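(* Let $\Gamma$ be a Fuchsian group with no elliptic nor parabolic element such that the quotient surface $S := \Gamma\backslash\mathbb{H}^2$ is geometrically infinite. If $S$ is weakly tame, then the horocycle flow $h_{\mathbb{R}}$ does not admit any minimal set on $T^1S$.
   Context: A Fuchsian group is a discrete subgroup $\Gamma$ of $\mathrm{PSL}_2(\mathbb{R})$, acting by orientation-preserving isometries on the hyperbolic plane $\mathbb{H}^2$ (upper half-plane model) and on its unit tangent bundle $T^1\mathbb{H}^2$. Set $T^1S := \Gamma\backslash(T^1\mathbb{H}^2)$. The surface $S$ is geometrically finite if its fundamental group is finitely generated, and geometrically infinite otherwise. $g_{\mathbb{R}}$ denotes the geodesic flow and $h_{\mathbb{R}}$ the horocycle flow, on $T^1\mathbb{H}^2$ and, by descent, on $T^1S$. For $\tilde u\in T^1\mathbb{H}^2$, $\tilde u^+\in\partial\mathbb{H}^2=\mathbb{R}\cup\{\infty\}$ is the endpoint of the half-geodesic $\{g_t\tilde u\}_{t\ge 0}$; the orbit $h_{\mathbb{R}}\tilde u$ consists of the unit vectors based on the horocycle centered at $\tilde u^+$ through the base point of $\tilde u$, and pointing towards $\tilde u^+$ (unit-speed parametrization of the horocycle). For $u\in T^1S$, $u(t)\in S$ denotes the base point of $g_tu$. For $p\in S$, the injectivity radius is $\mathrm{Inj}(p) := \min_{\gamma\in\Gamma,\ \gamma\neq \mathrm{id}} d(\tilde p,\gamma\tilde p)$, where $\tilde p$ is any lift of $p$ to $\mathbb{H}^2$. For $u\in T^1S$, $\underline{\mathrm{Inj}}(u(\mathbb{R}^+))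 := \liminf_{t\to+\infty}\mathrm{Inj}(u(t))$. The surface $S$ is weakly tame if $\underline{\mathrm{Inj}}(u(\mathbb{R}^+))<+\infty$ for every $u\in T^1S$. A minimal set for $h_{\mathbb{R}}$ is a non-empty closed $h_{\mathbb{R}}$-invariant subset of $T^1S$ containing no proper non-empty closed $h_{\mathbb{R}}$-invariant subset. *)

(* Defs.v *)
From HB Require Import structures.
From mathcomp Require Import all_boot all_order all_algebra.
From mathcomp Require Import generic_quotient.
From mathcomp Require Import all_classical all_reals all_analysis.
From mathcomp Require Import complex.
From mathcomp Require Import ring lra.

Set Implicit Arguments.
Unset Strict Implicit.
Unset Printing Implicit Defensive.

Import Order.TTheory GRing.Theory Num.Theory.
Import numFieldNormedType.Exports.
Import ComplexField.

Local Open Scope classical_set_scope.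
Local Open Scope quotient_scope.
Local Open Scope complex_scope.
Local Open Scope ring_scope.

Notation normc := Normc.normc.

(* R[i] carries no topology in the libraries: subtypes of R[i] and of
   R[i] * R[i] are topologized through their real coordinates. *)
Definition complex_coord (R : realType) (z : R[i]) : R * R :=
  (complex.Re z, complex.Im z).

Definition in_half_plane (R : realType) (z : R[i]) : bool :=
  0 < complex.Im z.

Definition half_plane (R : realType) : Type := {z : R[i] | in_half_plane z}.

HB.instance Definition _ (R : realType) :=
  [isSub of half_plane R for (@sval _ (fun z : R[i] => in_half_plane z))].
HB.instance Definition _ (R : realType) := [Choice of half_plane R by <:].
HB.instance Definition _ (R : realType) :=
  Topological.copy (half_plane R)
    (initial_topology (fun z : half_plane R => complex_coord (val z))).

(* A unit tangent vector is a pair (base point z, vector v) with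
   |v| / Im z = 1. *)
Definition in_unit_tangent (R : realType) (u : R[i] * R[i]) : bool :=
  in_half_plane u.1 && (normc u.2 == complex.Im u.1).

Definition unit_tangent (R : realType) : Type :=
  {u : R[i] * R[i] | in_unit_tangent u}.

HB.instance Definition _ (R : realType) :=
  [isSub of unit_tangent R for
    (@sval _ (fun u : R[i] * R[i] => in_unit_tangent u))].
HB.instance Definition _ (R : realType) := [Choice of unit_tangent R by <:].
HB.instance Definition _ (R : realType) :=
  Topological.copy (unit_tangent R)
    (initial_topology (fun u : unit_tangent R =>
       (complex_coord (val u).1, complex_coord (val u).2))).

Lemma base_point_subproof (R : realType) (u : unit_tangent R) :
  in_half_plane (val u).1.
Proof. by case/andP: (valP u). Qed.

Definition base_point (R : realType) (u : unit_tangent R) : half_plane R :=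
  Sub (val u).1 (base_point_subproof u).

Definition arcosh (R : realType) (x : R) : R := ln (x + Num.sqrt (x ^+ 2 - 1)).

Definition hdist (R : realType) (z w : R[i]) : R :=
  arcosh (1 + normc (z - w) ^+ 2 / (2 * complex.Im z * complex.Im w)).

Definition mobius_den (R : realType) (M : 'M[R]_2) (z : R[i]) : R[i] :=
  (M 1 0)%:C * z + (M 1 1)%:C.

Definition mobius (R : realType) (M : 'M[R]_2) (z : R[i]) : R[i] :=
  ((M 0 0)%:C * z + (M 0 1)%:C) / mobius_den M z.

(* The derivative of mobius M at z is (\det M) / mobius_den M z ^+ 2. *)
Definition mobius_tangent (R : realType) (M : 'M[R]_2) (u : R[i] * R[i]) :
    R[i] * R[i] :=
  (mobius M u.1, u.2 / mobius_den M u.1 ^+ 2).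

(* A subgroup of PSL_2(R) = SL_2(R) / {1, -1} is represented by its full
   preimage in SL_2(R), i.e. by a subgroup of SL_2(R) that contains -1; the
   former is discrete if and only if the latter is. *)
Record fuchsian (R : realType) := Fuchsian {
  fuchsian_set : set 'M[R]_2;
  fuchsian_det : forall M, fuchsian_set M -> \det M = 1;
  fuchsian1 : fuchsian_set 1%:M;
  fuchsianN : forall M, fuchsian_set M -> fuchsian_set (- M);
  fuchsianM : forall M N,
    fuchsian_set M -> fuchsian_set N -> fuchsian_set (M *m N);
  fuchsianV : forall M, fuchsian_set M -> fuchsian_set (invmx M);
  fuchsian_discrete : forall M, fuchsian_set M -> isolated fuchsian_set M
}.

Definition psl_trivial (R : realType) (M : 'M[R]_2) : Prop :=
  M = 1%:M \/ M = - 1%:M.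

Definition elliptic (R : realType) (M : 'M[R]_2) : Prop := `|\tr M| < 2.

Definition parabolic (R : realType) (M : 'M[R]_2) : Prop :=
  `|\tr M| = 2 /\ ~ psl_trivial M.

Lemma det_mx22E (R : comPzRingType) (M : 'M[R]_2) :
  \det M = M 0 0 * M 1 1 - M 0 1 * M 1 0.
Proof.
rewrite (expand_det_row M 0) !big_ord_recl big_ord0 addr0 /cofactor !det_mx11.
rewrite !mxE /= expr0 expr1 mul1r mulN1r mulrN.
have e01 : lift (ord0 : 'I_2) ord0 = 1 :> 'I_2 by exact/val_inj.
rewrite !e01; congr (_ - _ * M _ _); exact/val_inj.
Qed.

Lemma mobius_den_neq0 (R : realType) (M : 'M[R]_2) (z : R[i]) :
  \det M = 1 -> 0 < complex.Im z -> mobius_den M z != 0.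
Proof.
rewrite det_mx22E => dM; case: z => x y /= y0.
apply/eqP => /eqP; rewrite eq_complex /= !mul0r !subr0 !addr0 => /andP[/eqP h1].
rewrite mulf_eq0 (gt_eqF y0) orbF => /eqP c0.
move: h1; rewrite c0 mul0r add0r => d0.
by move: dM; rewrite c0 d0 !mulr0 subr0 => /eqP; rewrite eq_sym oner_eq0.
Qed.

Lemma mobius_denM (R : realType) (M N : 'M[R]_2) (z : R[i]) :
  mobius_den N z != 0 ->
  mobius_den (M *m N) z = mobius_den M (mobius N z) * mobius_den N z.
Proof.
rewrite /mobius => n0.
rewrite {1 2}/mobius_den mulrDl !mulrA -[_ * _^-1 * _]mulrA mulVf // mulr1.
rewrite /mobius_den !mxE !big_ord_recl !big_ord0 /=.
rewrite !addr0 !rmorphD !rmorphM /=.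
have -> : lift (ord0 : 'I_2) ord0 = 1 :> 'I_2 by exact/val_inj.
ring.
Qed.

Lemma mobiusM (R : realType) (M N : 'M[R]_2) (z : R[i]) :
  mobius_den N z != 0 -> mobius (M *m N) z = mobius M (mobius N z).
Proof.
move=> n0; rewrite {1}/mobius mobius_denM // {2}/mobius.
have -> : ((M *m N) 0 0)%:C * z + ((M *m N) 0 1)%:C =
  ((M 0 0)%:C * mobius N z + (M 0 1)%:C) * mobius_den N z.
  rewrite {1}/mobius mulrDl !mulrA -[_ * _^-1 * _]mulrA mulVf // mulr1.
  rewrite /mobius_den !mxE !big_ord_recl !big_ord0 /=.
  rewrite !addr0 !rmorphD !rmorphM /=.
  have -> : lift (ord0 : 'I_2) ord0 = 1 :> 'I_2 by exact/val_inj.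
  ring.
by rewrite -mulf_div divff // mulr1.
Qed.

Lemma mobius1 (R : realType) (z : R[i]) : mobius 1%:M z = z.
Proof.
by rewrite /mobius /mobius_den !mxE /= mulr0n !mulr1n !mul1r mul0r add0r addr0 divr1.
Qed.

Lemma mobius_tangentM (R : realType) (M N : 'M[R]_2) (u : R[i] * R[i]) :
  mobius_den N u.1 != 0 ->
  mobius_tangent (M *m N) u = mobius_tangent M (mobius_tangent N u).
Proof.
move=> n0; rewrite /mobius_tangent /= mobiusM // mobius_denM //.
by congr pair; rewrite exprMn invfM mulrA mulrAC.
Qed.

Lemma mobius_tangent1 (R : realType) (u : R[i] * R[i]) :
  mobius_tangent 1%:M u = u.
Proof.
case: u => z v; rewrite /mobius_tangent /= mobius1.
by rewrite /mobius_den !mxE /= mulr0n mulr1n mul0r add0r expr1n divr1.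
Qed.

Lemma fuchsian_unit (R : realType) (G : fuchsian R) M : fuchsian_set G M -> M \in unitmx.
Proof. by move=> /fuchsian_det dM; rewrite unitmxE dM unitr1. Qed.

Definition orbit_point (R : realType) (G : fuchsian R) :
    rel (half_plane R) :=
  fun z w => `[< exists2 M, fuchsian_set G M & mobius M (val z) = val w >].

Definition orbit_tangent (R : realType) (G : fuchsian R) :
    rel (unit_tangent R) :=
  fun u w => `[< exists2 M, fuchsian_set G M & mobius_tangent M (val u) = val w >].

Lemma orbit_point_refl (R : realType) (G : fuchsian R) :
  reflexive (orbit_point G).
Proof.
by move=> z; apply/asboolP; exists 1%:M; [exact: fuchsian1|exact: mobius1].
Qed.

Lemma orbit_point_sym (R : realType) (G : fuchsian R) :
  symmetric (orbit_point G).
Proof.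
suff H z w : orbit_point G z w -> orbit_point G w z.
  by move=> z w; apply/idP/idP; exact: H.
move=> /asboolP[M GM zw]; apply/asboolP; exists (invmx M).
  exact: fuchsianV.
rewrite -zw -mobiusM ?mulVmx ?mobius1 ?(fuchsian_unit GM)//.
by apply: mobius_den_neq0; [exact: (fuchsian_det GM)|exact: (valP z)].
Qed.

Lemma orbit_point_trans (R : realType) (G : fuchsian R) :
  transitive (orbit_point G).
Proof.
move=> w z t /asboolP[M GM zw] /asboolP[N GN wt]; apply/asboolP.
exists (N *m M); first exact: fuchsianM.
rewrite mobiusM ?zw//.
by apply: mobius_den_neq0; [exact: (fuchsian_det GM)|exact: (valP z)].
Qed.

Lemma orbit_tangent_refl (R : realType) (G : fuchsian R) :
  reflexive (orbit_tangent G).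
Proof.
move=> u; apply/asboolP.
by exists 1%:M; [exact: fuchsian1|exact: mobius_tangent1].
Qed.

Lemma orbit_tangent_sym (R : realType) (G : fuchsian R) :
  symmetric (orbit_tangent G).
Proof.
suff H u w : orbit_tangent G u w -> orbit_tangent G w u.
  by move=> u w; apply/idP/idP; exact: H.
move=> /asboolP[M GM uw]; apply/asboolP; exists (invmx M).
  exact: fuchsianV.
rewrite -uw -mobius_tangentM ?mulVmx ?mobius_tangent1 ?(fuchsian_unit GM)//.
by apply: mobius_den_neq0; [exact: (fuchsian_det GM)|case/andP: (valP u)].
Qed.

Lemma orbit_tangent_trans (R : realType) (G : fuchsian R) :
  transitive (orbit_tangent G).
Proof.
move=> w u t /asboolP[M GM uw] /asboolP[N GN wt]; apply/asboolP.
exists (N *m M); first exact: fuchsianM.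
rewrite mobius_tangentM ?uw//.
by apply: mobius_den_neq0; [exact: (fuchsian_det GM)|case/andP: (valP u)].
Qed.

Canonical orbit_point_equiv (R : realType) (G : fuchsian R) :=
  EquivRel (orbit_point G) (@orbit_point_refl R G) (@orbit_point_sym R G)
    (@orbit_point_trans R G).

Canonical orbit_tangent_equiv (R : realType) (G : fuchsian R) :=
  EquivRel (orbit_tangent G) (@orbit_tangent_refl R G)
    (@orbit_tangent_sym R G) (@orbit_tangent_trans R G).

Notation surface G := (quotient_topology {eq_quot orbit_point G}).
Notation unit_tangent_surface G :=
  (quotient_topology {eq_quot orbit_tangent G}).

(* Inverse Cayley transform: the isometry from the Poincare disc onto the
   half-plane that maps 0 to z and has derivative 2 i Im z at 0. *)
Definition disc_chart (R : realType) (z zeta : R[i]) : R[i] :=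
  (z - zeta * z^*) / (1 - zeta).

(* The direction at 0, of modulus 1, of the vector that corresponds to u in
   the chart disc_chart u.1. *)
Definition disc_direction (R : realType) (u : R[i] * R[i]) : R[i] :=
  u.2 / ('i * (complex.Im u.1)%:C).

(* In the chart, the geodesic from 0 with direction e is
   t |-> tanh (t / 2) * e. *)
Definition geodesic_flow_raw (R : realType) (t : R) (u : R[i] * R[i]) :
    R[i] * R[i] :=
  let T := (expR t - 1) / (expR t + 1) in
  let zeta := T%:C * disc_direction u in
  (disc_chart u.1 zeta, (1 - T ^+ 2)%:C * u.2 / (1 - zeta) ^+ 2).

(* For u = ('i, 'i), which points to oo, the horocycle is s |-> 'i + s, with
   vectors 'i: in the chart, s |-> s / (s + 2 'i). For other directions this is
   rotated about 0.
   Both flows commute with mobius_tangent M (geodesic_flow_mobius,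
   horocycle_flow_mobius below), and SL_2(R) is transitive on unit tangent
   vectors, so they are determined by their values at ('i, 'i), which are
   given by geodesic_flow_up and horocycle_flow_up. *)
Definition horocycle_flow_raw (R : realType) (s : R) (u : R[i] * R[i]) :
    R[i] * R[i] :=
  let zeta := s%:C / (s +i* 2) * disc_direction u in
  (disc_chart u.1 zeta, - 4 * u.2 / ((s +i* 2) ^+ 2 * (1 - zeta) ^+ 2)).

Lemma normc_ge0 (R : realType) (z : R[i]) : 0 <= normc z.
Proof. by case: z => a b; exact: sqrtr_ge0. Qed.

Lemma normc_sqr (R : realType) (z : R[i]) :
  normc z ^+ 2 = complex.Re z ^+ 2 + complex.Im z ^+ 2.
Proof. by case: z => a b /=; rewrite sqr_sqrtr// addr_ge0 ?sqr_ge0. Qed.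

Lemma normc_real (R : realType) (x : R) : normc x%:C = `|x|.
Proof. by rewrite /= expr0n addr0 sqrtr_sqr. Qed.

Lemma normc_i (R : realType) : normc ('i : R[i]) = 1.
Proof. by rewrite /= expr0n add0r expr1n sqrtr1. Qed.

Lemma normc_conj (R : realType) (z : R[i]) : normc z^* = normc z.
Proof. by case: z => a b /=; rewrite sqrrN. Qed.

Lemma normcX (R : realType) (z : R[i]) n : normc (z ^+ n) = normc z ^+ n.
Proof.
elim: n => [|n ih]; first by rewrite !expr0 Normc.normc1.
by rewrite !exprS Normc.normcM ih.
Qed.

Lemma normc_lt1_neq0 (R : realType) (zeta : R[i]) :
  normc zeta < 1 -> 1 - zeta != 0.
Proof.
apply: contraTneq => /eqP; rewrite subr_eq0 => /eqP <-.
by rewrite Normc.normc1 ltxx.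
Qed.

Lemma disc_chart_Im (R : realType) (z zeta : R[i]) : 1 - zeta != 0 ->
  complex.Im (disc_chart z zeta) =
  complex.Im z * (1 - normc zeta ^+ 2) / normc (1 - zeta) ^+ 2.
Proof.
rewrite !normc_sqr; case: z => x y; case: zeta => a b.
rewrite eq_complex /= negb_and => h.
have h0 : (1 - a) ^+ 2 + (0 - b) ^+ 2 != 0.
  rewrite paddr_eq0 ?sqr_ge0// !sqrf_eq0 negb_and.
  by move: h; rewrite ?add0r ?sub0r.
rewrite ?add0r ?sub0r in h0 *; field.
by move: h0; rewrite sqrrN.
Qed.

Lemma disc_chart_unit_tangent (R : realType) (z v zeta : R[i]) :
  in_half_plane z -> normc zeta < 1 ->
  normc v * normc (1 - zeta) ^+ 2 = complex.Im z * (1 - normc zeta ^+ 2) ->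
  in_unit_tangent (disc_chart z zeta, v).
Proof.
move=> z0 z1 hv; have n0 := normc_lt1_neq0 z1.
have n1 : 0 < normc (1 - zeta).
  rewrite lt0r normc_ge0 andbT.
  by apply: contraNneq n0 => /Normc.eq0_normc ->.
rewrite /in_unit_tangent /in_half_plane /= disc_chart_Im //.
apply/andP; split.
  rewrite divr_gt0 ?exprn_gt0// mulr_gt0// subr_gt0 expr_lt1//.
  exact: normc_ge0.
by rewrite -hv mulfK// expf_neq0// gt_eqF.
Qed.

Lemma normc_disc_direction (R : realType) (u : R[i] * R[i]) :
  in_unit_tangent u -> normc (disc_direction u) = 1.
Proof.
move=> /andP[u0 /eqP u1]; rewrite /disc_direction Normc.normcM Normc.normcV.
rewrite Normc.normcM normc_i normc_real mul1r u1 ger0_norm ?ltW// divff//.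
by rewrite gt_eqF.
Qed.

Lemma tanh_half_lt1 (R : realType) (t : R) :
  `|(expR t - 1) / (expR t + 1)| < 1.
Proof.
have e0 := expR_gt0 t; have e1 : 0 < expR t + 1 by rewrite addr_gt0.
by rewrite ltr_norml ltr_pdivlMr// ltr_pdivrMr//; apply/andP; split; lra.
Qed.

Lemma normc_horo (R : realType) (s : R) : normc (s +i* 2) ^+ 2 = s ^+ 2 + 4.
Proof. by rewrite normc_sqr /=; ring. Qed.

Lemma geodesic_flow_subproof (R : realType) (t : R) (u : unit_tangent R) :
  in_unit_tangent (geodesic_flow_raw t (val u)).
Proof.
have uu : in_unit_tangent (val u) := valP u; move: (uu) => /andP[u0 /eqP u1].
rewrite /geodesic_flow_raw; set T := _ / (expR t + 1).
have T1 : `|T| < 1 by exact: tanh_half_lt1.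
set zeta := T%:C * _.
have nz : normc zeta = `|T|.
  by rewrite Normc.normcM normc_real normc_disc_direction// mulr1.
have n0 : normc (1 - zeta) != 0.
  apply: contraNneq (@normc_lt1_neq0 _ zeta _) => [/Normc.eq0_normc -> //|].
  by rewrite nz.
apply: disc_chart_unit_tangent => //; first by rewrite nz.
rewrite Normc.normcM Normc.normcV normcX divfK ?expf_neq0//.
rewrite Normc.normcM normc_real u1 nz real_normK ?num_real// mulrC.
congr (_ * _); rewrite ger0_norm// subr_ge0 ltW//.
by rewrite -real_normK ?num_real// expr_lt1.
Qed.

Definition geodesic_flow (R : realType) (t : R) (u : unit_tangent R) :
    unit_tangent R := Sub _ (geodesic_flow_subproof t u).

Lemma normc_horocycle_coord (R : realType) (s : R) (u : R[i] * R[i]) :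
  in_unit_tangent u ->
  normc (s%:C / (s +i* 2) * disc_direction u) ^+ 2 = s ^+ 2 / (s ^+ 2 + 4).
Proof.
move=> uu; rewrite Normc.normcM Normc.normcM normc_disc_direction// mulr1.
by rewrite exprMn normc_real real_normK ?num_real// Normc.normcV exprVn normc_horo.
Qed.

Lemma normc_horocycle_coord_lt1 (R : realType) (s : R) (u : R[i] * R[i]) :
  in_unit_tangent u -> normc (s%:C / (s +i* 2) * disc_direction u) < 1.
Proof.
move=> uu; rewrite -(@expr_lt1 _ 2)// ?normc_ge0// normc_horocycle_coord//.
have s4 : 0 < s ^+ 2 + 4 by rewrite ltr_wpDl ?sqr_ge0.
by rewrite ltr_pdivrMr// mul1r ltrDl.
Qed.

Lemma horocycle_flow_subproof (R : realType) (s : R) (u : unit_tangent R) :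
  in_unit_tangent (horocycle_flow_raw s (val u)).
Proof.
have uu : in_unit_tangent (val u) := valP u; move: (uu) => /andP[u0 /eqP u1].
have nz := normc_horocycle_coord s uu.
rewrite /horocycle_flow_raw; move: nz; set zeta := _ * disc_direction _ => nz.
have s4 : 0 < s ^+ 2 + 4 by rewrite ltr_wpDl ?sqr_ge0.
have z1 : normc zeta < 1 by exact: normc_horocycle_coord_lt1.
have n0 : normc (1 - zeta) != 0.
  by apply: contraNneq (normc_lt1_neq0 z1) => /Normc.eq0_normc ->.
apply: disc_chart_unit_tangent => //.
rewrite 2!Normc.normcM Normc.normcV Normc.normcM !normcX normc_horo u1 nz.
have -> : normc (- 4 : R[i]) = 4.
  have -> : (- 4 : R[i]) = (- 4)%:C by rewrite rmorphN rmorph_nat.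
  by rewrite normc_real normrN ger0_norm.
by field; rewrite n0 gt_eqF.
Qed.

Definition horocycle_flow (R : realType) (s : R) (u : unit_tangent R) :
    unit_tangent R := Sub _ (horocycle_flow_subproof s u).

Lemma geodesic_flow_up (R : realType) (t : R) :
  geodesic_flow_raw t ('i, 'i) = (0 +i* expR t, 0 +i* expR t).
Proof.
have e0 := expR_gt0 t; have e1 : 0 < expR t + 1 by rewrite addr_gt0.
rewrite /geodesic_flow_raw /disc_chart /disc_direction.
congr pair; apply/eqP; rewrite eq_complex; apply/andP; split; apply/eqP => /=.
all: field.
all: by rewrite !gt_eqF //; lra.
Qed.

Lemma horocycle_flow_up (R : realType) (s : R) :
  horocycle_flow_raw s ('i, 'i) = (s +i* 1, 'i).
Proof.
have i0 : 'i != 0 :> R[i] by rewrite eq_complex /= oner_eq0 andbF.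
have sE : s +i* 2 = s%:C + 2 * 'i :> R[i].
  by apply/eqP; rewrite eq_complex /=; apply/andP; split; apply/eqP; ring.
have s0 : s%:C + 2 * 'i != 0 :> R[i].
  by rewrite -sE eq_complex /= (pnatr_eq0 _ 2) andbF.
have d0 : s%:C + 2 * 'i - s%:C != 0 :> R[i].
  by rewrite addrC addKr mulf_neq0// pnatr_eq0.
rewrite /horocycle_flow_raw /disc_chart /disc_direction /= sE mulr1 divff//.
have cE : 'i^* = - 'i :> R[i] by apply/eqP; rewrite eq_complex /= oppr0 !eqxx.
rewrite mulr1 cE; congr pair.
  have -> : s +i* 1 = s%:C + 'i.
    by apply/eqP; rewrite eq_complex /=; apply/andP; split; apply/eqP; ring.
  field.
by rewrite s0 d0.
transitivity (- ('i : R[i])^-1).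
  field.
by rewrite i0 s0 d0.
by apply: (mulIf i0); rewrite mulNr mulVf// -expr2 sqr_i.
Qed.

Lemma conj_affine (R : realType) (a b : R) (z : R[i]) :
  (a%:C * z + b%:C)^* = a%:C * z^* + b%:C.
Proof.
case: z => x y; apply/eqP; rewrite eq_complex /=.
by apply/andP; split; apply/eqP; ring.
Qed.

Lemma mobius_den_conj (R : realType) (M : 'M[R]_2) (z : R[i]) :
  (mobius_den M z)^* = mobius_den M z^*.
Proof. exact: conj_affine. Qed.

Lemma mobius_conj (R : realType) (M : 'M[R]_2) (z : R[i]) :
  (mobius M z)^* = mobius M z^*.
Proof. by rewrite /mobius fmorph_div /= conj_affine mobius_den_conj. Qed.

Lemma mobius_Im (R : realType) (M : 'M[R]_2) (z : R[i]) :
  \det M = 1 -> in_half_plane z ->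
  (complex.Im (mobius M z))%:C =
  (complex.Im z)%:C / (mobius_den M z * (mobius_den M z)^*).
Proof.
move=> dM z0; have n0 : mobius_den M z != 0 by exact: mobius_den_neq0.
have n1 : mobius_den M z^* != 0 by rewrite -mobius_den_conj conjc_eq0.
have ImE (w : R[i]) : (complex.Im w)%:C = (w^* - w) / 2 * 'i.
  exact: ImJ_sub.
rewrite !ImE mobius_conj mobius_den_conj.
have dC : (M 0 0)%:C * (M 1 1)%:C - (M 0 1)%:C * (M 1 0)%:C = 1 :> R[i].
  by rewrite -!rmorphM -rmorphB /= -det_mx22E dM.
rewrite -[in RHS](mul1r (z^* - z)) -dC; move: n0 n1; rewrite /mobius /mobius_den.
move: (z^*) => zb n0 n1; field.
by apply/and3P; split; [exact: n1|exact: n0|rewrite [X in X != 0]dC oner_eq0].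
Qed.

Lemma disc_direction_mobius (R : realType) (M : 'M[R]_2) (u : R[i] * R[i]) :
  \det M = 1 -> in_half_plane u.1 ->
  disc_direction (mobius_tangent M u) =
  disc_direction u * ((mobius_den M u.1)^* / mobius_den M u.1).
Proof.
move=> dM z0; have n0 : mobius_den M u.1 != 0 by exact: mobius_den_neq0.
have n1 : (mobius_den M u.1)^* != 0 by rewrite conjc_eq0.
have y0 : (complex.Im u.1)%:C != 0.
  by rewrite -(rmorph0 (real_complex R)) (inj_eq (@complexI R)) gt_eqF.
have i0 : 'i != 0 :> R[i] by rewrite eq_complex /= oner_eq0 andbF.
rewrite /disc_direction /mobius_tangent /= mobius_Im//.
by field; rewrite i0 y0 n0 n1.
Qed.

Lemma disc_chart_mobius (R : realType) (M : 'M[R]_2) (z zeta : R[i]) :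
  \det M = 1 -> in_half_plane z -> normc zeta < 1 ->
  let zeta' := zeta * ((mobius_den M z)^* / mobius_den M z) in
  disc_chart (mobius M z) zeta' = mobius M (disc_chart z zeta) /\
  mobius_den M z * (1 - zeta') =
  mobius_den M (disc_chart z zeta) * (1 - zeta).
Proof.
move=> dM z0 z1 zeta'; have n0 : mobius_den M z != 0 by exact: mobius_den_neq0.
have n1 : (mobius_den M z)^* != 0 by rewrite conjc_eq0.
have m0 := normc_lt1_neq0 z1.
have m1 : 1 - zeta' != 0.
  apply: normc_lt1_neq0; rewrite Normc.normcM Normc.normcM normc_conj Normc.normcV.
  rewrite divff ?mulr1//; apply: contraNneq n0 => /Normc.eq0_normc -> //.
have E : mobius_den M z * (1 - zeta') =
    mobius_den M (disc_chart z zeta) * (1 - zeta).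
  have -> : mobius_den M z * (1 - zeta') =
      mobius_den M z - zeta * (mobius_den M z)^*.
    by rewrite /zeta'; field.
  by rewrite mobius_den_conj /mobius_den /disc_chart; field.
split=> //.
have m2 : mobius_den M (disc_chart z zeta) != 0.
  by have := mulf_neq0 n0 m1; rewrite E mulf_eq0 negb_or => /andP[].
have E' : ((M 0 0)%:C * disc_chart z zeta + (M 0 1)%:C) * (1 - zeta) =
    (mobius M z - zeta' * mobius M z^*) * mobius_den M z.
  rewrite /zeta' mobius_den_conj; move: n1; rewrite mobius_den_conj => n1.
  rewrite /mobius; move: (mobius_den M z) (mobius_den M z^*) n0 n1 => d d' n0 n1.
  rewrite /disc_chart; field.
  by rewrite n0 n1 m0.
rewrite [RHS]/mobius -[RHS]mulr1 -(divff m0) mulf_div E' -E invfM mulrA mulfK//.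
by rewrite -mobius_conj.
Qed.

Lemma geodesic_flow_mobius (R : realType) (M : 'M[R]_2) (t : R)
    (u : R[i] * R[i]) :
  \det M = 1 -> in_unit_tangent u ->
  geodesic_flow_raw t (mobius_tangent M u) =
  mobius_tangent M (geodesic_flow_raw t u).
Proof.
move=> dM uu; have /andP[u0 _] := uu.
have n0 : mobius_den M u.1 != 0 by exact: mobius_den_neq0.
rewrite /geodesic_flow_raw disc_direction_mobius//.
set T := (_ / (expR t + 1)).
have z1 : normc (T%:C * disc_direction u) < 1.
  by rewrite Normc.normcM normc_real normc_disc_direction// mulr1 tanh_half_lt1.
have [e1 e2] := disc_chart_mobius dM u0 z1.
rewrite mulrA /mobius_tangent /= e1; congr pair.
rewrite mulrA -[LHS]mulrA -[RHS]mulrA -!invfM -!exprMn e2.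
by rewrite [(1 - _) * _]mulrC.
Qed.

Lemma horocycle_flow_mobius (R : realType) (M : 'M[R]_2) (s : R)
    (u : R[i] * R[i]) :
  \det M = 1 -> in_unit_tangent u ->
  horocycle_flow_raw s (mobius_tangent M u) =
  mobius_tangent M (horocycle_flow_raw s u).
Proof.
move=> dM uu; have /andP[u0 _] := uu.
have n0 : mobius_den M u.1 != 0 by exact: mobius_den_neq0.
have z1 : normc (s%:C / (s +i* 2) * disc_direction u) < 1.
  exact: normc_horocycle_coord_lt1.
rewrite /horocycle_flow_raw disc_direction_mobius//.
have [e1 e2] := disc_chart_mobius dM u0 z1.
rewrite mulrA /mobius_tangent /= e1; congr pair.
rewrite mulrA -[LHS]mulrA -[RHS]mulrA -!invfM mulrCA -exprMn e2 exprMn -mulrA.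
have swap (a b c d e : R[i]) : a * (b / (c * (d * e))) = a * b / (c * e * d).
  by rewrite mulrA -(mulrA c) (mulrC d).
exact: swap.
Qed.

(* The choice of the representative is immaterial: see the lemmas
   surface_geodesic_flow_pi, surface_horocycle_flow_pi and
   surface_base_point_pi. *)
Definition surface_geodesic_flow (R : realType) (G : fuchsian R) (t : R)
    (u : unit_tangent_surface G) : unit_tangent_surface G :=
  \pi_(unit_tangent_surface G) (geodesic_flow t (repr u)).

Definition surface_horocycle_flow (R : realType) (G : fuchsian R) (s : R)
    (u : unit_tangent_surface G) : unit_tangent_surface G :=
  \pi_(unit_tangent_surface G) (horocycle_flow s (repr u)).

Definition surface_base_point (R : realType) (G : fuchsian R)
    (u : unit_tangent_surface G) : surface G :=
  \pi_(surface G) (base_point (repr u)).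

Lemma repr_pi_orbit_tangent (R : realType) (G : fuchsian R)
    (u : unit_tangent R) :
  exists2 M, fuchsian_set G M &
    mobius_tangent M (val u) = val (repr (\pi_(unit_tangent_surface G) u)).
Proof.
have : \pi_(unit_tangent_surface G) u =
    \pi_(unit_tangent_surface G) (repr (\pi_(unit_tangent_surface G) u)).
  by rewrite reprK.
by move=> /(@eqmodP _ (orbit_tangent_equiv G)) /asboolP.
Qed.

Lemma surface_geodesic_flow_pi (R : realType) (G : fuchsian R) (t : R)
    (u : unit_tangent R) :
  surface_geodesic_flow t (\pi_(unit_tangent_surface G) u) =
  \pi_(unit_tangent_surface G) (geodesic_flow t u).
Proof.
have [M GM Mu] := repr_pi_orbit_tangent G u.
apply/esym/(@eqmodP _ (orbit_tangent_equiv G)).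
apply/asboolP; exists M => //=; rewrite -Mu geodesic_flow_mobius//.
- exact: fuchsian_det GM.
- exact: (valP u).
Qed.

Lemma surface_horocycle_flow_pi (R : realType) (G : fuchsian R) (s : R)
    (u : unit_tangent R) :
  surface_horocycle_flow s (\pi_(unit_tangent_surface G) u) =
  \pi_(unit_tangent_surface G) (horocycle_flow s u).
Proof.
have [M GM Mu] := repr_pi_orbit_tangent G u.
apply/esym/(@eqmodP _ (orbit_tangent_equiv G)).
apply/asboolP; exists M => //=; rewrite -Mu horocycle_flow_mobius//.
- exact: fuchsian_det GM.
- exact: (valP u).
Qed.

Lemma surface_base_point_pi (R : realType) (G : fuchsian R)
    (u : unit_tangent R) :
  surface_base_point (\pi_(unit_tangent_surface G) u) =
  \pi_(surface G) (base_point u).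
Proof.
have [M GM Mu] := repr_pi_orbit_tangent G u.
apply/esym/(@eqmodP _ (orbit_point_equiv G)).
by apply/asboolP; exists M => //=; rewrite -Mu.
Qed.

(* With values in \bar R, so that Inj is +oo when G is trivial in PSL_2(R). *)
Definition inj_radius (R : realType) (G : fuchsian R) (p : surface G) :
    \bar R :=
  ereal_inf [set (hdist (val (repr p)) (mobius M (val (repr p))))%:E |
             M in [set M | fuchsian_set G M /\ ~ psl_trivial M]].

Definition liminf_inj_radius (R : realType) (G : fuchsian R)
    (u : unit_tangent_surface G) : \bar R :=
  limf_einf (fun t : R =>
    inj_radius (surface_base_point (surface_geodesic_flow t u)))
    (pinfty_nbhs R).

Definition weakly_tame (R : realType) (G : fuchsian R) : Prop :=
  forall u : unit_tangent_surface G, (liminf_inj_radius u < +oo)%E.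

Definition is_loop (R : realType) (X : topologicalType) (p : X) (f : R -> X) :
    Prop :=
  {within `[0, 1], continuous f} /\ f 0 = p /\ f 1 = p.

Definition loop_inverse (R : realType) (X : Type) (f : R -> X) : R -> X :=
  fun t => f (1 - t).

Definition loop_concat (R : realType) (X : Type) (f g : R -> X) : R -> X :=
  fun t => if t <= 2^-1 then f (2 * t) else g (2 * t - 1).

Definition loop_homotopic (R : realType) (X : topologicalType) (p : X)
    (f g : R -> X) : Prop :=
  exists H : R * R -> X,
    [/\ {within `[0, 1] `*` `[0, 1], continuous H},
        forall t, t \in `[0, 1] -> H (0, t) = f t,
        forall t, t \in `[0, 1] -> H (1, t) = g t &
        forall s, s \in `[0, 1] -> H (s, 0) = p /\ H (s, 1) = p].

(* The loops at p whose homotopy classes belong to the subgroup of the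
   fundamental group at p generated by the classes of the loops g i. *)
Inductive loop_generated (R : realType) (X : topologicalType) (p : X) (n : nat)
    (g : 'I_n -> R -> X) : (R -> X) -> Prop :=
| loop_generated_gen i : loop_generated p g (g i)
| loop_generated_one : loop_generated p g (fun=> p)
| loop_generated_inv f :
    loop_generated p g f -> loop_generated p g (loop_inverse f)
| loop_generated_mul f1 f2 :
    loop_generated p g f1 -> loop_generated p g f2 ->
    loop_generated p g (loop_concat f1 f2)
| loop_generated_homotopic f1 f2 :
    loop_generated p g f1 -> loop_homotopic p f1 f2 ->
    loop_generated p g f2.

Definition fg_fundamental_group (R : realType) (X : topologicalType) (p : X) :
    Prop :=
  exists n (g : 'I_n -> R -> X),
    (forall i, is_loop p (g i)) /\
    forall f : R -> X, is_loop p f -> loop_generated p g f.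

Definition geometrically_finite (R : realType) (G : fuchsian R) : Prop :=
  forall p : surface G, fg_fundamental_group R p.

Definition horocycle_invariant (R : realType) (G : fuchsian R)
    (A : set (unit_tangent_surface G)) : Prop :=
  forall s u, A u -> A (surface_horocycle_flow s u).

Definition nonempty_closed_invariant (R : realType) (G : fuchsian R)
    (A : set (unit_tangent_surface G)) : Prop :=
  [/\ A !=set0, closed A & horocycle_invariant A].

Definition minimal_horocycle_set (R : realType) (G : fuchsian R)
    (A : set (unit_tangent_surface G)) : Prop :=
  nonempty_closed_invariant A /\
  forall B : set (unit_tangent_surface G), ~ (nonempty_closed_invariant B /\ B `<` A).

(* Main.v *)
Require Import Defs.
From mathcomp Require Import all_boot all_order all_algebra.
From mathcomp Require Import generic_quotient.
From mathcomp Require Import all_classical all_reals all_analysis.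
From mathcomp Require Import complex.
From mathcomp Require Import ring lra.

Set Implicit Arguments.
Unset Strict Implicit.
Unset Printing Implicit Defensive.

Import Order.TTheory GRing.Theory Num.Theory.
Import numFieldNormedType.Exports.

Local Open Scope classical_set_scope.
Local Open Scope quotient_scope.
Local Open Scope complex_scope.
Local Open Scope ring_scope.

(** Why there is no minimal set. Write a unit tangent vector as a frame [g] of
    [SL_2(R)]. Moving along its horocycle adds a multiple of the first column
    of [g] to the second one, and the geodesic flow rescales the first column.
    Hence closed invariant sets of the horocycle flow on the unit tangent
    bundle are the same thing as sets of nonzero vectors of the plane that are
    invariant under the linear action of the group and closed away from 0
    ([frame_vectors], [vectors_invariant_closed]). Let [V] be the set of
    vectors of a minimal set.

    Scaling. Weak tameness yields, along each geodesic ray, nontrivial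
    elements that move far points of the ray by a bounded distance. In the
    basis given by the frame of the ray, they have bounded diagonal entries
    and a lower left entry that tends to 0 and becomes negligible compared
    with the upper right one. Squaring such an element until a diagonal entry
    exceeds 2 produces elements that send the first basis vector [v] close to
    [a v], with the absolute value of [a] between 2 and a constant, unless
    some element fixes the line of [v] and so multiplies [v] by a factor other
    than 1 and -1 ([axis_dichotomy]). Either way [V] contains two vectors of
    different lengths on one line ([recurrent_scaling]), and minimality makes
    [V] invariant under the corresponding homothety and its inverse
    ([vectors_scaling]).

    Directions. Invariance under a homothety makes the set of directions of
    [V] closed. If a direction were missed, the elements found above for it
    would be confined to a finite set, which their small lower left entries
    forbid, or else [V] would lie on a single line; in the latter case the
    group preserves a line and contains a parabolic commutator. So [V] meets
    all directions ([all_directions]).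

    Contraction. By its homothety [V] contains arbitrarily short vectors, and
    by minimality the group can shorten all vectors of [V] as much as one
    likes ([vectors_shrink]), hence halve the length of any vector of the
    plane ([minimal_contraction]). By compactness of the circle finitely many
    elements suffice. Then bounded elements of the group bring every matrix of
    determinant 1 back to a bounded set, and by discreteness the group is
    generated by finitely many elements ([contraction_generated]).

    Topology. As nontrivial elements are hyperbolic, the group acts freely and
    properly discontinuously, so loops of the surface lift to paths
    ([path_lifting]). As the half-plane is convex, a loop is determined up to
    homotopy by the end point of its lift, that is by an element of the group;
    loops of generators generate, and the surface would be geometrically
    finite ([finitely_generated_geometrically_finite]). *)

(** * Two by two matrices *)

Section Matrices.
Context {R : realType}.
Implicit Types (M N g h : 'M[R]_2) (v w : R * R).

Definition mx2 (a b c d : R) : 'M[R]_2 :=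
  \matrix_(i, j) if i == 0 then (if j == 0 then a else b)
                 else (if j == 0 then c else d).

Lemma mx2E a b c d :
  ((mx2 a b c d 0 0 = a) * (mx2 a b c d 0 1 = b)) *
  ((mx2 a b c d 1 0 = c) * (mx2 a b c d 1 1 = d)).
Proof. by rewrite !mxE. Qed.

Lemma ord2P (P : 'I_2 -> Prop) : P 0 -> P 1 -> forall i, P i.
Proof.
move=> P0 P1 i; case: (unliftP ord0 i) => [j ->|-> //].
by rewrite (_ : lift ord0 j = 1) //; apply/val_inj; rewrite /= ord1.
Qed.

Lemma mx2P M N : M 0 0 = N 0 0 -> M 0 1 = N 0 1 -> M 1 0 = N 1 0 ->
  M 1 1 = N 1 1 -> M = N.
Proof.
move=> h1 h2 h3 h4; apply/matrixP.
by apply: ord2P; apply: ord2P.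
Qed.

Lemma mulmx2E M N i j : (M *m N) i j = M i 0 * N 0 j + M i 1 * N 1 j.
Proof.
rewrite !mxE !big_ord_recl big_ord0 addr0; congr (_ + M _ _ * N _ _).
  exact/val_inj.
exact/val_inj.
Qed.

Lemma tr_mx2E M : \tr M = M 0 0 + M 1 1.
Proof.
rewrite /mxtrace !big_ord_recl big_ord0 addr0; congr (_ + M _ _);
  exact/val_inj.
Qed.

Lemma det_mx2 a b c d : \det (mx2 a b c d) = a * d - b * c.
Proof. by rewrite det_mx22E !mx2E. Qed.

Lemma mx1E : (((1%:M : 'M[R]_2) 0 0 = 1) * ((1%:M : 'M[R]_2) 0 1 = 0)) *
  (((1%:M : 'M[R]_2) 1 0 = 0) * ((1%:M : 'M[R]_2) 1 1 = 1)).
Proof. by rewrite !mxE. Qed.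

Lemma det1_unit M : \det M = 1 -> M \in unitmx.
Proof. by rewrite unitmxE => ->; rewrite unitr1. Qed.

Lemma invmx_det1 M : \det M = 1 ->
  invmx M = mx2 (M 1 1) (- M 0 1) (- M 1 0) (M 0 0).
Proof.
move=> dM; have uM := det1_unit dM; apply: (can_inj (mulKmx uM)).
rewrite mulmxV //; rewrite det_mx22E in dM.
apply: mx2P; rewrite mulmx2E !mx2E !mx1E; lra.
Qed.

Lemma det_invmx1 M : \det M = 1 -> \det (invmx M) = 1.
Proof. by rewrite det_inv => ->; rewrite invr1. Qed.

Lemma det_mul1 M N : \det M = 1 -> \det N = 1 -> \det (M *m N) = 1.
Proof. by rewrite det_mulmx => -> ->; rewrite mulr1. Qed.

Lemma invmx_mul1 M N : \det M = 1 -> \det N = 1 ->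
  invmx (M *m N) = invmx N *m invmx M.
Proof.
move=> dM dN; have uu := det1_unit (det_mul1 dM dN).
apply: (can_inj (mulKmx uu)).
by rewrite mulmxV // !mulmxA mulmxK ?det1_unit // mulmxV ?det1_unit.
Qed.

Lemma psl_trivial_tr M : psl_trivial M -> `|\tr M| = 2.
Proof.
by case=> ->; rewrite tr_mx2E ?mxE /= ?mxE -?opprD ?normrN ger0_norm // ; lra.
Qed.

Definition bounded_by (C : R) M := forall i j, `|M i j| <= C.

Lemma bounded_byP C M : `|M 0 0| <= C -> `|M 0 1| <= C -> `|M 1 0| <= C ->
  `|M 1 1| <= C -> bounded_by C M.
Proof. by move=> h1 h2 h3 h4; apply: ord2P; apply: ord2P. Qed.

Lemma bounded_by_mul C D M N : bounded_by C M -> bounded_by D N ->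
  bounded_by (2 * C * D) (M *m N).
Proof.
move=> hM hN i j; rewrite mulmx2E (le_trans (ler_normD _ _)) // !normrM.
have -> : 2 * C * D = C * D + C * D by ring.
by apply: lerD; apply: ler_pM.
Qed.

Lemma bounded_by_inv C M : \det M = 1 -> bounded_by C M ->
  bounded_by C (invmx M).
Proof.
by move=> dM hM; rewrite invmx_det1 //; apply: bounded_byP;
  rewrite mx2E ?normrN; exact: hM.
Qed.

Lemma bounded_by_exists M : exists C, bounded_by C M.
Proof.
exists (`|M 0 0| + `|M 0 1| + `|M 1 0| + `|M 1 1|).
have := (normr_ge0 (M 0 0), normr_ge0 (M 0 1), normr_ge0 (M 1 0),
  normr_ge0 (M 1 1)).
by move=> [[[? ?] ?] ?]; apply: bounded_byP; lra.
Qed.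

Definition act M v : R * R :=
  (M 0 0 * v.1 + M 0 1 * v.2, M 1 0 * v.1 + M 1 1 * v.2).

Lemma actM M N v : act (M *m N) v = act M (act N v).
Proof. by rewrite /act !mulmx2E /=; congr pair; ring. Qed.

Lemma act1 v : act 1%:M v = v.
Proof. by rewrite /act !mx1E !mul1r !mul0r addr0 add0r; case: v. Qed.

Lemma actK M : \det M = 1 -> cancel (act M) (act (invmx M)).
Proof. by move=> dM v; rewrite -actM mulVmx ?act1 // det1_unit. Qed.

Lemma actKV M : \det M = 1 -> cancel (act (invmx M)) (act M).
Proof. by move=> dM v; rewrite -actM mulmxV ?act1 // det1_unit. Qed.

Lemma actZ M r v : act M (r *: v) = r *: act M v.
Proof. by rewrite /act /=; congr pair; rewrite /GRing.scale /=; ring. Qed.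

Definition conj_set g (Gam : set 'M[R]_2) : set 'M[R]_2 :=
  [set M | Gam (g *m M *m invmx g)].

Definition nsq v : R := v.1 ^+ 2 + v.2 ^+ 2.

Lemma nsq_ge0 v : 0 <= nsq v.
Proof. by rewrite addr_ge0 ?sqr_ge0. Qed.

Lemma nsqZ r v : nsq (r *: v) = r ^+ 2 * nsq v.
Proof. by rewrite /nsq /= /GRing.scale /=; ring. Qed.

Lemma nsq_gt0 v : (0 < nsq v) = (v != 0).
Proof.
rewrite lt0r nsq_ge0 andbT paddr_eq0 ?sqr_ge0 // !sqrf_eq0.
by case: v => a b; rewrite xpair_eqE.
Qed.

End Matrices.

(** * Minima over finite sets and cluster points *)

Lemma finite_pos_lb {R : realType} {T : eqType} (E : set T) (f : T -> R) :
  finite_set E -> (forall x, E x -> 0 < f x) ->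
  exists2 m, 0 < m & forall x, E x -> m <= f x.
Proof.
move=> /finite_seqP[s ->]; elim: s => [|x s ih] hf; first by exists 1.
have [|m m0 hm] := ih; first by move=> y ys; apply: hf; rewrite /= in_cons ys orbT.
have x0 : 0 < f x by apply: hf; rewrite /= in_cons eqxx.
exists (Num.min m (f x)); first by rewrite lt_min m0 x0.
move=> y; rewrite /= in_cons => /orP[/eqP ->|/hm my].
  by rewrite ge_min lexx orbT.
by rewrite ge_min my.
Qed.

(** Compactness of a square, in the only form needed below: bounded sequences
    of the plane come back near a point at arbitrarily late times. *)
Lemma bounded_pairs_cluster_nbhs {R : realType} (u : nat -> R * R) (C : R) :
  (forall n, `|(u n).1| <= C /\ `|(u n).2| <= C) ->
  exists p : R * R, forall (U : set (R * R)) (N : nat), nbhs p U ->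
    exists2 n, (N <= n)%N & U (u n).
Proof.
move=> hu.
have cK : compact (`[- C, C]%classic `*` `[- C, C]%classic : set (R * R)).
  by apply: compact_setX; exact: segment_compact.
have [|p [_ hp]] := cK (u @ \oo) _.
  exists 0%N => // n _ /=; have [h1 h2] := hu n.
  by split; rewrite in_itv /= -ler_norml.
exists p => U N pU.
have h1 : (u @ \oo) [set q | exists2 n, (N <= n)%N & q = u n].
  by exists N => // n /= Nn; exists n.
by have [q [[n Nn ->] Uq]] := hp _ _ h1 pU; exists n.
Qed.

Lemma bounded_pairs_cluster {R : realType} (u : nat -> R * R) (C : R) :
  (forall n, `|(u n).1| <= C /\ `|(u n).2| <= C) ->
  exists p : R * R, forall (e : R) (N : nat), 0 < e ->
    exists n, [/\ (N <= n)%N, `|(u n).1 - p.1| < e & `|(u n).2 - p.2| < e].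
Proof.
move=> /bounded_pairs_cluster_nbhs[p hp]; exists p => e N e0.
have pe : nbhs p [set q : R * R | `|q.1 - p.1| < e /\ `|q.2 - p.2| < e].
  exists (ball p.1 e, ball p.2 e); first by split; exact: nbhsx_ballx.
  by move=> q [/= q1 q2]; rewrite distrC [X in _ /\ X < _]distrC.
by have [n Nn [h1 h2]] := hp _ N pe; exists n.
Qed.

Lemma nbhs_sublevel {R : realType} {T : topologicalType} (f : T -> R) (x : T)
  (r : R) : {for x, continuous f} -> f x < r -> nbhs x [set y | f y < r].
Proof. by move=> cf fr; exact: (cvgr_lt (f x) cf r fr). Qed.

(** * Recurrent groups of matrices *)

Section RecurrentGroups.
Context {R : realType}.
Implicit Types (M N g h : 'M[R]_2) (v w : R * R) (Gam : set 'M[R]_2).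

(** The last field is weak tameness in coordinates: for the frame [g] of a
    geodesic ray, the point at time [t] of the ray is moved by [M] by a bounded
    distance exactly when conjugating [N] by the diagonal matrix of the
    geodesic flow gives a bounded matrix, where [s] is [expR t].  The record is
    stable under conjugation, so that any vector can be taken as the first
    basis vector. *)
Record recurrent_group Gam : Prop := RecurrentGroup {
  rec_det : forall M, Gam M -> \det M = 1;
  rec_N : forall M, Gam M -> Gam (- M);
  rec_M : forall M N, Gam M -> Gam N -> Gam (M *m N);
  rec_V : forall M, Gam M -> Gam (invmx M);
  rec_finite : forall C, finite_set [set M | Gam M /\ bounded_by C M];
  rec_hyperbolic : forall M, Gam M -> ~ psl_trivial M -> 2 < `|\tr M|;
  rec_recurrent : forall g, \det g = 1 -> exists K, forall T,
    exists (s : R) M, [/\ T <= s, Gam M, ~ psl_trivial M &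
      let N := invmx g *m M *m g in
      [/\ `|N 0 0| <= K, `|N 1 1| <= K, `|N 0 1| <= K * s &
          `|N 1 0| <= K / s]] }.

Lemma psl_trivial_conj g M : \det g = 1 ->
  psl_trivial (g *m M *m invmx g) -> psl_trivial M.
Proof.
move=> dg; have ug := det1_unit dg.
have E : M = invmx g *m (g *m M *m invmx g) *m g.
  by rewrite !mulmxA mulVmx // mul1mx mulmxKV.
case=> h; [left|right]; rewrite E h.
  by rewrite mulmx1 mulVmx.
by rewrite mulmxN mulmx1 mulNmx mulVmx.
Qed.

Lemma recurrent_group_conj Gam g : \det g = 1 ->
  recurrent_group Gam -> recurrent_group (conj_set g Gam).
Proof.
move=> dg H; have ug := det1_unit dg; have dg' := det_invmx1 dg.
have E M : M = invmx g *m (g *m M *m invmx g) *m g.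
  by rewrite !mulmxA mulVmx // mul1mx mulmxKV.
have detE M : \det (g *m M *m invmx g) = \det M.
  by rewrite !det_mulmx dg dg' mul1r mulr1.
split.
- by move=> M /(rec_det H); rewrite detE.
- by move=> M /(rec_N H); rewrite /conj_set /= mulmxN mulNmx.
- move=> M N hM hN; rewrite /conj_set /=.
  have -> : g *m (M *m N) *m invmx g =
      (g *m M *m invmx g) *m (g *m N *m invmx g).
    by rewrite !mulmxA mulmxKV.
  exact: rec_M.
- move=> M hM; have dM : \det M = 1 by rewrite -detE (rec_det H hM).
  have uM := det1_unit dM.
  rewrite /conj_set /=.
  have -> : g *m invmx M *m invmx g = invmx (g *m M *m invmx g).
    have uu : g *m M *m invmx g \in unitmx by rewrite det1_unit // detE.
    apply: (can_inj (mulKmx uu)); rewrite mulmxV // !mulmxA mulmxKV //.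
    by rewrite mulmxK // mulmxV.
  exact: rec_V.
- move=> C; have [D hD] := bounded_by_exists g.
  have fin := rec_finite H (2 * (2 * D * C) * D).
  apply: sub_finite_set (finite_image (fun M => invmx g *m M *m g) fin).
  move=> M [hM bM] /=; exists (g *m M *m invmx g) => //; split=> //.
  apply: bounded_by_mul; first exact: bounded_by_mul.
  exact: bounded_by_inv.
- move=> M hM nM; have := rec_hyperbolic H hM.
  rewrite mxtrace_mulC !mulmxA mulVmx // mul1mx; apply.
  by move/(psl_trivial_conj dg).
- move=> h dh; have [K hK] := rec_recurrent H (det_mul1 dg dh).
  exists K => T; have [s [M [Ts hM nM hb]]] := hK T.
  exists s, (invmx g *m M *m g).
  have gE : g *m (invmx g *m M *m g) *m invmx g = M.
    by rewrite !mulmxA mulmxV // mul1mx mulmxK.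
  split=> //; first by rewrite /conj_set /= gE.
    move=> nt; apply: nM; apply: (@psl_trivial_conj (invmx g)) => //.
    by rewrite invmxK.
  rewrite (_ : invmx h *m _ *m h = invmx (g *m h) *m M *m (g *m h)) //.
  by rewrite invmx_mul1 // !mulmxA.
Qed.

(** Squaring [M] multiplies both off-diagonal entries by the trace, so that
    their ratio, which is below [e ^+ 2], never changes, while the excess of the
    trace over 2 is multiplied by at least 4.  At the first time a diagonal
    entry exceeds 2, the product of the off-diagonal entries is still bounded;
    together with the ratio this makes the lower left entry small.  The
    constant 9 bounds the diagonal of the square of a matrix of determinant 1
    with diagonal entries below 2. *)
Lemma squaring_search Gam (K e : R) (n : nat) M :
  (forall M N, Gam M -> Gam N -> Gam (M *m N)) ->
  9 <= K -> 0 <= e -> Gam M -> \det M = 1 -> 2 < `|\tr M| ->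
  `|M 0 0| <= K -> `|M 1 1| <= K -> `|M 0 1 * M 1 0| <= K ^+ 2 ->
  `|M 1 0| <= e ^+ 2 * `|M 0 1| ->
  4 <= 4 ^+ n * (`|\tr M| - 2) ->
  exists N, [/\ Gam N /\ \det N = 1, 2 < `|\tr N|,
    `|N 0 0| <= K /\ `|N 1 1| <= K, 2 <= `|N 0 0| \/ 2 <= `|N 1 1| &
    `|N 1 0| <= e * K].
Proof.
move=> GM K9 e0; elim: n M => [|n ih] M hM dM tM aK dK bcK cb.
  rewrite expr0 mul1r => t6; exists M; split=> //.
    move: t6; rewrite tr_mx2E; have := ler_normD (M 0 0) (M 1 1).
    by case: (lerP 2 `|M 0 0|) => ? ?; [left|right; lra].
  rewrite -(@ler_pXn2r _ 2) ?nnegrE ?mulr_ge0 //; last by lra.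
  rewrite exprMn (le_trans _ (ler_wpM2l (sqr_ge0 e) bcK)) // normrM mulrA.
  by rewrite expr2; apply: ler_wpM2r.
case: (lerP 2 `|M 0 0|) => a2.
  move=> _; exists M; split=> //; first by left.
  rewrite -(@ler_pXn2r _ 2) ?nnegrE ?mulr_ge0 //; last by lra.
  rewrite exprMn (le_trans _ (ler_wpM2l (sqr_ge0 e) bcK)) // normrM mulrA.
  by rewrite expr2; apply: ler_wpM2r.
case: (lerP 2 `|M 1 1|) => d2.
  move=> _; exists M; split=> //; first by right.
  rewrite -(@ler_pXn2r _ 2) ?nnegrE ?mulr_ge0 //; last by lra.
  rewrite exprMn (le_trans _ (ler_wpM2l (sqr_ge0 e) bcK)) // normrM mulrA.
  by rewrite expr2; apply: ler_wpM2r.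
move=> tn; move: (dM); rewrite det_mx22E => dE.
have tE : \tr (M *m M) = (\tr M) ^+ 2 - 2.
  by rewrite !tr_mx2E !mulmx2E; nra.
have tt : `|\tr (M *m M)| = `|\tr M| ^+ 2 - 2.
  have tt4 : 2 * 2 <= `|\tr M| * `|\tr M| by apply: ler_pM => //; exact: ltW.
  rewrite tE -(@real_normK _ (\tr M)) ?num_real //.
  by apply: ger0_norm; rewrite expr2; lra.
have t4 : `|\tr M| < 4.
  by rewrite tr_mx2E; have := ler_normD (M 0 0) (M 1 1); lra.
have ad4 : `|M 0 0 * M 1 1| <= 4.
  rewrite normrM; have := normr_ge0 (M 0 0); have := normr_ge0 (M 1 1); nra.
have bc5 : `|M 0 1 * M 1 0| <= 5.
  have -> : M 0 1 * M 1 0 = M 0 0 * M 1 1 - 1 by lra.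
  have := ler_normB (M 0 0 * M 1 1) 1; rewrite normr1; lra.
have b'E : (M *m M) 0 1 = M 0 1 * \tr M.
  by rewrite mulmx2E tr_mx2E; ring.
have c'E : (M *m M) 1 0 = M 1 0 * \tr M.
  by rewrite mulmx2E tr_mx2E; ring.
apply: (ih (M *m M)).
- exact: GM.
- exact: det_mul1.
- by rewrite tt; nra.
- rewrite mulmx2E (le_trans (ler_normD _ _)) // !normrM.
  rewrite normrM in bc5; have := normr_ge0 (M 0 0); nra.
- rewrite mulmx2E (le_trans (ler_normD _ _)) // !normrM.
  rewrite normrM in bc5; have := normr_ge0 (M 1 1); nra.
- rewrite b'E c'E.
  have -> : M 0 1 * \tr M * (M 1 0 * \tr M) = (M 0 1 * M 1 0) * (\tr M) ^+ 2.
    by ring.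
  rewrite normrM normrX.
  have t16 : `|\tr M| ^+ 2 <= 16 by have := normr_ge0 (\tr M); nra.
  have := normr_ge0 (M 0 1 * M 1 0); have := sqr_ge0 `|\tr M|; nra.
- rewrite b'E c'E !normrM mulrA; apply: ler_wpM2r => //.
- rewrite tt (le_trans tn) // exprSr -mulrA; apply: ler_wpM2l.
    by rewrite exprn_ge0.
  by nra.
Qed.

Lemma exists_pow4 (t : R) : 0 < t -> exists n, 4 <= 4 ^+ n * t.
Proof.
move=> t0; have [n hn] : exists n : nat, 4 / t < n%:R.
  by exists (Num.truncn (4 / t)).+1; rewrite truncnS_gt.
exists n; rewrite -ler_pdivrMr // ltW // (lt_le_trans hn) //.
by rewrite -natrX ler_nat ltnW // ltn_expl.
Qed.

End RecurrentGroups.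

Section Axis.
Context {R : realType}.
Implicit Types (M N g h : 'M[R]_2) (v w : R * R) (Gam : set 'M[R]_2).

(** If no nontrivial element fixes the line of the first basis vector, the
    recurrent elements leave every bounded set: a bounded one would be among
    finitely many, whose lower left entries are bounded away from 0.  Their
    upper right entries therefore dominate the lower left ones, which is what
    the squaring procedure asks for.  Inverting exchanges the two diagonal
    entries. *)
Lemma axis_dichotomy Gam : recurrent_group Gam ->
  (exists M, [/\ Gam M, ~ psl_trivial M & M 1 0 = 0]) \/
  exists K : R, forall e : R, 0 < e -> exists M,
    [/\ Gam M, M 1 0 != 0, 2 <= `|M 0 0|, `|M 0 0| <= K & `|M 1 0| <= e].
Proof.
move=> H; case: (pselect (exists M, [/\ Gam M, ~ psl_trivial M & M 1 0 = 0])).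
  by left.
move=> nc; right.
have c0 M : Gam M -> 2 < `|\tr M| -> M 1 0 != 0.
  move=> hM tM; apply/eqP => c0; apply: nc; exists M; split=> //.
  by move/psl_trivial_tr => E; rewrite E ltxx in tM.
have [K0 hK0] := rec_recurrent H (det1 R 2).
pose K := Num.max 9 K0.
have K9 : 9 <= K by rewrite le_max lexx.
have KK0 : K0 <= K by rewrite le_max lexx orbT.
have {hK0} hK T : 0 < T -> exists (s : R) M, [/\ T <= s, Gam M, 2 < `|\tr M| &
    [/\ `|M 0 0| <= K, `|M 1 1| <= K, `|M 0 1| <= K * s & `|M 1 0| <= K / s]].
  move=> T0; have [s [M [Ts hM nM]]] := hK0 T.
  have -> : invmx 1%:M *m M *m 1%:M = M :> 'M[R]_2.
    by rewrite mulmx1 -[RHS]mul1mx -[in RHS](mulVmx (unitmx1 _ _)) mulmx1.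
  move=> [h1 h2 h3 h4]; exists s, M; split=> //.
    exact: rec_hyperbolic H _ hM nM.
  have s0 : 0 < s by exact: lt_le_trans Ts.
  split; [exact: le_trans KK0|exact: le_trans KK0| |].
    by rewrite (le_trans h3) // ler_wpM2r // ltW.
  by rewrite (le_trans h4) // ler_wpM2r // invr_ge0 ltW.
have step1 d : 0 < d -> exists M, [/\ Gam M, 2 < `|\tr M|,
    `|M 0 0| <= K /\ `|M 1 1| <= K, `|M 0 1 * M 1 0| <= K ^+ 2 &
    `|M 1 0| <= d * `|M 0 1|].
  move=> d0.
  have fin : finite_set [set M | (Gam M /\ 2 < `|\tr M|) /\ bounded_by K M].
    by apply: sub_finite_set (rec_finite H K) => M [[? ?] ?].
  have [m m0 hm] : exists2 m, 0 < m & forall M,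
      (Gam M /\ 2 < `|\tr M|) /\ bounded_by K M -> m <= `|M 1 0|.
    apply: (finite_pos_lb fin) => M [[hM tM] _].
    by rewrite normr_gt0; exact: c0.
  pose T := Num.max (Num.max 1 (K / m + 1)) d^-1.
  have T0 : 0 < T by rewrite !lt_max ltr01.
  have [s [M [Ts hM tM [aK dK bK cK]]]] := hK T T0.
  have s0 : 0 < s by exact: lt_le_trans Ts.
  have s1 : 1 <= s by apply: le_trans Ts; rewrite !le_max lexx.
  have sm : K / m + 1 <= s by apply: le_trans Ts; rewrite !le_max lexx !orbT.
  have sd : d^-1 <= s by apply: le_trans Ts; rewrite !le_max lexx !orbT.
  exists M; split=> //.
    rewrite normrM expr2 (le_trans (ler_pM _ _ bK cK)) //.
    by rewrite le_eqVlt; apply/orP; left; apply/eqP; field; rewrite gt_eqF.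
  rewrite leNgt; apply/negP => bc.
  have bM : bounded_by K M.
    have cK1 : `|M 1 0| <= K.
      by rewrite (le_trans cK) // ler_pdivrMr //; nra.
    apply: bounded_byP => //.
    have : d * `|M 0 1| <= d * K.
      rewrite (le_trans (ltW bc)) // (le_trans cK) // ler_pdivrMr //.
      have : 1 <= d * s by rewrite -(mulfV (lt0r_neq0 d0)) ler_wpM2l // ltW.
      by nra.
    by rewrite ler_pM2l.
  have := hm M (conj (conj hM tM) bM).
  rewrite leNgt => /negP; apply.
  rewrite (le_lt_trans cK) // ltr_pdivrMr //.
  by rewrite -ltr_pdivrMl // mulrC; lra.
exists K => e e0.
have K0' : 0 < K by lra.
pose d := e / K.
have d0 : 0 < d by rewrite divr_gt0.
have [M [hM tM [aK dK] bcK cb]] := step1 (d ^+ 2) (exprn_gt0 _ d0).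
have [n hn] : exists n, 4 <= 4 ^+ n * (`|\tr M| - 2).
  by apply: exists_pow4; lra.
have [N [[hN dN] tN [aN dN'] aorD cN]] := squaring_search (rec_M H) K9 (ltW d0)
  hM (rec_det H hM) tM aK dK bcK cb hn.
rewrite divfK ?gt_eqF // in cN.
case: aorD => h2.
  by exists N; split=> //; exact: c0.
exists (invmx N); have := c0 _ hN tN.
rewrite invmx_det1 // !mx2E normrN oppr_eq0 -invmx_det1 //.
by split=> //; exact: rec_V.
Qed.
End Axis.

(** * Invariant closed sets of vectors *)

Section InvariantSets.
Context {R : realType}.
Implicit Types (M N g h : 'M[R]_2) (v w p : R * R) (Gam : set 'M[R]_2)
  (S : set (R * R)).

(** The origin is left out: vectors may accumulate there, but it corresponds to
    no horocycle. *)
Definition punctured_closed S := forall p, p != 0 ->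
  (forall e, 0 < e -> exists v, [/\ S v, `|v.1 - p.1| < e & `|v.2 - p.2| < e]) ->
  S p.

Record invariant_closed Gam S : Prop := InvariantClosed {
  ic_neq0 : forall v, S v -> v != 0;
  ic_act : forall M v, Gam M -> S v -> S (act M v);
  ic_closed : punctured_closed S }.

Lemma act_neq0 M v : \det M = 1 -> v != 0 -> act M v != 0.
Proof.
move=> dM; apply: contraNneq => Mv; rewrite -(actK dM v) Mv.
by rewrite /act /= !mulr0 !addr0.
Qed.

Lemma act_dist M C v w (e : R) : bounded_by C M -> 0 <= C ->
  `|v.1 - w.1| <= e -> `|v.2 - w.2| <= e ->
  `|(act M v).1 - (act M w).1| <= 2 * C * e /\
  `|(act M v).2 - (act M w).2| <= 2 * C * e.
Proof.
move=> bM C0 h1 h2; rewrite /act /=.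
have E (a b : R) : `|a| <= C -> `|b| <= C ->
    `|a * v.1 + b * v.2 - (a * w.1 + b * w.2)| <= 2 * C * e.
  move=> ha hb.
  have -> : a * v.1 + b * v.2 - (a * w.1 + b * w.2) =
    a * (v.1 - w.1) + b * (v.2 - w.2) by ring.
  rewrite (le_trans (ler_normD _ _)) // !normrM.
  have -> : 2 * C * e = C * e + C * e by ring.
  by apply: lerD; apply: ler_pM.
by split; apply: E; exact: bM.
Qed.

Lemma invariant_closed_conj Gam S g : \det g = 1 ->
  invariant_closed Gam S ->
  invariant_closed (conj_set g Gam) [set v | S (act g v)].
Proof.
move=> dg H; split.
- move=> v /(ic_neq0 H); apply: contra => /eqP ->; apply/eqP.
  by rewrite /act /= !mulr0 !addr0.
- move=> M v hM hv /=; rewrite -actM.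
  have -> : g *m M = (g *m M *m invmx g) *m g by rewrite mulmxKV ?det1_unit.
  by rewrite actM; apply: (ic_act H).
- move=> p p0 hp; apply: (ic_closed H); first exact: act_neq0.
  move=> e e0; have [C bC] := bounded_by_exists g.
  have C0 : 0 <= C by exact: le_trans (bC 0 0).
  have d0 : 0 < e / (2 * C + 1) by rewrite divr_gt0 //; lra.
  have [v [Sv h1 h2]] := hp _ d0; exists (act g v).
  have [k1 k2] := act_dist bC C0 (ltW h1) (ltW h2).
  have small : 2 * C * (e / (2 * C + 1)) < e.
    by rewrite mulrCA gtr_pMr // ltr_pdivrMr; lra.
  by split=> //; exact: le_lt_trans small.
Qed.

(** The second column is the rotated first column divided by its squared length:
    this choice of a matrix of determinant 1 is continuous in [v] away from 0. *)
Definition frame v : 'M[R]_2 :=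
  mx2 v.1 (- v.2 / nsq v) v.2 (v.1 / nsq v).

Lemma frame_det v : v != 0 -> \det (frame v) = 1.
Proof.
rewrite -nsq_gt0 => v0; rewrite det_mx2.
have -> : v.1 * (v.1 / nsq v) - - v.2 / nsq v * v.2 = nsq v / nsq v.
  by rewrite /nsq; ring.
by rewrite divff ?gt_eqF.
Qed.

Lemma frame_act v (r : R) : act (frame v) (r, 0) = r *: v.
Proof.
by rewrite /act !mx2E /= !mulr0 !addr0 [v.1 * _]mulrC [v.2 * _]mulrC.
Qed.

(** A vector of the form [(a, 0)] is an accumulation point of the images of
    the first basis vector under the elements of [axis_dichotomy]. *)
Lemma axis_scaling Gam S : recurrent_group Gam -> invariant_closed Gam S ->
  S (1, 0) -> exists r, [/\ 0 < r, r != 1 & S (r, 0)].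
Proof.
move=> H HS S1.
have scN r : S (r, 0) -> S (`|r|, 0).
  move=> Sr; case: (leP 0 r) => [/ger0_norm -> //|/ltr0_norm ->].
  suff: S (act (- 1%:M) (r, 0)).
    by rewrite /act !mxE /= ?mulr0n ?mulr1n !mulr0 !addr0 oppr0 mul0r mulN1r.
  apply: (ic_act HS) => //; apply: (rec_N H).
  have [K hK] := rec_recurrent H (det1 R 2).
  have [s [M [_ hM _ _]]] := hK 0.
  have := rec_M H (rec_V H hM) hM.
  by rewrite mulVmx // det1_unit // (rec_det H hM).
case: (axis_dichotomy H) => [[M [hM nM c0]]|[K hK]].
  have dM := rec_det H hM; have tM := rec_hyperbolic H hM nM.
  rewrite det_mx22E c0 mulr0 subr0 in dM; rewrite tr_mx2E in tM.
  exists `|M 0 0|; split.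
  - rewrite normr_gt0; apply/eqP => a0; move: dM; rewrite a0 mul0r => /eqP.
    by rewrite eq_sym oner_eq0.
  - apply/eqP => a1; have d1 : `|M 1 1| = 1.
      by have := congr1 Num.norm dM; rewrite normrM a1 mul1r normr1.
    by have := ler_normD (M 0 0) (M 1 1); rewrite a1 d1; lra.
  - apply: scN; have := ic_act HS hM S1.
    by rewrite /act /= c0 mul0r !mulr0 !addr0 mulr1.
have ex n : exists v, [/\ S v, 2 <= `|v.1|, `|v.1| <= K & `|v.2| <= n.+1%:R^-1].
  have n0 : 0 < n.+1%:R^-1 :> R by rewrite invr_gt0 ltr0n.
  have [M [hM _ a2 aK ce]] := hK _ n0.
  exists (act M (1, 0)); split; first exact: (ic_act HS).
  1-3: by rewrite /act /= !mulr0 !addr0 mulr1.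
have [u hu] := choice ex.
have K2 : 2 <= K by have [_ h1 h2 _] := hu 0%N; exact: le_trans h2.
have inv1 (n : nat) : n.+1%:R^-1 <= 1 :> R.
  by rewrite invf_le1 ?ltr0n // ler1n.
have [n|p hp] := @bounded_pairs_cluster R u K.
  have [_ _ h1 h2] := hu n.
  by split=> //; apply: le_trans h2 (le_trans (inv1 n) _); lra.
have p2 : p.2 = 0.
  apply/eqP; rewrite -normr_eq0; apply/negPn/negP => p20.
  have e0 : 0 < `|p.2| / 2 by rewrite divr_gt0 // lt0r p20 normr_ge0.
  have [N hN] : exists N : nat, (`|p.2| / 2)^-1 < N.+1%:R.
    by exists (Num.truncn (`|p.2| / 2)^-1); rewrite truncnS_gt.
  have [n [Nn _ h2]] := hp _ N e0.
  have [_ _ _ h3] := hu n.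
  have h4 : n.+1%:R^-1 < `|p.2| / 2.
    rewrite -[X in _ < X]invrK ltf_pV2 ?posrE ?ltr0n ?invr_gt0 //.
    by rewrite (lt_le_trans hN) // ler_nat.
  have {h3 h4} h3 := le_lt_trans h3 h4.
  have := ler_normB ((u n).2) ((u n).2 - p.2).
  by rewrite (_ : _ - (_ - _) = p.2); [lra|ring].
have p1 : 2 <= `|p.1|.
  rewrite leNgt; apply/negP => p12.
  have [n [_ h1 _]] := hp (2 - `|p.1|) 0%N ltac:(lra).
  have [_ h2 _ _] := hu n.
  have := ler_normD ((u n).1 - p.1) p.1; rewrite subrK; lra.
exists `|p.1|; split; [lra|by rewrite gt_eqF //; lra|].
apply: scN; rewrite -[X in (_, X)]p2 -surjective_pairing.
apply: (ic_closed HS).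
  by apply: contraTneq p1 => ->; rewrite normr0 -ltNge; lra.
move=> e e0; have [n [_ h1 h2]] := hp e 0%N e0.
by exists (u n); split=> //; have [] := hu n.
Qed.

Lemma recurrent_scaling Gam S v : recurrent_group Gam ->
  invariant_closed Gam S -> S v -> exists r, [/\ 0 < r, r != 1 & S (r *: v)].
Proof.
move=> H HS Sv; have v0 := ic_neq0 HS Sv; have dg := frame_det v0.
have [|r [r0 r1]] := axis_scaling (recurrent_group_conj dg H)
  (invariant_closed_conj dg HS).
  by rewrite /= frame_act scale1r.
by rewrite /= frame_act; exists r.
Qed.

Definition scale_invariant (r : R) S :=
  forall v, S v -> S (r *: v) /\ S (r^-1 *: v).

Lemma scale_invariant_conj r S g :
  scale_invariant r S -> scale_invariant r [set v | S (act g v)].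
Proof. by move=> H v /H; rewrite -!actZ. Qed.

(** A fundamental domain for the homothety. *)
Lemma scale_invariant_normalize r S v : 1 < r -> scale_invariant r S ->
  S v -> v.1 != 0 -> exists q, [/\ 0 < q, S (q *: v), 1 <= `|(q *: v).1| &
    `|(q *: v).1| <= r].
Proof.
move=> r1 hr Sv v1; have r0 : 0 < r by lra.
have up n : S (r ^+ n *: v).
  elim: n => [|n ih]; first by rewrite expr0 scale1r.
  by rewrite exprS -scalerA; have [] := hr _ ih.
have dn n : S (r ^- n *: v).
  elim: n => [|n ih]; first by rewrite expr0 invr1 scale1r.
  by rewrite exprS invfM -scalerA; have [] := hr _ ih.
have hk (k : int) : S (r ^ k *: v).
  by case: k => n; [exact: up|exact: dn].
have l0 : 0 < ln r by rewrite ln_gt0.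
have v10 : 0 < `|v.1| by rewrite normr_gt0.
pose k : int := - Num.floor (ln `|v.1| / ln r).
have q0 : 0 < r ^ k by rewrite exprz_gt0.
have rk : ln (r ^ k) = k%:~R * ln r.
  case: (k) => n; first by rewrite -exprnP lnXn // mulr_natl.
  by rewrite NegzE -exprnN lnV ?posrE ?exprn_gt0 // lnXn // mulrNz mulNr mulr_natl.
have fl := floor_le (ln `|v.1| / ln r).
have fg := floorD1_gt (ln `|v.1| / ln r).
exists (r ^ k); split=> //=.
- rewrite /GRing.scale /= normrM gtr0_norm // -ler_ln ?posrE ?mulr_gt0 //.
  rewrite ln1 lnM ?posrE // rk /k mulrNz mulNr addrC subr_ge0.
  by rewrite -ler_pdivlMr.
- rewrite /GRing.scale /= normrM gtr0_norm // -ler_ln ?posrE ?mulr_gt0 //.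
  rewrite lnM ?posrE // rk /k mulrNz mulNr addrC lerBlDr.
  move: fg; rewrite intrD ltr_pdivrMr // mulrDl mul1r => fg.
  by rewrite addrC ltW.
Qed.

End InvariantSets.

(** * Every direction is represented *)

Section Directions.
Context {R : realType}.
Implicit Types (M N g h : 'M[R]_2) (v w p : R * R) (Gam : set 'M[R]_2)
  (S : set (R * R)).

(** Directions of a scale invariant set form a closed set, since vectors can be
    normalized by the homothety to stay in a compact set avoiding 0. *)
Lemma bounded_slope Gam S (r : R) : invariant_closed Gam S -> 1 < r ->
  scale_invariant r S -> (forall q, ~ S (q, 0)) ->
  exists C, forall v, S v -> `|v.1| <= C * `|v.2|.
Proof.
move=> HS r1 hr noS; apply: contrapT => /forallNP hC.
have ex (n : nat) : exists v,
    [/\ S v, 1 <= `|v.1|, `|v.1| <= r & n%:R * `|v.2| <= r].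
  have /existsNP[v /not_implyP[Sv /negP]] := hC n%:R.
  rewrite -ltNge => vn.
  have v1 : v.1 != 0.
    rewrite -normr_gt0; apply: le_lt_trans vn; exact: mulr_ge0.
  have [q [q0 Sq q1 qr]] := scale_invariant_normalize r1 hr Sv v1.
  exists (q *: v); split=> //; apply: le_trans qr.
  rewrite /GRing.scale /= !normrM mulrCA; apply: ler_wpM2l => //.
  exact: ltW.
have [u hu] := choice ex.
have [n|p hp] := @bounded_pairs_cluster R (fun n => u n.+1) r.
  have [_ _ h1 h2] := hu n.+1; split=> //; apply: le_trans h2.
  by rewrite ler_peMl // ler1n.
have p2 : p.2 = 0.
  apply/eqP; rewrite -normr_eq0; apply/negPn/negP => p20.
  have e0 : 0 < `|p.2| / 2 by rewrite divr_gt0 // lt0r p20 normr_ge0.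
  have [N hN] : exists N : nat, r / (`|p.2| / 2) < N.+1%:R.
    by exists (Num.truncn (r / (`|p.2| / 2))); rewrite truncnS_gt.
  have [n [Nn _ h2]] := hp _ N e0.
  have [_ _ _ h3] := hu n.+1.
  have h4 : `|(u n.+1).2| < `|p.2| / 2.
    rewrite ltr_pdivrMr // in hN.
    rewrite -(@ltr_pM2l _ n.+1%:R) ?ltr0n //.
    apply: (le_lt_trans h3); apply: (lt_le_trans hN).
    by rewrite ler_pM2r // ler_nat.
  have := ler_normB ((u n.+1).2) ((u n.+1).2 - p.2).
  by rewrite (_ : _ - (_ - _) = p.2); [lra|ring].
have p1 : 1 <= `|p.1|.
  rewrite leNgt; apply/negP => p12.
  have e0 : 0 < 1 - `|p.1| by lra.
  have [n [_ h1 _]] := hp _ 0%N e0.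
  have [_ h2 _ _] := hu n.+1.
  have := ler_normD ((u n.+1).1 - p.1) p.1; rewrite subrK; lra.
apply: (noS p.1); rewrite -[X in (_, X)]p2 -surjective_pairing.
apply: (ic_closed HS).
  by apply: contraTneq p1 => ->; rewrite normr0 -ltNge; lra.
move=> e e0; have [n [_ h1 h2]] := hp e 0%N e0.
by exists (u n.+1); split=> //; have [] := hu n.+1.
Qed.

(** If the first axis is missed, the slopes of the vectors of [S] are bounded.
    An element fixing that axis expands it, or its inverse does; its powers
    would drive vectors of [S] towards the axis, unless these vectors belong to
    its other invariant line. *)
Lemma no_direction_line Gam S (r : R) : recurrent_group Gam ->
  invariant_closed Gam S -> 1 < r -> scale_invariant r S ->
  S !=set0 -> (forall q, ~ S (q, 0)) ->
  exists M k, [/\ Gam M, M 1 0 = 0, 1 < `|M 0 0| &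
    forall v, S v -> v.1 = k * v.2].
Proof.
move=> H HS r1 hr [v0 Sv0] noS.
have [C0 hC0] := bounded_slope HS r1 hr noS.
pose C := Num.max 1 C0.
have C1 : 1 <= C by rewrite le_max lexx.
have {hC0} hC v : S v -> `|v.1| <= C * `|v.2|.
  move=> /hC0 h; apply: (le_trans h); apply: ler_wpM2r => //.
  by rewrite le_max lexx orbT.
have v20 : 0 < `|v0.2|.
  rewrite normr_gt0; apply/eqP => v20; apply: (noS v0.1).
  by rewrite -[X in (_, X)]v20 -surjective_pairing.
case: (axis_dichotomy H) => [[M [hM nM c0]]|[K hK]].
  have {nM} [M' [{}hM {}c0 a1]] : exists M, [/\ Gam M, M 1 0 = 0 & 1 < `|M 0 0|].
    have dM := rec_det H hM; have tM := rec_hyperbolic H hM nM.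
    case: (ltrP 1 `|M 0 0|) => a1; first by exists M.
    exists (invmx M); split; first exact: rec_V.
      by rewrite invmx_det1 // mx2E c0 oppr0.
    rewrite invmx_det1 // mx2E.
    by have := ler_normD (M 0 0) (M 1 1); rewrite tr_mx2E in tM; lra.
  move: M' hM c0 a1 => {}M hM c0 a1.
  have dM := rec_det H hM; rewrite det_mx22E c0 mulr0 subr0 in dM.
  pose a := M 0 0; pose d := M 1 1; pose b := M 0 1.
  have ad : a * d = 1 by [].
  have d1 : `|d| < 1.
    have : `|a| * `|d| = 1 by rewrite -normrM ad normr1.
    by have := normr_ge0 d; rewrite -/a in a1; nra.
  have da0 : d - a != 0.
    rewrite subr_eq0; apply/eqP => da; rewrite -/a -da in a1; lra.
  pose k := b / (d - a).
  have bE : b = k * (d - a) by rewrite /k divfK.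
  exists M, k; split=> // v Sv; apply/eqP; rewrite -subr_eq0 -normr_eq0.
  apply/negPn/negP => n0.
  have e0 : 0 < `|v.1 - k * v.2| by rewrite lt0r n0 normr_ge0.
  have it n : exists w, [/\ S w, w.1 - k * w.2 = a ^+ n * (v.1 - k * v.2) &
      `|w.2| <= `|v.2|].
    elim: n => [|n [w [Sw w1 w2]]]; first by exists v; rewrite expr0 mul1r.
    exists (act M w); split; first exact: (ic_act HS).
      rewrite /act /= c0 mul0r add0r -/a -/b -/d exprS -mulrA -w1 bE; ring.
    rewrite /act /= c0 mul0r add0r normrM -/d; apply: le_trans w2.
    by rewrite ler_piMl // ltW.
  pose B := (C + `|k|) * `|v.2|.
  have hB n : `|a| ^+ n * `|v.1 - k * v.2| <= B.
    have [w [Sw w1 w2]] := it n.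
    rewrite -normrX -normrM -w1 (le_trans (ler_normB _ _)) // normrM /B mulrDl.
    apply: lerD; last exact: ler_wpM2l.
    by apply: (le_trans (hC _ Sw)); apply: ler_wpM2l => //; lra.
  have bern n : 1 + n%:R * (`|a| - 1) <= `|a| ^+ n.
    elim: n => [|n ih]; first by rewrite mul0r addr0 expr0.
    rewrite exprS -natr1.
    have sq : 0 <= n%:R * (`|a| - 1) ^+ 2 by rewrite mulr_ge0 // sqr_ge0.
    have := ler_wpM2l (normr_ge0 a) ih.
    by apply: le_trans; rewrite expr2 in sq; lra.
  have [n hn] : exists n : nat, (B / `|v.1 - k * v.2|) / (`|a| - 1) < n%:R.
    by exists (Num.truncn ((B / `|v.1 - k * v.2|) / (`|a| - 1))).+1;
      rewrite truncnS_gt.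
  have a10 : 0 < `|a| - 1 by rewrite -/a in a1; lra.
  rewrite ltr_pdivrMr // ltr_pdivrMr // in hn.
  by have := hB n; have := bern n; nra.
(* The other alternative is impossible: the image of v0 has bounded slope,
   which bounds the upper right entry, so that only finitely many elements
   are available to make the lower left entry small. *)
exfalso.
have v2n : `|v0.2| != 0 by rewrite gt_eqF.
pose B := 2 * (K * `|v0.1| / `|v0.2| + `|v0.1| / `|v0.2| + C).
have K0 : 0 <= K.
  by have [//|M [_ _ h1 h2 _]] := hK 1; apply: le_trans h2; lra.
have q0 : 0 <= `|v0.1| / `|v0.2| by rewrite divr_ge0.
have B0 : 0 <= B by rewrite /B -mulrA; nra.
have bd M : Gam M -> 2 <= `|M 0 0| -> `|M 0 0| <= K -> `|M 1 0| <= C^-1 ->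
    bounded_by (K + 1 + B) M.
  move=> hM a2 aK cC; have dM := rec_det H hM; rewrite det_mx22E in dM.
  have Cc : C * `|M 1 0| <= 1 by rewrite -ler_pdivlMl ?mulr1 //; lra.
  have c1 : `|M 1 0| <= 1 by have := normr_ge0 (M 1 0); nra.
  have ad : `|M 0 0| * `|M 1 1| <= 1 + `|M 0 1| * `|M 1 0|.
    rewrite -!normrM (_ : _ * _ = 1 + M 0 1 * M 1 0); last by lra.
    by rewrite (le_trans (ler_normD _ _)) // normr1.
  have Cd : 2 * (C * `|M 1 1|) <= C + `|M 0 1|.
    have d0 := normr_ge0 (M 1 1); have b0 := normr_ge0 (M 0 1).
    have : C * (`|M 0 0| * `|M 1 1|) <= C * (1 + `|M 0 1| * `|M 1 0|).
      by apply: ler_wpM2l => //; lra.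
    have : 2 * (C * `|M 1 1|) <= C * (`|M 0 0| * `|M 1 1|).
      rewrite mulrCA; apply: ler_wpM2l; first lra.
      exact: ler_wpM2r.
    have : `|M 0 1| * (C * `|M 1 0|) <= `|M 0 1| * 1 by exact: ler_wpM2l.
    lra.
  have sl := hC _ (ic_act HS hM Sv0); rewrite /act /= in sl.
  have bB : `|M 0 1| <= B.
    have l1 : `|M 0 1| * `|v0.2| <=
       K * `|v0.1| + `|v0.1| + C * `|M 1 1| * `|v0.2|.
      have t1 : `|M 0 1 * v0.2| <= `|M 0 0 * v0.1 + M 0 1 * v0.2| +
          `|M 0 0 * v0.1|.
        have := ler_normB (M 0 0 * v0.1 + M 0 1 * v0.2) (M 0 0 * v0.1).
        by rewrite addrAC subrr add0r.
      have t2 := ler_normD (M 1 0 * v0.1) (M 1 1 * v0.2).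
      rewrite !normrM in t1 t2.
      have t3 : `|M 0 0| * `|v0.1| <= K * `|v0.1| by exact: ler_wpM2r.
      have t4 : C * (`|M 1 0| * `|v0.1|) <= 1 * `|v0.1|.
        by rewrite mulrA; exact: ler_wpM2r.
      have t5 : C * `|M 1 0 * v0.1 + M 1 1 * v0.2| <=
          C * (`|M 1 0| * `|v0.1| + `|M 1 1| * `|v0.2|).
        by apply: ler_wpM2l => //; lra.
      lra.
    have l2 : `|M 0 1| * `|v0.2| * 2 <=
        2 * (K * `|v0.1| + `|v0.1|) + (C + `|M 0 1|) * `|v0.2|.
      have : 2 * (C * `|M 1 1|) * `|v0.2| <= (C + `|M 0 1|) * `|v0.2|.
        exact: ler_wpM2r.
      lra.
    rewrite -(ler_pM2r v20); apply: (@le_trans _ _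
      (2 * (K * `|v0.1| + `|v0.1|) + C * `|v0.2|)); first by lra.
    have -> : B * `|v0.2| = 2 * (K * `|v0.1| + `|v0.1| + C * `|v0.2|).
      by rewrite /B; field.
    have : 0 <= C * `|v0.2| by rewrite mulr_ge0 //; lra.
    lra.
  have dB : `|M 1 1| <= B + 1.
    by have := normr_ge0 (M 1 1); nra.
  by apply: bounded_byP; lra.
have fin : finite_set [set M | (Gam M /\ M 1 0 != 0) /\
    bounded_by (K + 1 + B) M].
  by apply: sub_finite_set (rec_finite H (K + 1 + B)) => M [[? ?] ?].
have [m m0 hm] : exists2 m, 0 < m & forall M, (Gam M /\ M 1 0 != 0) /\
    bounded_by (K + 1 + B) M -> m <= `|M 1 0|.
  by apply: (finite_pos_lb fin) => M [[_ c0] _]; rewrite normr_gt0.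
have Ci : 0 < C^-1 by rewrite invr_gt0; lra.
have [|M [hM c0 a2 aK cm]] := hK (Num.min C^-1 (m / 2)).
  by rewrite lt_min Ci divr_gt0.
move: cm; rewrite le_min => /andP[c1 c2].
have := hm M (conj (conj hM c0) (bd M hM a2 aK c1)); lra.
Qed.

End Directions.

Section AllDirections.
Context {R : realType}.
Implicit Types (M N g h : 'M[R]_2) (v w p : R * R) (Gam : set 'M[R]_2)
  (S : set (R * R)).

(** Two hyperbolic elements that share exactly one fixed line have a parabolic
    commutator.  Missing a direction puts [S] on one line, and missing two
    directions gives two such elements. *)
Lemma all_directions Gam S (r : R) : recurrent_group Gam ->
  invariant_closed Gam S -> 1 < r -> scale_invariant r S -> S !=set0 ->
  forall v, v != 0 -> exists q, S (q *: v).
Proof.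
move=> H0 HS0 r1 hr0 ne0 v v0; apply: contrapT => /forallNP noS0.
have conj_ne S' g : \det g = 1 -> S' !=set0 -> [set w | S' (act g w)] !=set0.
  by move=> dg [w Sw]; exists (act (invmx g) w); rewrite /= actKV.
(* Change of basis making v the first basis vector; then S lies on a
   line. *)
have dg := frame_det v0.
have H1 := recurrent_group_conj dg H0; have HS1 := invariant_closed_conj dg HS0.
have hr1 := scale_invariant_conj (g := frame v) hr0.
have ne1 := conj_ne _ _ dg ne0.
have noS1 q : ~ [set w | S (act (frame v) w)] (q, 0).
  by rewrite /= frame_act; exact: noS0.
move: H1 HS1 hr1 ne1 noS1; set G1 := conj_set _ _; set S1 := [set w | _].
move=> H1 HS1 hr1 ne1 noS1.
have [_ [k [_ _ _ lk]]] := no_direction_line H1 HS1 r1 hr1 ne1 noS1.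
(* A shear fixes the first axis and makes that line the second axis; the
   group preserves it, hence is triangular. *)
pose u := mx2 1 k 0 1.
have du : \det u = 1 by rewrite det_mx2; ring.
have H2 := recurrent_group_conj du H1; have HS2 := invariant_closed_conj du HS1.
have hr2 := scale_invariant_conj (g := u) hr1.
have ne2 := conj_ne _ _ du ne1.
have noS2 q : ~ [set w | S1 (act u w)] (q, 0).
  rewrite /= (_ : act u (q, 0) = (q, 0)); first exact: noS1.
  by rewrite /act !mx2E /= mul1r mul0r !mulr0 !addr0.
have ax2 w : [set w | S1 (act u w)] w -> w.1 = 0.
  by move/lk; rewrite /act !mx2E /=; lra.
move: H2 HS2 hr2 ne2 noS2 ax2; set G2 := conj_set _ _; set S2 := [set w | _].
move=> H2 HS2 hr2 ne2 noS2 ax2.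
have lower M : G2 M -> M 0 1 = 0.
  move=> hM; have [w Sw] := ne2.
  have := ax2 _ (ic_act HS2 hM Sw); rewrite /act /= (ax2 _ Sw) mulr0 add0r.
  move=> /eqP; rewrite mulf_eq0 => /orP[/eqP //|/eqP w2].
  have := ic_neq0 HS2 Sw; rewrite (surjective_pairing w) w2 (ax2 _ Sw).
  by rewrite eqxx.
have [M1 [k1 [hM1 c1 a1 _]]] := no_direction_line H2 HS2 r1 hr2 ne2 noS2.
(* The diagonal is missed as well: it is fixed by an element that does not
   fix the first axis. *)
pose h := mx2 1 0 1 1 : 'M[R]_2.
have dh : \det h = 1 by rewrite det_mx2; ring.
have H3 := recurrent_group_conj dh H2; have HS3 := invariant_closed_conj dh HS2.
have hr3 := scale_invariant_conj (g := h) hr2.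
have ne3 := conj_ne _ _ dh ne2.
have noS3 q : ~ [set w | S2 (act h w)] (q, 0).
  rewrite /= => Sq; have := ax2 _ Sq; rewrite /act !mx2E /= mul1r mul0r addr0.
  move=> q0; have := ic_neq0 HS2 Sq.
  by rewrite q0 /act !mx2E /= !mulr0 !addr0 eqxx.
have [N [k2 [hN c2 a2 _]]] := no_direction_line H3 HS3 r1 hr3 ne3 noS3.
pose M2 := h *m N *m invmx h.
have hM2 : G2 M2 := hN.
have dN := rec_det H3 hN; rewrite det_mx22E c2 mulr0 subr0 in dN.
have ih : invmx h = mx2 1 0 (- 1) 1 by rewrite invmx_det1 // !mx2E oppr0.
have M2E : ((M2 0 0 = N 0 0 - N 0 1) * (M2 0 1 = N 0 1)) *
   ((M2 1 0 = N 0 0 - N 0 1 - N 1 1) * (M2 1 1 = N 0 1 + N 1 1)).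
  by rewrite /M2 ih !mulmx2E !mx2E c2; do ![split]; ring.
move: (M2) hM2 M2E => {}M2 hM2 M2E.
have b2 := lower _ hM2; rewrite !M2E in b2.
have b1 := lower _ hM1.
have dM1 := rec_det H2 hM1; rewrite det_mx22E c1 mulr0 subr0 in dM1.
have dM2 := rec_det H2 hM2.
have dM1' := rec_det H2 hM1.
(* The commutator of M1 and M2 is unipotent and nontrivial. *)
pose Z := M1 *m M2 *m (invmx M1 *m invmx M2).
have hZ : G2 Z.
  by apply: (rec_M H2); apply: (rec_M H2) => //; exact: (rec_V H2).
pose a := M1 0 0; pose d := M1 1 1; pose s := N 0 0; pose t := N 1 1.
have ad : a * d = 1 by [].
have st : s * t = 1 by [].
have ZE : ((Z 0 0 = (a * d) * (s * t)) * (Z 1 1 = (a * d) * (s * t))) *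
   (Z 1 0 = (s - t) * (d * d * t - a * d * t)).
  rewrite /Z !mulmx2E (invmx_det1 dM1') (invmx_det1 dM2) !mx2E !M2E c1 b1 b2.
  by rewrite -/a -/d -/s -/t; do ![split]; ring.
have t0 : t != 0.
  by apply: contra_eq_neq st => ->; rewrite mulr0 eq_sym oner_neq0.
have d0 : d != 0.
  by apply: contra_eq_neq ad => ->; rewrite mulr0 eq_sym oner_neq0.
have ad0 : d - a != 0.
  rewrite subr_eq0; apply/eqP => da; rewrite -/a in a1.
  have : `|a| * `|a| = 1 by rewrite -{2}da -normrM ad normr1.
  by nra.
have st0 : s - t != 0.
  rewrite subr_eq0; apply/eqP => sta; rewrite -/s in a2.
  have : `|s| * `|s| = 1 by rewrite {2}sta -normrM st normr1.
  by nra.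
have Z10 : Z 1 0 != 0.
  rewrite ZE (_ : d * d * t - a * d * t = d * t * (d - a)); last by ring.
  by rewrite !mulf_neq0.
have nZ : ~ psl_trivial Z.
  by case=> ZE'; move: Z10; rewrite ZE' !mxE /= ?oppr0 eqxx.
have := rec_hyperbolic H2 hZ nZ.
by rewrite tr_mx2E !ZE ad st mulr1 ger0_norm //; lra.
Qed.

End AllDirections.

(** * Contraction of vectors and finite generation *)

Section Generation.
Context {R : realType}.
Implicit Types (M N : 'M[R]_2) (v w p : R * R) (Gam E : set 'M[R]_2).

Inductive generated_by E : 'M[R]_2 -> Prop :=
| generated_in M : E M -> generated_by E M
| generated_mul M N :
    generated_by E M -> generated_by E N -> generated_by E (M *m N)
| generated_inv M : generated_by E M -> generated_by E (invmx M).

Lemma act_continuous1 M : continuous (fun v : R * R => (act M v).1).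
Proof.
move=> v; apply: cvgD; apply: cvgM; [exact: cvg_cst|exact: cvg_fst|
  exact: cvg_cst|exact: cvg_snd].
Qed.

Lemma act_continuous2 M : continuous (fun v : R * R => (act M v).2).
Proof.
move=> v; apply: cvgD; apply: cvgM; [exact: cvg_cst|exact: cvg_fst|
  exact: cvg_cst|exact: cvg_snd].
Qed.

Lemma nsq_act_continuous M : continuous (fun v : R * R => nsq (act M v)).
Proof.
move=> v; rewrite /nsq; under eq_fun do rewrite !expr2.
by rewrite ?expr2; apply: cvgD; apply: cvgM;
  [exact: act_continuous1|exact: act_continuous1|
   exact: act_continuous2|exact: act_continuous2].
Qed.

(** Compactness of the unit circle: a matrix that contracts a vector strictly
    also contracts the neighbouring ones. *)
Lemma uniform_contraction Gam :
  (forall v, v != 0 -> exists M, Gam M /\ nsq (act M v) < 4^-1 * nsq v) ->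
  exists K, forall v, v != 0 ->
    exists M, [/\ Gam M, bounded_by K M & nsq (act M v) <= 4^-1 * nsq v].
Proof.
move=> hG; apply: contrapT => /forallNP hK.
have ex (n : nat) : exists v, nsq v = 1 /\ forall M, Gam M ->
    bounded_by n%:R M -> 4^-1 < nsq (act M v).
  have /existsNP[v /not_implyP[v0 /forallNP hv]] := hK n%:R.
  have n0 : 0 < nsq v by rewrite nsq_gt0.
  exists ((Num.sqrt (nsq v))^-1 *: v); split.
    by rewrite nsqZ exprVn sqr_sqrtr ?nsq_ge0 // mulVf // gt_eqF.
  move=> M hM bM; rewrite actZ nsqZ exprVn sqr_sqrtr ?nsq_ge0 // mulrC.
  rewrite ltr_pdivlMr // ltNge; apply/negP => h; exact: (hv M).
have [u hu] := choice ex.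
have u1 n : `|(u n).1| <= 1 /\ `|(u n).2| <= 1.
  have [h _] := hu n; rewrite /nsq in h.
  split; rewrite -(@expr_le1 _ 2) // real_normK ?num_real //.
    by have := sqr_ge0 (u n).2; lra.
  by have := sqr_ge0 (u n).1; lra.
have [p hp] := bounded_pairs_cluster_nbhs u1.
have cont1 : continuous (fun v : R * R => nsq v).
  move=> v; have := @nsq_act_continuous 1%:M v.
  by under eq_fun do rewrite act1.
have p0 : p != 0.
  apply/eqP => p0; have : nbhs p [set v | nsq v < 1].
    apply: nbhs_sublevel; first exact: cont1.
    by rewrite p0 /nsq /= expr0n addr0.
  by move=> /(hp _ 0%N)[n _ /=]; have [-> _] := hu n; rewrite ltxx.
have [M [hM Mp]] := hG _ p0.
have [C bC] := bounded_by_exists M.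
pose N := (Num.truncn C).+1.
have CN : C <= N%:R by rewrite ltW // truncnS_gt.
have : nbhs p [set v | nsq (act M v) - 4^-1 * nsq v < 0].
  apply: (nbhs_sublevel (f := fun v => nsq (act M v) - 4^-1 * nsq v));
    last by rewrite subr_lt0.
  apply: cvgB; first exact: nsq_act_continuous.
  by apply: cvgM; [exact: cvg_cst|exact: cont1].
move=> /(hp _ N)[n Nn /=]; have [n1 hn] := hu n.
rewrite n1 mulr1 subr_lt0 => h.
have : bounded_by n%:R M.
  by move=> i j; rewrite (le_trans (bC i j)) // (le_trans CN) // ler_nat.
by move=> /(hn _ hM); rewrite ltNge ltW.
Qed.

Definition frob M : R :=
  M 0 0 ^+ 2 + M 0 1 ^+ 2 + (M 1 0 ^+ 2 + M 1 1 ^+ 2).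

Lemma frob_bounded M C : 1 <= C -> frob M <= C -> bounded_by C M.
Proof.
move=> C1 h.
have E i j : M i j ^+ 2 <= C -> `|M i j| <= C.
  move=> hij; rewrite -(@ler_pXn2r _ 2) ?nnegrE //; last by lra.
  by rewrite real_normK ?num_real // (le_trans hij) // expr2; nra.
rewrite /frob in h.
by have := (sqr_ge0 (M 0 0), sqr_ge0 (M 0 1), sqr_ge0 (M 1 0), sqr_ge0 (M 1 1));
  move=> [[[? ?] ?] ?]; apply: bounded_byP; apply: E; lra.
Qed.

(** Elements that contract single vectors pull every matrix of determinant 1
    back to a bounded set, because such a matrix is large only if it expands a single
    direction. *)
Lemma frob_contraction Gam (K : R) :
  (forall v, v != 0 ->
    exists M, [/\ Gam M, bounded_by K M & nsq (act M v) <= 4^-1 * nsq v]) ->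
  forall N, \det N = 1 -> exists M, [/\ Gam M, bounded_by K M &
    frob (M *m N) <= 4^-1 * frob N + 2 * K ^+ 2].
Proof.
move=> hG N dN; rewrite det_mx22E in dN.
pose al := N 0 0 ^+ 2 + N 0 1 ^+ 2.
pose be := N 0 0 * N 1 0 + N 0 1 * N 1 1.
pose de := N 1 0 ^+ 2 + N 1 1 ^+ 2.
have fN : frob N = al + de by [].
have D : al * de - be ^+ 2 = 1.
  rewrite (_ : _ - _ = (N 0 0 * N 1 1 - N 0 1 * N 1 0) ^+ 2).
    by rewrite dN expr1n.
  by rewrite /al /be /de; ring.
have al0 : 0 <= al by rewrite addr_ge0 ?sqr_ge0.
have de0 : 0 <= de by rewrite addr_ge0 ?sqr_ge0.
have fMN M : frob (M *m N) =
   (M 0 0 ^+ 2 + M 1 0 ^+ 2) * al + 2 * (M 0 0 * M 0 1 + M 1 0 * M 1 1) * be +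
   (M 0 1 ^+ 2 + M 1 1 ^+ 2) * de.
  by rewrite /frob !mulmx2E /al /be /de; ring.
have be2 := sqr_ge0 be.
have bsq M i j : bounded_by K M -> M i j ^+ 2 <= K ^+ 2.
  move=> bM; rewrite -real_normK ?num_real // ler_sqr ?nnegrE //.
  exact: le_trans (bM i j).
(* The Gram matrix of the rows of N has determinant 1, so it is the sum of the
   rank one matrix of (be, de) over de, and of a single entry 1 / de: the
   first is contracted, the second is at most 1 when de is at least 1. *)
case: (lerP al de) => ad.
  have de1 : 1 <= de by nra.
  have v0 : (be, de) != 0.
    by rewrite -nsq_gt0 /nsq /=; nra.
  have [M [hM bM cM]] := hG _ v0; exists M; split=> //.
  have E : de * frob (M *m N) =
      nsq (act M (be, de)) + (M 0 0 ^+ 2 + M 1 0 ^+ 2) * (al * de - be ^+ 2).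
    by rewrite fMN /nsq /act /=; ring.
  have F : nsq (be, de) <= de * frob N by rewrite fN /nsq /=; nra.
  rewrite D mulr1 in E.
  have h1 := bsq M 0 0 bM; have h2 := bsq M 1 0 bM.
  rewrite -(@ler_pM2l _ de) ?E; last by lra.
  have : 2 * K ^+ 2 <= de * (2 * K ^+ 2).
    by rewrite ler_peMl // mulr_ge0 // sqr_ge0.
  lra.
have al1 : 1 <= al by nra.
have v0 : (al, be) != 0.
  by rewrite -nsq_gt0 /nsq /=; nra.
have [M [hM bM cM]] := hG _ v0; exists M; split=> //.
have E : al * frob (M *m N) =
    nsq (act M (al, be)) + (M 0 1 ^+ 2 + M 1 1 ^+ 2) * (al * de - be ^+ 2).
  by rewrite fMN /nsq /act /=; ring.
have F : nsq (al, be) <= al * frob N by rewrite fN /nsq /=; nra.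
rewrite D mulr1 in E.
have h1 := bsq M 0 1 bM; have h2 := bsq M 1 1 bM.
rewrite -(@ler_pM2l _ al) ?E; last by lra.
have : 2 * K ^+ 2 <= al * (2 * K ^+ 2).
  by rewrite ler_peMl // mulr_ge0 // sqr_ge0.
lra.
Qed.

(** Left multiplication by a bounded element decreases the Frobenius norm of
    every large element, so each element is reached from a bounded one in
    finitely many steps. *)
Lemma contraction_generated Gam :
  (forall M, Gam M -> \det M = 1) ->
  (forall M N, Gam M -> Gam N -> Gam (M *m N)) ->
  (forall v, v != 0 -> exists M, Gam M /\ nsq (act M v) < 4^-1 * nsq v) ->
  exists C, forall M, Gam M ->
    generated_by [set N | Gam N /\ bounded_by C N] M.
Proof.
move=> detG mulG hG; have [K hK] := uniform_contraction hG.
have step := frob_contraction hK.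
pose L := 2 * K ^+ 2 + 2.
pose C := Num.max K (2 * L).
have KC : K <= C by rewrite le_max lexx.
have LC : 2 * L <= C by rewrite le_max lexx orbT.
have K2 := sqr_ge0 K.
have bnd D M : D <= C -> bounded_by D M -> bounded_by C M.
  by move=> DC bM i j; exact: le_trans DC.
exists C; suff main (n : nat) N : Gam N -> frob N <= n%:R ->
    generated_by [set N | Gam N /\ bounded_by C N] N.
  move=> M hM; apply: (main (Num.truncn (frob M)).+1) => //.
  by rewrite ltW // truncnS_gt.
elim: n N => [|n ih] N hN fN.
  apply: generated_in; split=> //; apply: (bnd 1).
    by rewrite /L in LC; lra.
  by apply: frob_bounded => //; rewrite (le_trans fN).
case: (lerP (frob N) (2 * L)) => fL.
  apply: generated_in; split=> //; apply: (bnd (2 * L)) => //.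
  by apply: frob_bounded => //; rewrite /L; lra.
have [M [hM bM fM]] := step N (detG _ hN).
have -> : N = invmx M *m (M *m N) by rewrite mulKmx // det1_unit // detG.
apply: generated_mul.
  by apply: generated_inv; apply: generated_in; split=> //; exact: bnd bM.
apply: ih; first exact: mulG.
by rewrite -natr1 /L in fN fL *; lra.
Qed.

End Generation.

(** * Continuity of complex-valued functions *)

Section ComplexContinuity.
Context {R : realType} {T : topologicalType}.
Implicit Types (f g : T -> R[i]) (x : T).

(** Complex numbers are topologized through their coordinates. *)
Definition ccontinuous_at x f :=
  {for x, continuous (fun y => complex.Re (f y))} /\
  {for x, continuous (fun y => complex.Im (f y))}.

Lemma ccontinuous_cst x (z : R[i]) : ccontinuous_at x (fun=> z).
Proof. by split; exact: cvg_cst. Qed.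

Lemma ccontinuous_real x (f : T -> R) : {for x, continuous f} ->
  ccontinuous_at x (fun y => (f y)%:C).
Proof. by split => //; exact: cvg_cst. Qed.

Lemma ccontinuousD x f g : ccontinuous_at x f -> ccontinuous_at x g ->
  ccontinuous_at x (fun y => f y + g y).
Proof.
move=> [f1 f2] [g1 g2]; split.
  rewrite (_ : (fun y => _) =
    (fun y => complex.Re (f y) + complex.Re (g y))); last first.
    by apply/funext => y; case: (f y); case: (g y).
  exact: (cvgD f1 g1).
rewrite (_ : (fun y => _) =
  (fun y => complex.Im (f y) + complex.Im (g y))); last first.
  by apply/funext => y; case: (f y); case: (g y).
exact: (cvgD f2 g2).
Qed.

Lemma ccontinuousN x f : ccontinuous_at x f ->
  ccontinuous_at x (fun y => - f y).
Proof.
move=> [f1 f2]; split.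
  rewrite (_ : (fun y => _) = (fun y => - complex.Re (f y))); last first.
    by apply/funext => y; case: (f y).
  exact: (cvgN f1).
rewrite (_ : (fun y => _) = (fun y => - complex.Im (f y))); last first.
  by apply/funext => y; case: (f y).
exact: (cvgN f2).
Qed.

Lemma ccontinuousM x f g : ccontinuous_at x f -> ccontinuous_at x g ->
  ccontinuous_at x (fun y => f y * g y).
Proof.
move=> [f1 f2] [g1 g2]; split.
  rewrite (_ : (fun y => _) = (fun y => complex.Re (f y) * complex.Re (g y)
      - complex.Im (f y) * complex.Im (g y))); last first.
    by apply/funext => y; case: (f y); case: (g y).
  exact: (cvgB (cvgM f1 g1) (cvgM f2 g2)).
rewrite (_ : (fun y => _) = (fun y => complex.Re (f y) * complex.Im (g y)
    + complex.Im (f y) * complex.Re (g y))); last first.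
  by apply/funext => y; case: (f y); case: (g y).
exact: (cvgD (cvgM f1 g2) (cvgM f2 g1)).
Qed.

Lemma ccontinuousV x f : f x != 0 -> ccontinuous_at x f ->
  ccontinuous_at x (fun y => (f y)^-1).
Proof.
move=> fx0 [f1 f2].
pose n y := complex.Re (f y) ^+ 2 + complex.Im (f y) ^+ 2.
have cn : {for x, continuous (fun y => n y)}.
  exact: (cvgD (cvgM f1 f1) (cvgM f2 f2)).
have n0 : n x != 0.
  rewrite /n paddr_eq0 ?sqr_ge0 // !sqrf_eq0.
  by move: fx0; case: (f x) => a b; rewrite eq_complex.
have cni : {for x, continuous (fun y => (n y)^-1)} by exact: (cvgV n0 cn).
split.
  rewrite (_ : (fun y => _) = (fun y => complex.Re (f y) * (n y)^-1)); last first.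
    by apply/funext => y; rewrite /n; case: (f y).
  exact: (cvgM f1 cni).
rewrite (_ : (fun y => _) = (fun y => - (complex.Im (f y) * (n y)^-1))); last first.
  by apply/funext => y; rewrite /n; case: (f y) => a b /=; rewrite ?mulNr.
exact: (cvgN (cvgM f2 cni)).
Qed.

Lemma ccontinuous_conj x f : ccontinuous_at x f ->
  ccontinuous_at x (fun y => (f y)^*).
Proof.
move=> [f1 f2]; split.
  rewrite (_ : (fun y => _) = (fun y => complex.Re (f y))) //.
  by apply/funext => y; case: (f y).
rewrite (_ : (fun y => _) = (fun y => - complex.Im (f y))); last first.
  by apply/funext => y; case: (f y).
exact: (cvgN f2).
Qed.

Lemma ccontinuousB x f g : ccontinuous_at x f -> ccontinuous_at x g ->
  ccontinuous_at x (fun y => f y - g y).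
Proof. by move=> cf cg; apply: ccontinuousD => //; exact: ccontinuousN. Qed.

Lemma ccontinuous_div x f g : g x != 0 -> ccontinuous_at x f ->
  ccontinuous_at x g -> ccontinuous_at x (fun y => f y / g y).
Proof. by move=> g0 cf cg; apply: ccontinuousM => //; exact: ccontinuousV. Qed.

Lemma ccontinuous_coord x f : ccontinuous_at x f ->
  {for x, continuous (fun y => complex_coord (f y))}.
Proof. by move=> [f1 f2]; exact: (cvg_pair f1 f2). Qed.

Lemma continuous_at_initial {Y : choiceType} {Z : topologicalType}
    (w : Y -> Z) (f : T -> initial_topology w) x :
  {for x, continuous (w \o f : T -> Z)} -> {for x, continuous f}.
Proof.
move=> cf U [?/= [[W oW <-]]] /= Wsfz /filterS; apply; apply: cf.
exact: open_nbhs_nbhs.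
Qed.

Lemma continuous_at_half_plane (f : T -> half_plane R) x :
  ccontinuous_at x (fun y => val (f y)) -> {for x, continuous f}.
Proof. by move=> /ccontinuous_coord cf; exact: continuous_at_initial. Qed.

Lemma continuous_at_unit_tangent (f : T -> unit_tangent R) x :
  ccontinuous_at x (fun y => (val (f y)).1) ->
  ccontinuous_at x (fun y => (val (f y)).2) -> {for x, continuous f}.
Proof.
move=> /ccontinuous_coord c1 /ccontinuous_coord c2.
by apply: continuous_at_initial; exact: (cvg_pair c1 c2).
Qed.

End ComplexContinuity.

Section Coordinates.
Context {R : realType}.

Lemma half_plane_val_continuous (z : half_plane R) :
  ccontinuous_at z (fun w : half_plane R => val w).
Proof.
have c : {for z, continuous (fun w : half_plane R => complex_coord (val w))}.
  exact: (@initial_continuous _ _ (fun w : half_plane R => complex_coord (val w))).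
split.
  exact: (cvg_comp _ _ c (@cvg_fst _ _ _ _ _)).
exact: (cvg_comp _ _ c (@cvg_snd _ _ _ _ _)).
Qed.

Lemma unit_tangent_val_continuous (u : unit_tangent R) :
  ccontinuous_at u (fun w : unit_tangent R => (val w).1) /\
  ccontinuous_at u (fun w : unit_tangent R => (val w).2).
Proof.
pose c (w : unit_tangent R) : (R * R) * (R * R) :=
  (complex_coord (val w).1, complex_coord (val w).2).
have cc : {for u, continuous (fun w : unit_tangent R => c w)}.
  exact: (@initial_continuous _ _ c).
have c1 : {for u, continuous (fun w : unit_tangent R => (c w).1)}.
  exact: (cvg_comp _ _ cc (@cvg_fst _ _ _ _ _)).
have c2 : {for u, continuous (fun w : unit_tangent R => (c w).2)}.
  exact: (cvg_comp _ _ cc (@cvg_snd _ _ _ _ _)).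
split; split.
- exact: (cvg_comp _ _ c1 (@cvg_fst _ _ _ _ _)).
- exact: (cvg_comp _ _ c1 (@cvg_snd _ _ _ _ _)).
- exact: (cvg_comp _ _ c2 (@cvg_fst _ _ _ _ _)).
- exact: (cvg_comp _ _ c2 (@cvg_snd _ _ _ _ _)).
Qed.

End Coordinates.

(** * The action of SL_2 on the half-plane and on its unit tangent bundle *)

Section Moebius.
Context {R : realType}.
Implicit Types (M N g h : 'M[R]_2) (z w : half_plane R) (u : unit_tangent R).

Lemma normc_gt0 (z : R[i]) : z != 0 -> 0 < normc z.
Proof.
by move=> z0; rewrite lt0r normc_ge0 andbT;
  apply: contraNneq z0 => /Normc.eq0_normc ->.
Qed.

Lemma mulc_conj (z : R[i]) : z * z^* = (normc z ^+ 2)%:C.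
Proof.
rewrite normc_sqr; case: z => a b; apply/eqP; rewrite eq_complex /=.
by apply/andP; split; apply/eqP; ring.
Qed.

Lemma mobius_ImE M (z : R[i]) : \det M = 1 -> in_half_plane z ->
  complex.Im (mobius M z) = complex.Im z / normc (mobius_den M z) ^+ 2.
Proof.
move=> dM z0; apply: (@complexI R); rewrite mobius_Im // mulc_conj.
by rewrite fmorph_div.
Qed.

Lemma mobius_half_plane M (z : R[i]) : \det M = 1 -> in_half_plane z ->
  in_half_plane (mobius M z).
Proof.
move=> dM z0; rewrite /in_half_plane mobius_ImE // divr_gt0 // exprn_gt0 //.
by apply: normc_gt0; exact: mobius_den_neq0.
Qed.

Lemma mobius_tangent_unit M (u : R[i] * R[i]) : \det M = 1 ->
  in_unit_tangent u -> in_unit_tangent (mobius_tangent M u).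
Proof.
move=> dM /andP[u0 /eqP u1]; rewrite /in_unit_tangent mobius_half_plane //=.
by rewrite mobius_ImE // Normc.normcM Normc.normcV normcX u1.
Qed.

Definition mob M z : half_plane R := insubd z (mobius M (val z)).

Definition mobt M u : unit_tangent R := insubd u (mobius_tangent M (val u)).

Lemma val_mob M z : \det M = 1 -> val (mob M z) = mobius M (val z).
Proof.
by move=> dM; rewrite insubdK //; apply: mobius_half_plane => //; exact: (valP z).
Qed.

Lemma val_mobt M u : \det M = 1 -> val (mobt M u) = mobius_tangent M (val u).
Proof.
by move=> dM; rewrite insubdK //; apply: mobius_tangent_unit => //; exact: (valP u).
Qed.

Lemma mob_den_neq0 M z : \det M = 1 -> mobius_den M (val z) != 0.
Proof. by move=> dM; apply: mobius_den_neq0 => //; exact: (valP z). Qed.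

Lemma mobt_den_neq0 M u : \det M = 1 -> mobius_den M (val u).1 != 0.
Proof. by move=> dM; apply: mobius_den_neq0 => //; case/andP: (valP u). Qed.

Lemma mobM M N z : \det M = 1 -> \det N = 1 ->
  mob (M *m N) z = mob M (mob N z).
Proof.
move=> dM dN; apply: val_inj; rewrite !val_mob ?det_mul1 // mobiusM //.
exact: mob_den_neq0.
Qed.

Lemma mobtM M N u : \det M = 1 -> \det N = 1 ->
  mobt (M *m N) u = mobt M (mobt N u).
Proof.
move=> dM dN; apply: val_inj; rewrite !val_mobt ?det_mul1 // mobius_tangentM //.
exact: mobt_den_neq0.
Qed.

Lemma mob1 z : mob 1%:M z = z.
Proof. by apply: val_inj; rewrite val_mob ?det1 // mobius1. Qed.

Lemma mobK M : \det M = 1 -> cancel (mob M) (mob (invmx M)).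
Proof.
by move=> dM z; rewrite -mobM ?det_invmx1 // mulVmx ?mob1 // det1_unit.
Qed.

Lemma mobius_den_ccontinuous {T : topologicalType} (f : T -> R[i]) M x :
  ccontinuous_at x f -> ccontinuous_at x (fun y => mobius_den M (f y)).
Proof.
move=> cf; apply: ccontinuousD; last exact: ccontinuous_cst.
by apply: ccontinuousM => //; exact: ccontinuous_cst.
Qed.

Lemma mobius_ccontinuous {T : topologicalType} (f : T -> R[i]) M x :
  mobius_den M (f x) != 0 ->
  ccontinuous_at x f -> ccontinuous_at x (fun y => mobius M (f y)).
Proof.
move=> d0 cf; apply: ccontinuous_div => //; last exact: mobius_den_ccontinuous.
apply: ccontinuousD; last exact: ccontinuous_cst.
by apply: ccontinuousM => //; exact: ccontinuous_cst.
Qed.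

Lemma mob_continuous M : \det M = 1 -> continuous (mob M).
Proof.
move=> dM z; apply: continuous_at_half_plane.
under eq_fun do rewrite val_mob //.
apply: mobius_ccontinuous; first exact: mob_den_neq0.
exact: half_plane_val_continuous.
Qed.

Lemma mobt_continuous M : \det M = 1 -> continuous (mobt M).
Proof.
move=> dM u; have [c1 c2] := unit_tangent_val_continuous u.
apply: continuous_at_unit_tangent.
  under eq_fun do rewrite val_mobt //.
  by apply: mobius_ccontinuous => //; exact: mobt_den_neq0.
under eq_fun do rewrite val_mobt //=.
apply: ccontinuous_div => //; first by rewrite expf_neq0 // mobt_den_neq0.
by under eq_fun do rewrite expr2; apply: ccontinuousM;
  exact: mobius_den_ccontinuous.
Qed.

End Moebius.

Section Frames.
Context {R : realType}.
Implicit Types (M N g h : 'M[R]_2) (u : unit_tangent R).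

(** ** Frames: SL_2 as the unit tangent bundle *)

Lemma up_subproof : in_unit_tangent ('i, 'i : R[i]).
Proof. by rewrite /in_unit_tangent /in_half_plane normc_i /= ltr01 eqxx. Qed.

Definition up : unit_tangent R := Sub _ up_subproof.

(** The bottom row of a frame of the vector [xi] at [z] gives the square root
    [j] of ['i / xi], by the formula for the derivative of a homography. *)
Lemma exists_frame u : exists2 g, \det g = 1 & u = mobt g up.
Proof.
have /andP[y0 /eqP vy] := valP u.
set z := (val u).1 in y0 vy; set xi := (val u).2 in vy.
have xi0 : xi != 0.
  apply: contraTneq y0 => xi0; rewrite /in_half_plane -vy xi0.
  by rewrite Normc.normc0 ltxx.
have i0 : 'i != 0 :> R[i] by rewrite eq_complex /= oner_eq0 andbF.
pose j := sqrtc ('i / xi).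
have j2 : j ^+ 2 = 'i / xi by exact: sqr_sqrtc.
have jn : normc j ^+ 2 = (complex.Im z)^-1.
  by rewrite -normcX j2 Normc.normcM Normc.normcV normc_i vy mul1r.
pose k := z * j.
have cE (w : R[i]) : (complex.Im w)%:C * 'i + (complex.Re w)%:C = w.
  case: w => a b; apply/eqP; rewrite eq_complex /=.
  by apply/andP; split; apply/eqP; ring.
have j0 : j != 0.
  apply/eqP => j0; move/eqP: j2; rewrite j0 expr0n /= eq_sym.
  by apply/negP; rewrite mulf_neq0 // invr_neq0.
pose g := mx2 (complex.Im k) (complex.Re k) (complex.Im j) (complex.Re j).
have dg : \det g = 1.
  rewrite det_mx2 /k; move: jn; rewrite normc_sqr.
  move: y0; rewrite /in_half_plane; case: (z) => x y; case: (j) => a b /= y0 jn.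
  transitivity (y * (a ^+ 2 + b ^+ 2)); first ring.
  by rewrite jn divff // gt_eqF.
exists g => //.
apply: val_inj; rewrite val_mobt //= /mobius_tangent /mobius /mobius_den /=.
rewrite !mx2E !cE j2 /k mulfK // invf_div mulrCA divff // mulr1.
exact: surjective_pairing.
Qed.

Lemma row_nsq_gt0 g : \det g = 1 -> 0 < g 1 0 ^+ 2 + g 1 1 ^+ 2.
Proof.
rewrite det_mx22E => dg; rewrite lt0r addr_ge0 ?sqr_ge0 // andbT.
rewrite paddr_eq0 ?sqr_ge0 // !sqrf_eq0.
apply/negP => /andP[/eqP c0 /eqP d0].
by move: dg; rewrite c0 d0 !mulr0 subr0 => /eqP; rewrite eq_sym oner_eq0.
Qed.

Lemma val_mobt_up g : \det g = 1 ->
  let n := g 1 0 ^+ 2 + g 1 1 ^+ 2 in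
  val (mobt g up) = (((g 0 0 * g 1 0 + g 0 1 * g 1 1) / n) +i* n^-1,
    (2 * g 1 0 * g 1 1 / n ^+ 2) +i* ((g 1 1 ^+ 2 - g 1 0 ^+ 2) / n ^+ 2)).
Proof.
move=> dg n; have npos : 0 < n := row_nsq_gt0 dg.
have n0 : n != 0 by rewrite gt_eqF.
have d0 := mobt_den_neq0 up dg.
rewrite val_mobt //; rewrite det_mx22E in dg.
have hc : g 1 0 = g 1 0 * (g 0 0 * g 1 1 - g 0 1 * g 1 0) by rewrite dg mulr1.
have hd : g 1 1 = g 1 1 * (g 0 0 * g 1 1 - g 0 1 * g 1 0) by rewrite dg mulr1.
have nn : n^-1 * n = 1 by rewrite mulVf.
have nE : n = g 1 0 ^+ 2 + g 1 1 ^+ 2 by [].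
rewrite -!exprVn; move: (n) (n^-1) n0 nn nE => {npos}n m n0 nn nE.
rewrite /mobius_tangent /mobius; congr pair.
  apply: (mulIf d0); rewrite divfK // /mobius_den; apply/eqP.
  rewrite eq_complex /=; apply/andP; split; apply/eqP; apply: (mulIf n0).
    transitivity (((g 0 0 * g 1 0 + g 0 1 * g 1 1) * g 1 1 - g 1 0) * (m * n)).
      by rewrite nn mulr1 nE; lra.
    by ring.
  transitivity (((g 0 0 * g 1 0 + g 0 1 * g 1 1) * g 1 0 + g 1 1) * (m * n)).
    by rewrite nn mulr1 nE; lra.
  by ring.
have d20 : mobius_den g 'i ^+ 2 != 0 by rewrite expf_neq0.
apply: (mulIf d20); rewrite divfK // /mobius_den; apply/eqP.
rewrite eq_complex /=; apply/andP; split; apply/eqP; first by ring.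
transitivity ((m * n) ^+ 2); first by rewrite nn expr1n.
by rewrite exprMn nE; ring.
Qed.

Definition unip (s : R) : 'M[R]_2 := mx2 1 s 0 1.

Definition dilat (r : R) : 'M[R]_2 := mx2 r 0 0 r^-1.

Lemma unip_det s : \det (unip s) = 1.
Proof. by rewrite det_mx2; ring. Qed.

Lemma dilat_det r : r != 0 -> \det (dilat r) = 1.
Proof. by move=> r0; rewrite det_mx2 divff // mulr0 subr0. Qed.

Lemma horocycle_flow_frame g s : \det g = 1 ->
  horocycle_flow s (mobt g up) = mobt (g *m unip s) up.
Proof.
move=> dg; rewrite mobtM // ?unip_det //; apply: val_inj.
rewrite /= !val_mobt // ?unip_det // horocycle_flow_mobius //; last exact: (valP up).
congr (mobius_tangent _ _); rewrite horocycle_flow_up.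
rewrite /mobius_tangent /mobius /mobius_den /= !mx2E mul0r add0r expr1n !divr1.
rewrite mul1r; congr pair; apply/eqP; rewrite eq_complex /=.
by apply/andP; split; apply/eqP; ring.
Qed.

Lemma geodesic_flow_frame g t : \det g = 1 ->
  geodesic_flow t (mobt g up) = mobt (g *m dilat (expR (t / 2))) up.
Proof.
move=> dg; have e0 : expR (t / 2) != 0 by rewrite gt_eqF // expR_gt0.
rewrite mobtM // ?dilat_det //; apply: val_inj.
rewrite /= !val_mobt // ?dilat_det // geodesic_flow_mobius //;
  last exact: (valP up).
congr (mobius_tangent _ _); rewrite geodesic_flow_up.
have -> : expR t = expR (t / 2) ^+ 2.
  by rewrite expr2 -expRD; congr expR; field.
move: (expR (t / 2)) e0 => e e0.
have c0 : e%:C != 0 by rewrite eq_complex /= negb_and e0.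
have E : 0 +i* e ^+ 2 = e%:C ^+ 2 * 'i :> R[i].
  by apply/eqP; rewrite eq_complex /=; apply/andP; split; apply/eqP; ring.
rewrite /mobius_tangent /mobius /mobius_den /= !mx2E E fmorphV /=.
rewrite (_ : 0%:C = 0) // mul0r add0r addr0.
by congr pair; field.
Qed.

(** The exponential of a Busemann function: it is constant on horocycles, and
    equals the squared length of the first column of any frame of [u]. *)
Definition height (u : R[i] * R[i]) : R :=
  let x := complex.Re u.1 in let y := complex.Im u.1 in
  (x ^+ 2 + 1) * (y - complex.Im u.2) / (2 * y ^+ 2) +
  x * complex.Re u.2 / y + (y + complex.Im u.2) / 2.

Lemma height_frame g : \det g = 1 ->
  height (val (mobt g up)) = nsq (g 0 0, g 1 0).
Proof.
move=> dg; rewrite val_mobt_up // /height /nsq /=.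
have := row_nsq_gt0 dg; rewrite det_mx22E in dg.
set n := _ + _ => npos; have n0 : n != 0 by rewrite gt_eqF.
have nE : n = g 1 0 ^+ 2 + g 1 1 ^+ 2 by [].
have aE : g 0 0 = ((g 0 0 * g 1 0 + g 0 1 * g 1 1) * g 1 0 + g 1 1) / n.
  apply: (mulIf n0); rewrite divfK // nE.
  have : g 1 1 = g 1 1 * (g 0 0 * g 1 1 - g 0 1 * g 1 0) by rewrite dg mulr1.
  lra.
rewrite [in RHS]aE; move: (g 0 0 * g 1 0 + g 0 1 * g 1 1) => X.
rewrite (_ : g 1 1 ^+ 2 = n - g 1 0 ^+ 2); last by rewrite nE; ring.
transitivity ((X ^+ 2 * g 1 0 ^+ 2 + 2 * X * g 1 0 * g 1 1 +
   (n - g 1 0 ^+ 2)) / n ^+ 2 + g 1 0 ^+ 2); first by field.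
rewrite (_ : n - g 1 0 ^+ 2 = g 1 1 ^+ 2); last by rewrite nE; ring.
by field.
Qed.

Lemma height_continuous u :
  {for u, continuous (fun w : unit_tangent R => height (val w))}.
Proof.
have [[x1 y1] [x2 y2]] := unit_tangent_val_continuous u.
have y0 : complex.Im (val u).1 != 0.
  by have /andP[y0 _] := valP u; rewrite gt_eqF.
have k0 : 2 * (complex.Im (val u).1 * complex.Im (val u).1) != 0.
  by rewrite !mulf_neq0 // pnatr_eq0.
have cst (c : R) : {for u, continuous (fun _ : unit_tangent R => c)}.
  exact: (@cst_continuous _ _ c u).
have M (f g : unit_tangent R -> R) : {for u, continuous f} ->
    {for u, continuous g} -> {for u, continuous (fun w => f w * g w)}.
  by move=> cf cg; exact: (cvgM cf cg).
have D (f g : unit_tangent R -> R) : {for u, continuous f} ->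
    {for u, continuous g} -> {for u, continuous (fun w => f w + g w)}.
  by move=> cf cg; exact: (cvgD cf cg).
have V (f : unit_tangent R -> R) : f u != 0 -> {for u, continuous f} ->
    {for u, continuous (fun w => (f w)^-1)}.
  by move=> f0 cf; exact: (cvgV f0 cf).
have N (f : unit_tangent R -> R) : {for u, continuous f} ->
    {for u, continuous (fun w => - f w)}.
  by move=> cf; exact: (cvgN cf).
exact: (D _ _ (D _ _ (M _ _ (M _ _ (D _ _ (M _ _ x1 x1) (cst 1))
  (D _ _ y1 (N _ y2))) (V _ k0 (M _ _ (cst 2) (M _ _ y1 y1))))
  (M _ _ (M _ _ x1 x2) (V _ y0 y1))) (M _ _ (D _ _ y1 y2) (cst 2^-1))).
Qed.

Definition frame_up (v : R * R) : unit_tangent R := mobt (frame v) up.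

Lemma ccontinuous_near {T : topologicalType} (f g : T -> R[i]) x :
  (\forall y \near x, f y = g y) -> ccontinuous_at x g -> ccontinuous_at x f.
Proof.
move=> fg [g1 g2]; have fgx : f x = g x by exact: nbhs_singleton fg.
split; rewrite /prop_for /continuous_at fgx; [apply: cvg_trans g1|apply: cvg_trans g2];
  by apply: near_eq_cvg; apply: filterS fg => y ->.
Qed.

Lemma frame_up_continuous v : v != 0 -> {for v, continuous frame_up}.
Proof.
move=> v0; have n0 : nsq v != 0 by rewrite gt_eqF // nsq_gt0.
have c1 : {for v, continuous (fun w : R * R => w.1)} by exact: cvg_fst.
have c2 : {for v, continuous (fun w : R * R => w.2)} by exact: cvg_snd.
have cnn : {for v, continuous (fun w : R * R => nsq w)}.
  exact: (cvgD (cvgM c1 c1) (cvgM c2 c2)).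
have cn : {for v, continuous (fun w : R * R => (nsq w)^-1)}.
  exact: (cvgV n0 cnn).
have near0 : \forall w \near v, w != 0.
  have : nbhs v [set w | - nsq w < 0].
    apply: (nbhs_sublevel (f := fun w => - nsq w)); first exact: (cvgN cnn).
    by rewrite oppr_lt0 nsq_gt0.
  by apply: filterS => w /=; rewrite oppr_lt0 nsq_gt0.
have cd : ccontinuous_at v (fun w => mobius_den (frame w) 'i).
  under eq_fun do rewrite /mobius_den !mx2E.
  apply: ccontinuousD; last by apply: ccontinuous_real; exact: (cvgM c1 cn).
  by apply: ccontinuousM; [exact: ccontinuous_real|exact: ccontinuous_cst].
have cm : ccontinuous_at v
    (fun w => (frame w 0 0)%:C * 'i + (frame w 0 1)%:C).
  under eq_fun do rewrite !mx2E.
  apply: ccontinuousD; last first.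
    by apply: ccontinuous_real; exact: (cvgM (cvgN c2) cn).
  by apply: ccontinuousM; [exact: ccontinuous_real|exact: ccontinuous_cst].
have d0 : mobius_den (frame v) 'i != 0 := mobt_den_neq0 up (frame_det v0).
apply: continuous_at_unit_tangent.
  apply: (ccontinuous_near (g := fun w => mobius (frame w) 'i)).
    by apply: filterS near0 => w w0; rewrite val_mobt // frame_det.
  exact: ccontinuous_div.
apply: (ccontinuous_near (g := fun w => 'i / (mobius_den (frame w) 'i) ^+ 2)).
  by apply: filterS near0 => w w0; rewrite val_mobt // frame_det.
apply: ccontinuous_div; [by rewrite expf_neq0|exact: ccontinuous_cst|].
by under eq_fun do rewrite expr2; exact: ccontinuousM.
Qed.

Lemma geodesic_flow_continuous t : continuous (@geodesic_flow R t).
Proof.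
move=> u; have [c1 c2] := unit_tangent_val_continuous u.
have y0 : 0 < complex.Im (val u).1 by case/andP: (valP u).
have i0 : 'i != 0 :> R[i] by rewrite eq_complex /= oner_eq0 andbF.
have b0 : 'i * (complex.Im (val u).1)%:C != 0 :> R[i].
  by rewrite mulf_neq0 // -(rmorph0 (real_complex R)) (inj_eq (@complexI R)) gt_eqF.
pose T := (expR t - 1) / (expR t + 1) : R.
have cz : ccontinuous_at u (fun w : unit_tangent R =>
    1 - T%:C * disc_direction (val w)).
  apply: ccontinuousB; first exact: ccontinuous_cst.
  apply: ccontinuousM; first exact: ccontinuous_cst.
  apply: ccontinuous_div => //.
  apply: ccontinuousM; first exact: ccontinuous_cst.
  by apply: ccontinuous_real; case: c1.
have z0 : 1 - T%:C * disc_direction (val u) != 0.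
  apply: normc_lt1_neq0.
  rewrite Normc.normcM normc_real normc_disc_direction ?mulr1 ?tanh_half_lt1 //.
  exact: (valP u).
have cz' : ccontinuous_at u (fun w : unit_tangent R =>
    T%:C * disc_direction (val w)).
  rewrite (_ : (fun w => _) = (fun w : unit_tangent R =>
     1 - (1 - T%:C * disc_direction (val w)))); last first.
    by apply/funext => w; ring.
  by apply: ccontinuousB => //; exact: ccontinuous_cst.
apply: continuous_at_unit_tangent => /=.
  apply: ccontinuous_div => //; apply: ccontinuousB => //.
  by apply: ccontinuousM => //; exact: ccontinuous_conj.
apply: ccontinuous_div; first by rewrite expf_neq0.
  by apply: ccontinuousM => //; exact: ccontinuous_cst.
by under eq_fun do rewrite expr2; exact: ccontinuousM.
Qed.

End Frames.

(** * Discreteness and proper discontinuity *)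

Section Discreteness.
Context {R : realType} (G : fuchsian R).
Implicit Types (M N : 'M[R]_2) (z w : half_plane R).

(** Isolation of the identity suffices for discreteness: differences of
    elements reduce to it by left translation. *)
Lemma fuchsian_gap : exists2 e, 0 < e & forall M, fuchsian_set G M ->
  (forall i j, `|(1%:M : 'M[R]_2) i j - M i j| < e) -> M = 1%:M.
Proof.
have [_ [V nV VG]] := fuchsian_discrete (fuchsian1 G).
move/nbhs_ballP: nV => [e /= e0 eV]; exists e => // M hM Me.
have : (V `&` fuchsian_set G) M.
  by split=> //; apply: eV; split=> // i j; exact: Me.
by rewrite VG.
Qed.

(** Two bounded elements in the same small cell of a grid differ by a factor
    close to the identity, hence coincide, and there are finitely many cells. *)
Lemma fuchsian_finite (C : R) :
  finite_set [set M | fuchsian_set G M /\ bounded_by C M].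
Proof.
set A := [set M | _].
have [e e0 gap] := fuchsian_gap.
case: (pselect (A !=set0)) => [[M0 [hM0 bM0]]|noA]; last first.
  by rewrite (_ : A = set0) //; apply/seteqP; split=> // M AM; apply: noA; exists M.
have C0 : 0 <= C by exact: le_trans (bM0 0 0).
pose d := e / (2 * C + 1).
have d0 : 0 < d by rewrite divr_gt0 //; lra.
pose n := Num.truncn (2 * C / d).
pose g M : {ffun 'I_2 * 'I_2 -> 'I_n.+1} :=
  [ffun p => inord (Num.truncn ((M p.1 p.2 + C) / d))].
have cell (x y : R) : `|x| <= C -> `|y| <= C ->
    Num.truncn ((x + C) / d) = Num.truncn ((y + C) / d) -> `|x - y| < d.
  have aux (s t : R) : `|s| <= C -> `|t| <= C ->
      Num.truncn ((s + C) / d) = Num.truncn ((t + C) / d) -> s - t < d.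
    rewrite !ler_norml => /andP[x1 x2] /andP[y1 y2] E.
    have hx : (s + C) / d < (Num.truncn ((t + C) / d)).+1%:R.
      by rewrite -E truncnS_gt.
    have hy : (Num.truncn ((t + C) / d))%:R <= (t + C) / d.
      by rewrite truncn_le divr_ge0 //; lra.
    rewrite -natr1 in hx.
    have := lt_le_trans hx (lerD hy (lexx 1)).
    rewrite ltr_pdivrMr // mulrDl divfK ?gt_eqF // mul1r; lra.
  move=> hx hy E; rewrite ltr_norml; apply/andP; split.
    by have := aux _ _ hy hx (esym E); lra.
  exact: aux.
have inj M N : A M -> A N -> g M = g N -> M = N.
  move=> [hM bM] [hN bN] gE.
  have uM := fuchsian_unit hM; have dM := fuchsian_det hM.
  suff E : invmx M *m N = 1%:M by rewrite -[RHS](mulKVmx uM) E mulmx1.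
  apply: gap; first by apply: fuchsianM => //; exact: fuchsianV.
  move=> i j; have -> : (1%:M : 'M[R]_2) i j - (invmx M *m N) i j =
      (invmx M *m (M - N)) i j by rewrite mulmxBr mulVmx // !mxE.
  have MN k l : `|(M - N) k l| < d.
    rewrite !mxE; apply: cell => //.
    have := congr1 (fun f : {ffun _ -> _} => val (f (k, l))) gE.
    rewrite /g !ffunE /= !inordK // ltnS /n; apply: le_truncn;
      rewrite ler_pM2r ?invr_gt0 //.
      by have := bN k l; rewrite ler_norml => /andP[_ ?]; lra.
    by have := bM k l; rewrite ler_norml => /andP[_ ?]; lra.
  rewrite mulmx2E (le_lt_trans (ler_normD _ _)) // !normrM.
  have bi := bounded_by_inv dM bM.
  have h1 : `|invmx M i 0| * `|(M - N) 0 j| <= C * d.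
    by apply: ler_pM => //; exact: ltW.
  have h2 : `|invmx M i 1| * `|(M - N) 1 j| <= C * d.
    by apply: ler_pM => //; exact: ltW.
  have : (2 * C + 1) * d = e by rewrite mulrC divfK // gt_eqF //; lra.
  lra.
pose h y := xget 0 [set M | A M /\ g M = y].
have : finite_set [set` (predT : pred {ffun 'I_2 * 'I_2 -> 'I_n.+1})].
  exact: finite_finpred.
move=> /(finite_image h); apply: sub_finite_set => M AM.
exists (g M) => //; rewrite /h; case: xgetP => [N _ [AN gN]|/(_ M) []] //.
exact: inj.
Qed.

Lemma mob_coords M (x y x' y' : R) : \det M = 1 -> 0 < y ->
  mobius M (x +i* y) = x' +i* y' ->
  let p := M 1 0 * x + M 1 1 in let q := M 1 0 * y in
  [/\ x' * p - y' * q = M 0 0 * x + M 0 1, x' * q + y' * p = M 0 0 * y &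
      y' * (p ^+ 2 + q ^+ 2) = y].
Proof.
move=> dM y0 E p q.
have d0 : mobius_den M (x +i* y) != 0 by exact: mobius_den_neq0.
have : mobius M (x +i* y) * mobius_den M (x +i* y) =
    (M 0 0)%:C * (x +i* y) + (M 0 1)%:C by rewrite divfK.
rewrite E /mobius_den => /eqP; rewrite eq_complex /= => /andP[/eqP e1 /eqP e2].
have e1' : x' * p - y' * q = M 0 0 * x + M 0 1 by rewrite /p /q; lra.
have e2' : x' * q + y' * p = M 0 0 * y by rewrite /p /q; lra.
split=> //.
transitivity ((x' * q + y' * p) * p - (x' * p - y' * q) * q); first by ring.
rewrite e1' e2' /p /q; rewrite det_mx22E in dM.
transitivity ((M 0 0 * M 1 1 - M 0 1 * M 1 0) * y); first by ring.
by rewrite dM mul1r.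
Qed.

(** An element of trace larger than 2 moves all points by a distance bounded
    below in terms of its trace only.  With [p + i q] the denominator at
    [x + i y], the right-hand side is the squared modulus of the quadratic
    polynomial whose roots are the fixed points. *)
Lemma displacement M (x y x' y' : R) : \det M = 1 -> 0 < y ->
  mobius M (x +i* y) = x' +i* y' ->
  y ^+ 2 * ((\tr M) ^+ 2 - 4) <= ((x - x') ^+ 2 + (y - y') ^+ 2) *
    ((M 1 0 * x + M 1 1) ^+ 2 + (M 1 0 * y) ^+ 2).
Proof.
move=> dM y0 /(mob_coords dM y0) [e1 e2 _].
move: e1 e2; set p := M 1 0 * x + M 1 1; set q := M 1 0 * y => e1 e2.
rewrite det_mx22E in dM.
have -> : ((x - x') ^+ 2 + (y - y') ^+ 2) * (p ^+ 2 + q ^+ 2) =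
  (x * p - y * q - (x' * p - y' * q)) ^+ 2 +
  (x * q + y * p - (x' * q + y' * p)) ^+ 2 by ring.
rewrite e1 e2.
have -> : (x * p - y * q - (M 0 0 * x + M 0 1)) ^+ 2 +
    (x * q + y * p - M 0 0 * y) ^+ 2 =
  (x * p - (M 0 0 * x + M 0 1) + y * q) ^+ 2 + y ^+ 2 *
    ((M 0 0 + M 1 1) ^+ 2 - 4 * (M 0 0 * M 1 1 - M 0 1 * M 1 0)).
  by rewrite /p /q; ring.
by rewrite dM mulr1 tr_mx2E lerDr sqr_ge0.
Qed.

Lemma coords_bounded M (x y x' y' B : R) : 1 <= B -> 0 < y -> 1 <= B * y ->
  `|x| <= B -> `|x'| <= B -> `|y'| <= B ->
  let p := M 1 0 * x + M 1 1 in let q := M 1 0 * y in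
  `|p| <= 2 -> `|q| <= 2 ->
  x' * p - y' * q = M 0 0 * x + M 0 1 -> x' * q + y' * p = M 0 0 * y ->
  bounded_by (10 * B ^+ 3) M.
Proof.
move=> B1 yp yi xB xB' yB' p q p2 q2' q1 q2.
have B0 : 0 <= B by exact: le_trans B1.
have divy (t c : R) : 0 <= c -> `|t * y| <= c -> `|t| <= B * c.
  move=> c0; rewrite normrM (gtr0_norm yp) => h.
  apply: (@le_trans _ _ (`|t| * (B * y))); first by rewrite ler_peMr.
  by rewrite mulrCA ler_wpM2l //; lra.
have cB : `|M 1 0| <= B * 2 by apply: divy.
have prod (s t c c' : R) : `|s| <= c -> `|t| <= c' -> `|s * t| <= c * c'.
  by move=> ? ?; rewrite normrM ler_pM.
have add (s t c c' : R) : `|s| <= c -> `|t| <= c' -> `|s + t| <= c + c'.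
  by move=> ? ?; rewrite (le_trans (ler_normD _ _)) // lerD.
have dB : `|M 1 1| <= 2 + B * 2 * B.
  rewrite (_ : M 1 1 = p + - (M 1 0 * x)); last by rewrite /p; ring.
  by apply: add => //; rewrite normrN; exact: prod.
have aB : `|M 0 0| <= B * (B * 2 + B * 2).
  apply: divy; first by rewrite addr_ge0 ?mulr_ge0.
  by rewrite -q2; apply: add; exact: prod.
have bB : `|M 0 1| <= B * 2 + B * 2 + B * (B * 2 + B * 2) * B.
  rewrite (_ : M 0 1 = x' * p + - (y' * q) + - (M 0 0 * x)); last by lra.
  apply: add; last by rewrite normrN; exact: prod.
  have h1 : `|x' * p| <= B * 2 := prod _ _ _ _ xB' p2.
  have h2 : `|y' * q| <= B * 2 := prod _ _ _ _ yB' q2'.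
  by apply: (le_trans (ler_normB _ _)); exact: lerD.
have B2 : B <= B ^+ 2 by rewrite expr2 ler_peMl //; lra.
have B3 : B ^+ 2 <= B ^+ 3 by rewrite (exprS _ 2) ler_peMl // sqr_ge0.
have E2 : B ^+ 2 = B * B by rewrite expr2.
have E3 : B ^+ 3 = B * B * B by rewrite !exprS expr0; ring.
by apply: bounded_byP; lra.
Qed.

Lemma sqr_le_small (t e : R) : 0 < e -> e <= 1 -> - (2 * e) <= t <= 2 * e ->
  t ^+ 2 <= 4 * e.
Proof.
move=> e0 e1 /andP[t1 t2].
have : 0 <= (2 * e - t) * (2 * e + t) by apply: mulr_ge0; lra.
have : e * e <= e by rewrite ger_pMr.
by rewrite expr2; lra.
Qed.

Lemma norm_le2 (p q : R) : p ^+ 2 + q ^+ 2 <= 4 -> `|p| <= 2 /\ `|q| <= 2.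
Proof.
move=> h; have p0 := sqr_ge0 p; have q0 := sqr_ge0 q.
by split; rewrite -(@ler_pXn2r _ 2) ?nnegrE // real_normK ?num_real //; lra.
Qed.

(** Only elements with bounded entries can move a point near [z] to another
    one, and [displacement] bounds the displacements of these finitely
    many elements from below. *)
Lemma properly_discontinuous :
  (forall M, fuchsian_set G M -> ~ elliptic M) ->
  (forall M, fuchsian_set G M -> ~ parabolic M) ->
  forall z, exists2 U, nbhs z U & forall M w, fuchsian_set G M ->
    U w -> U (mob M w) -> psl_trivial M.
Proof.
move=> noE noP z.
have hyp M : fuchsian_set G M -> ~ psl_trivial M -> 2 < `|\tr M|.
  move=> hM nM; rewrite lt_neqAle; apply/andP; split.
    by apply/eqP => t2; apply: (noP _ hM).
  by rewrite leNgt; apply/negP; exact: noE.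
set x0 := complex.Re (val z); set y0 := complex.Im (val z).
have y00 : 0 < y0 := valP z.
pose B := `|x0| + 2 * y0 + 2 / y0 + 1.
have y0i : 0 < 2 / y0 by rewrite divr_gt0.
have B1 : 1 <= B by rewrite /B; have := normr_ge0 x0; lra.
have fin : finite_set [set M | (fuchsian_set G M /\ ~ psl_trivial M) /\
    bounded_by (10 * B ^+ 3) M].
  by apply: sub_finite_set (fuchsian_finite (10 * B ^+ 3)) => M [[? ?] ?].
have [m m0 hm] : exists2 m, 0 < m & forall M,
    (fuchsian_set G M /\ ~ psl_trivial M) /\ bounded_by (10 * B ^+ 3) M ->
    m <= (\tr M) ^+ 2 - 4.
  apply: (finite_pos_lb fin) => M [[hM nM] _].
  have := hyp _ hM nM; rewrite -(@real_normK _ (\tr M)) ?num_real //.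
  by have := normr_ge0 (\tr M); nra.
pose e := Num.min 1 (Num.min (y0 / 2) (y0 ^+ 2 * m / 200)).
have e0 : 0 < e by rewrite !lt_min ltr01 !divr_gt0 // mulr_gt0 // exprn_gt0.
have [e1 e2 e3] : [/\ e <= 1, e <= y0 / 2 & e <= y0 ^+ 2 * m / 200].
  by rewrite !ge_min !lexx !orbT.
move: (e) e0 e1 e2 e3 => {}e e0 e1 e2 e3.
pose U := [set w : half_plane R | `|x0 - complex.Re (val w)| < e /\
   `|y0 - complex.Im (val w)| < e].
exists U.
  have [c1 c2] := half_plane_val_continuous z.
  
  have n1 : nbhs z [set w : half_plane R | ball x0 e (complex.Re (val w))].
    exact: (c1 _ (nbhsx_ballx x0 e e0)).
  have n2 : nbhs z [set w : half_plane R | ball y0 e (complex.Im (val w))].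
    exact: (c2 _ (nbhsx_ballx y0 e e0)).
  by apply: filterS (filterI n1 n2) => w [].
move=> M w hM Uw UMw; apply: contrapT => nM.
have dM := fuchsian_det hM.
have [ux uy] := Uw; have [ux' uy'] := UMw; rewrite val_mob // in ux' uy'.
have yp : 0 < complex.Im (val w) := valP w.
move: yp ux uy ux' uy'; case: (val w) => x y.
case E : (mobius M (x +i* y)) => [x' y'] /= yp ux uy ux' uy'.
have disp := displacement dM yp E.
have [q1 q2 q3] := mob_coords dM yp E.
move: disp q1 q2 q3.
set p := M 1 0 * x + M 1 1; set q := M 1 0 * y => disp q1 q2 q3.
move: ux uy ux' uy'; rewrite !ltr_norml.
move=> /andP[x1 x2] /andP[y1 y2] /andP[x1' x2'] /andP[y1' y2'].
have yl : y0 / 2 <= y by lra.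
have yl' : y0 / 2 <= y' by lra.
have yi : B * y >= 1.
  have : 2 / y0 * y >= 1 by rewrite mulrAC ler_pdivlMr //; lra.
  by rewrite /B; have := normr_ge0 x0; nra.
have j4 : p ^+ 2 + q ^+ 2 <= 4.
  have := sqr_ge0 p; have := sqr_ge0 q; nra.
have bM : bounded_by (10 * B ^+ 3) M.
  have xB : `|x| <= B.
    rewrite ler_norml /B; have := ler_norm x0; have := ler_normB 0 x0.
    by rewrite sub0r normrN; have := ler_norm (- x0); rewrite normrN; lra.
  have xB' : `|x'| <= B.
    rewrite ler_norml /B; have := ler_norm x0.
    by have := ler_norm (- x0); rewrite normrN; lra.
  have yB' : `|y'| <= B.
    by rewrite ger0_norm /B; have := normr_ge0 x0; lra.
  have [p2 q2'] := norm_le2 j4.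
  exact: (coords_bounded B1 yp yi xB xB' yB' p2 q2' q1 q2).
have tm := hm M (conj (conj hM nM) bM).
have d8 : (x - x') ^+ 2 + (y - y') ^+ 2 <= 8 * e.
  rewrite (_ : 8 * e = 4 * e + 4 * e); last by ring.
  have close (s t t' : R) : - e < s - t -> s - t < e -> - e < s - t' ->
      s - t' < e -> (t - t') ^+ 2 <= 4 * e.
    by move=> *; apply: sqr_le_small => //; apply/andP; split; lra.
  by apply: lerD; [exact: close x1 x2 x1' x2'|exact: close y1 y2 y1' y2'].
move: x1 x2 y1 y2 x1' x2' y1' y2' yi j4 q1 q2 q3 => _ _ _ _ _ _ _ _ _ j4 _ _ _.
have low : y0 ^+ 2 / 4 * m <= y ^+ 2 * ((\tr M) ^+ 2 - 4).
  have ysq : y0 / 2 * (y0 / 2) <= y * y by apply: ler_pM => //; lra.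
  apply: ler_pM => //; first by rewrite divr_ge0 // sqr_ge0.
    exact: ltW.
  by rewrite !expr2; lra.
have up : ((x - x') ^+ 2 + (y - y') ^+ 2) * (p ^+ 2 + q ^+ 2) <= 8 * e * 4.
  by apply: ler_pM => //; apply: addr_ge0; exact: sqr_ge0.
have ym : 0 < y0 ^+ 2 * m by rewrite mulr_gt0 // exprn_gt0.
lra.
Qed.

End Discreteness.

(** * Path lifting and the fundamental group *)

Section Clamp.
Context {R : realType}.

Definition clamp (a b r : R) : R := Num.min (Num.max r a) b.

Lemma clamp_id a b r : a <= r -> r <= b -> clamp a b r = r.
Proof. by move=> ar rb; rewrite /clamp max_l // min_l. Qed.

Lemma clamp_ge a b r : a <= b -> a <= clamp a b r.
Proof. by move=> ab; rewrite /clamp le_min ab le_max lexx orbT. Qed.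

Lemma clamp_le a b r : clamp a b r <= b.
Proof. by rewrite /clamp ge_min lexx orbT. Qed.

Lemma clamp_continuous a b : continuous (clamp a b).
Proof.
move=> r; apply: (@continuous_min _ _ (fun r => Num.max r a) (fun=> b) r).
  by apply: (@continuous_max _ _ id (fun=> a) r); [exact: cvg_id|exact: cvg_cst].
exact: cvg_cst.
Qed.

(** For concatenating paths and for extending lifts. *)
Lemma continuous_glue (Y : topologicalType) (F F' : R -> Y) (s : R) :
  continuous F -> continuous F' -> F s = F' s ->
  continuous (fun r => if r <= s then F r else F' r).
Proof.
move=> cF cF' E r; case: (ltgtP r s) => rs.
- rewrite /continuous_at (ltW rs); apply: cvg_trans (cF r).
  have : nbhs r [set x | x < s] by apply: (nbhs_sublevel (f := id)).
  by move=> n; apply: near_eq_cvg; apply: filterS n => x /ltW ->.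
- rewrite /continuous_at leNgt rs /=; apply: cvg_trans (cF' r).
  apply: near_eq_cvg; apply: filterS (lt_nbhsr rs) => x sx.
  by rewrite leNgt sx.
- rewrite /continuous_at rs lexx => W /= nW.
  have n1 : nbhs s (F @^-1` W) := cF s W nW.
  have n2 : nbhs s (F' @^-1` W).
    by apply: (cF' s); rewrite -E.
  by apply: filterS (filterI n1 n2) => x [] /= h1 h2; case: ifP.
Qed.

End Clamp.

Section Covering.
Context {R : realType} (G : fuchsian R).
Hypothesis discontinuous : forall z : half_plane R, exists2 U, nbhs z U &
  forall M (w : half_plane R), fuchsian_set G M ->
    U w -> U (mob M w) -> psl_trivial M.
Implicit Types (M N : 'M[R]_2) (z w : half_plane R).

Definition surface_proj : half_plane R -> surface G := \pi_(surface G).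

Lemma surface_proj_continuous : continuous surface_proj.
Proof. exact: pi_continuous. Qed.

Lemma surface_proj_eq z w :
  surface_proj z = surface_proj w <-> exists2 M, fuchsian_set G M & mob M z = w.
Proof.
split.
  move/(@eqmodP _ (orbit_point_equiv G)) => /asboolP[M hM E]; exists M => //.
  by apply: val_inj; rewrite val_mob // (fuchsian_det hM).
move=> [M hM E]; apply/(@eqmodP _ (orbit_point_equiv G)); apply/asboolP.
by exists M => //; rewrite -E val_mob // (fuchsian_det hM).
Qed.

Lemma surface_proj_mob M z : fuchsian_set G M -> surface_proj (mob M z) = surface_proj z.
Proof. by move=> hM; apply/esym/surface_proj_eq; exists M. Qed.

Lemma surface_proj_open (U : set (half_plane R)) : open U -> open (surface_proj @` U).
Proof.
move=> oU.
have -> : open (surface_proj @` U) = open (surface_proj @^-1` (surface_proj @` U)) by [].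
have -> : surface_proj @^-1` (surface_proj @` U) = \bigcup_(M in fuchsian_set G) (mob M @^-1` U).
  apply/seteqP; split=> z /=.
    by move=> [w Uw /esym /surface_proj_eq[M hM Mz]]; exists M => //=; rewrite Mz.
  by move=> [M hM /= UMz]; exists (mob M z) => //; exact: surface_proj_mob.
apply: bigcup_open => M hM; apply: open_comp => //.
by move=> z _; apply: mob_continuous; exact: fuchsian_det hM.
Qed.

Lemma psl_trivial_mob M z : psl_trivial M -> mob M z = z.
Proof.
case=> ->; first exact: mob1.
have dN : \det (- 1%:M : 'M[R]_2) = 1.
  by rewrite det_mx22E !mxE /=; ring.
apply: val_inj; rewrite val_mob // /mobius /mobius_den !mxE /=.
rewrite ?mulr0n ?mulr1n oppr0 mul0r addr0 add0r rmorphN /= mulN1r.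
by rewrite invrN invr1 mulrN1 opprK.
Qed.

(** On a neighbourhood that no nontrivial element sends to meet itself, the
    projection is injective and open, so its inverse is continuous. *)
Lemma local_section (p : surface G) : exists V (s : surface G -> half_plane R),
  [/\ nbhs p V, forall q, V q -> surface_proj (s q) = q &
      forall q, V q -> {for q, continuous s}].
Proof.
pose z := repr p; have zp : surface_proj z = p := reprK p.
have [U' nU' hU'] := discontinuous z.
pose U := interior U'.
have oU : open U by exact: open_interior.
have Uz : U z by [].
have UU' w : U w -> U' w by exact: interior_subset.
pose s q := xget z [set w | U w /\ surface_proj w = q].
have sP q : (surface_proj @` U) q -> U (s q) /\ surface_proj (s q) = q.
  by move=> [w Uw wq]; rewrite /s; case: xgetP => [_ -> //|/(_ w) []].
exists (surface_proj @` U), s; split.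
- by apply: open_nbhs_nbhs; split; [exact: surface_proj_open|exists z].
- by move=> q /sP[].
move=> q Vq W nW; have [Uq qE] := sP _ Vq.
pose W' := interior W `&` U.
have : nbhs q (surface_proj @` W').
  apply: open_nbhs_nbhs; split.
    by apply: surface_proj_open; apply: openI => //; exact: open_interior.
  by exists (s q).
apply: filterS => q' [w [Ww Uw] wq'].
have [Uq' q'E] := sP q' ltac:(by exists w).
have /surface_proj_eq[M hM Mw] : surface_proj w = surface_proj (s q') by rewrite wq' q'E.
have tM : psl_trivial M.
  by apply: (hU' M w hM); [exact: UU'|rewrite Mw; exact: UU'].
by rewrite /= -Mw psl_trivial_mob //; exact: interior_subset.
Qed.

(** The lifts over initial segments extend a little further by a local section
    composed with the element that makes it agree with the lift already
    obtained; hence the supremum of the lengths of these segments is 1 and is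
    attained.  The path is defined on the whole line to avoid restrictions to
    subspaces. *)
Lemma path_lifting (f : R -> surface G) z : continuous f -> surface_proj z = f 0 ->
  exists F : R -> half_plane R, [/\ continuous F, F 0 = z &
    forall t, 0 <= t -> t <= 1 -> surface_proj (F t) = f t].
Proof.
move=> cf zf.
pose lifted t F := [/\ continuous (F : R -> half_plane R), F 0 = z &
  forall r, 0 <= r -> r <= t -> surface_proj (F r) = f r].
pose T := [set t | [/\ 0 <= t, t <= 1 & exists F, lifted t F]].
have T0 : T 0.
  split=> //; exists (fun=> z); split=> //; first by move=> ?; exact: cvg_cst.
  by move=> r r0 r1; rewrite (_ : r = 0) //; apply/eqP; rewrite eq_le r1.
have hsT : has_sup T by split; [exists 0|exists 1 => t []].
set c := sup T.
have c0 : 0 <= c by exact: (ub_le_sup hsT.2).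
have c1 : c <= 1 by apply: ge_sup; [exists 0|move=> t []].
have [V [s [nV sV cs]]] := local_section (f c).
have /nbhs_ballP[e /= e0 eV] := cf c _ nV.
have [t [t0 t1 [F [cF F0 FP]]] ct] := sup_adherent e0 hsT.
rewrite -/c in ct.
have tc : t <= c by apply: (ub_le_sup hsT.2); split=> //; exists F.
have Vf r : c - e < r -> r < c + e -> V (f r).
  by move=> r1 r2; apply: eV; rewrite /ball /= ltr_norml; apply/andP; split; lra.
have Vt : V (f t) by apply: Vf; lra.
have /surface_proj_eq[M hM MF] : surface_proj (s (f t)) = surface_proj (F t) by rewrite sV // FP.
have ext t' : t <= t' -> t' < c + e -> exists F, lifted t' F.
  move=> tt' te.
  pose F' r := mob M (s (f (clamp t t' r))).
  have cF' : continuous F'.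
    move=> r; have V1 : V (f (clamp t t' r)).
      by apply: Vf; [apply: lt_le_trans ct _; exact: clamp_ge|
        apply: le_lt_trans te; exact: clamp_le].
    have k1 : {for r, continuous (f \o clamp t t')}.
      by apply: continuous_comp; [exact: clamp_continuous|exact: cf].
    have k2 : {for r, continuous (s \o (f \o clamp t t'))}.
      by apply: continuous_comp; [exact: k1|exact: cs].
    have k3 : {for r, continuous (mob M \o (s \o (f \o clamp t t')))}.
      apply: continuous_comp; first exact: k2.
      exact: mob_continuous (fuchsian_det hM) _.
    exact: k3.
  exists (fun r => if r <= t then F r else F' r); split.
  - apply: continuous_glue => //; rewrite /F' clamp_id //.
  - by rewrite t0.
  - move=> r r0 rt'; case: (leP r t) => rt; first exact: FP.
    have rE : clamp t t' r = r by apply: clamp_id => //; exact: ltW.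
    rewrite /F' rE surface_proj_mob //; apply: sV.
    by apply: Vf; lra.
(* Beyond the supremum the lift extends, so that the supremum is at least 1. *)
case: (ltP 1 (c + e)) => ce.
  have [F1 [cF1 F10 F1P]] := ext 1 t1 ce.
  by exists F1.
have : T (c + e / 2).
  split; [lra|lra|apply: ext; lra].
by move=> /(ub_le_sup hsT.2); rewrite -/c; lra.
Qed.

End Covering.

Arguments surface_proj {R} G z.

Section FundamentalGroup.
Context {R : realType} (G : fuchsian R).
Implicit Types (M N : 'M[R]_2) (z w : half_plane R) (F : R -> half_plane R).

(** The parameter is clamped to [[0, 1]] so that the segment stays in the
    half-plane for all real values of it. *)
Definition segment (s : R) z w : half_plane R :=
  insubd z ((1 - clamp 0 1 s)%:C * val z + (clamp 0 1 s)%:C * val w).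

Lemma val_segment s z w : val (segment s z w) =
  (1 - clamp 0 1 s)%:C * val z + (clamp 0 1 s)%:C * val w.
Proof.
suff h : 0 < complex.Im ((1 - clamp 0 1 s)%:C * val z + (clamp 0 1 s)%:C * val w).
  by rewrite insubdK.
have : 0 < complex.Im (val z) := valP z; have : 0 < complex.Im (val w) := valP w.
have := @clamp_ge R 0 1 s ler01; have := @clamp_le R 0 1 s.
move: (clamp 0 1 s) => c; case: (val z) => x y; case: (val w) => x' y' /=.
move=> c1 c0 y0' y0. rewrite !mul0r !addr0.
case: (lerP c 2^-1) => c2.
  apply: ltr_wpDr; first by apply: mulr_ge0 => //; exact: ltW.
  by apply: mulr_gt0 => //; lra.
apply: ltr_wpDl; first by apply: mulr_ge0; [lra|exact: ltW].
by apply: mulr_gt0 => //; lra.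
Qed.

Lemma segment0 z w : segment 0 z w = z.
Proof. by apply: val_inj; rewrite val_segment clamp_id // subr0 mul1r mul0r addr0. Qed.

Lemma segment1 z w : segment 1 z w = w.
Proof.
by apply: val_inj; rewrite val_segment clamp_id // subrr mul1r mul0r add0r.
Qed.

Lemma segmentxx s z : segment s z z = z.
Proof.
apply: val_inj; rewrite val_segment -mulrDl -rmorphD /= subrK; exact: mul1r.
Qed.

Lemma segment_continuous (T : topologicalType) (a : T -> R)
    (f g : T -> half_plane R) : continuous a -> continuous f -> continuous g ->
  continuous (fun t => segment (a t) (f t) (g t)).
Proof.
move=> ca cf cg t; apply: continuous_at_half_plane.
under eq_fun do rewrite val_segment.
have cca : {for t, continuous (clamp 0 1 \o a)}.
  by apply: continuous_comp; [exact: ca|exact: clamp_continuous].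
have vc (h : T -> half_plane R) : continuous h ->
    ccontinuous_at t (fun y => val (h y)).
  move=> ch; have [v1 v2] := half_plane_val_continuous (h t).
  by split; [exact: (cvg_comp _ _ (ch t) v1)|exact: (cvg_comp _ _ (ch t) v2)].
apply: ccontinuousD; apply: ccontinuousM.
- apply: (ccontinuous_real (f := fun y => 1 - clamp 0 1 (a y))).
  by apply: cvgB; [exact: cvg_cst|exact: cca].
- exact: vc.
- exact: (ccontinuous_real (f := fun y => clamp 0 1 (a y))).
- exact: vc.
Qed.

(** The half-plane is convex, so that paths of the surface with lifts that
    have the same end points are homotopic. *)
Lemma lifts_homotopic (p : surface G) (f : R -> surface G) F F' :
  continuous F -> continuous F' ->
  (forall t, 0 <= t -> t <= 1 -> surface_proj G (F t) = f t) ->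
  F 0 = F' 0 -> F 1 = F' 1 -> surface_proj G (F 0) = p -> surface_proj G (F 1) = p ->
  loop_homotopic p f (fun t => surface_proj G (F' t)) /\
  loop_homotopic p (fun t => surface_proj G (F' t)) f.
Proof.
have main (F1 F2 : R -> half_plane R) (f1 f2 : R -> surface G) :
    continuous F1 -> continuous F2 ->
    (forall t, 0 <= t -> t <= 1 -> surface_proj G (F1 t) = f1 t) ->
    (forall t, 0 <= t -> t <= 1 -> surface_proj G (F2 t) = f2 t) ->
    F1 0 = F2 0 -> F1 1 = F2 1 -> surface_proj G (F1 0) = p -> surface_proj G (F1 1) = p ->
    loop_homotopic p f1 f2.
  move=> c1 c2 h1 h2 e0 e1 p0 p1.
  exists (fun q => surface_proj G (segment q.1 (F1 q.2) (F2 q.2))); split.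
  - apply: continuous_subspaceT => q.
    apply: continuous_comp; last exact: surface_proj_continuous.
    apply: segment_continuous => {}q; first exact: cvg_fst.
      by apply: continuous_comp; [exact: cvg_snd|exact: c1].
    by apply: continuous_comp; [exact: cvg_snd|exact: c2].
  - by move=> t; rewrite in_itv /= => /andP[t0 t1]; rewrite segment0 h1.
  - by move=> t; rewrite in_itv /= => /andP[t0 t1]; rewrite segment1 h2.
  - by move=> s _ /=; rewrite -e0 -e1 !segmentxx.
move=> cF cF' hf e0 e1 p0 p1; split; first exact: (main F F').
by apply: (main F' F) => //; rewrite -?e0 -?e1.
Qed.

Definition deck_loop z M : R -> surface G :=
  fun t => surface_proj G (segment t z (mob M z)).

Lemma deck_segment_continuous z w : continuous (fun t => segment t z w).
Proof.
apply: segment_continuous => t; [exact: cvg_id|exact: cvg_cst|exact: cvg_cst].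
Qed.

Lemma deck_loop_is_loop z M : fuchsian_set G M ->
  is_loop (surface_proj G z) (deck_loop z M).
Proof.
move=> hM; split; last by rewrite /deck_loop segment0 segment1 surface_proj_mob.
apply: continuous_subspaceT => t.
apply: continuous_comp; last exact: surface_proj_continuous.
exact: deck_segment_continuous.
Qed.

(** The loop of a product is homotopic to the concatenation of the loops of the
    factors, because both lift to paths from [z] to the image of [z]: the lift
    of the second factor is translated by the first factor. *)
Lemma deck_loop_generated z n (g : 'I_n -> R -> surface G) E :
  E `<=` fuchsian_set G ->
  (forall M, E M -> loop_generated (surface_proj G z) g (deck_loop z M)) ->
  forall M, generated_by E M ->
    fuchsian_set G M /\ loop_generated (surface_proj G z) g (deck_loop z M).
Proof.
move=> EG hE M; elim: M / => [M EM|M N _ [hM lM] _ [hN lN]|M _ [hM lM]].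
- by split; [exact: EG|exact: hE].
- have hMN := fuchsianM hM hN; split=> //.
  have [dM dN] := (fuchsian_det hM, fuchsian_det hN).
  (* The lift of the concatenation. *)
  pose F t := if t <= 2^-1 then segment (2 * t) z (mob M z)
    else mob M (segment (2 * t - 1) z (mob N z)).
  have c2 : continuous (fun t : R => 2 * t).
    by move=> t; apply: cvgM; [exact: cvg_cst|exact: cvg_id].
  have c21 : continuous (fun t : R => 2 * t - 1).
    by move=> t; apply: cvgB; [exact: c2|exact: cvg_cst].
  have cF : continuous F.
    apply: continuous_glue.
    + by apply: segment_continuous => // t; exact: cvg_cst.
    + move=> t; apply: continuous_comp; last exact: mob_continuous.
      by apply: segment_continuous => // r; exact: cvg_cst.
    + by rewrite divff // subrr segment1 segment0.
  have F0 : F 0 = z by rewrite /F ifT ?mulr0 ?segment0 // invr_ge0.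
  have F1 : F 1 = mob (M *m N) z.
    rewrite /F ifF; last by apply/negbTE; rewrite -ltNge; lra.
    by rewrite mulr1 (_ : 2 - 1 = 1) ?segment1 ?mobM //; lra.
  apply: (loop_generated_homotopic (loop_generated_mul lM lN)).
  have [|||||||h _] := @lifts_homotopic (surface_proj G z)
    (loop_concat (deck_loop z M) (deck_loop z N)) F
    (fun t => segment t z (mob (M *m N) z)) => //.
  + exact: deck_segment_continuous.
  + move=> t _ _; rewrite /F /loop_concat; case: ifP => // _.
    by rewrite surface_proj_mob.
  + by rewrite F0 segment0.
  + by rewrite F1 segment1.
  + by rewrite F0.
  + by rewrite F1 surface_proj_mob.
- have hV := fuchsianV hM; split=> //.
  have dM := fuchsian_det hM.
  pose F t := mob (invmx M) (segment (1 - t) z (mob M z)).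
  have cF : continuous F.
    move=> t; apply: continuous_comp; last exact: mob_continuous (det_invmx1 dM) _.
    apply: segment_continuous => r; [|exact: cvg_cst|exact: cvg_cst].
    by apply: cvgB; [exact: cvg_cst|exact: cvg_id].
  have F0 : F 0 = z by rewrite /F subr0 segment1 mobK.
  have F1 : F 1 = mob (invmx M) z by rewrite /F subrr segment0.
  apply: (loop_generated_homotopic (loop_generated_inv lM)).
  have [|||||||h _] := @lifts_homotopic (surface_proj G z)
    (loop_inverse (deck_loop z M)) F
    (fun t => segment t z (mob (invmx M) z)) => //.
  + exact: deck_segment_continuous.
  + by move=> t _ _; rewrite /F surface_proj_mob.
  + by rewrite F0 segment0.
  + by rewrite F1 segment1.
  + by rewrite F0.
  + by rewrite F1 surface_proj_mob.
Qed.

Lemma finitely_generated_geometrically_finite (E : set 'M[R]_2) :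
  (forall z : half_plane R, exists2 U, nbhs z U &
    forall M w, fuchsian_set G M -> U w -> U (mob M w) -> psl_trivial M) ->
  finite_set E -> E `<=` fuchsian_set G ->
  (forall M, fuchsian_set G M -> generated_by E M) -> geometrically_finite G.
Proof.
move=> disc /finite_seqP[s Es] EG gen p.
pose z := repr p; have <- : surface_proj G z = p := reprK p.
exists (size s), (fun i => deck_loop z (nth 1%:M s i)); split.
  move=> i; apply: deck_loop_is_loop; apply: EG; rewrite Es /=.
  exact: mem_nth.
move=> f [cf [f0 f1]].
pose f' t := f (clamp 0 1 t).
have cf' : continuous f'.
  move=> t W nW.
  have cI : `[0, 1]%classic (clamp 0 1 t).
    by rewrite /= in_itv /= clamp_ge // clamp_le.
  have : within `[0, 1]%classic (nbhs (clamp 0 1 t)) (f @^-1` W).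
    have := cf (clamp 0 1 t) W nW.
    by rewrite /= nbhs_subspace_in.
  move=> fW; have : nbhs t [set r | `[0, 1]%classic (clamp 0 1 r) ->
      W (f (clamp 0 1 r))] := @clamp_continuous R 0 1 t _ fW.
  apply: filterS => r /=; apply.
  by rewrite in_itv /= clamp_ge // clamp_le.
have f'E t : 0 <= t -> t <= 1 -> f' t = f t.
  by move=> t0 t1; rewrite /f' clamp_id.
have [|F [cF F0 FP]] := path_lifting disc cf' (z := z).
  by rewrite f'E // f0.
have /surface_proj_eq[M hM Mz] : surface_proj G z = surface_proj G (F 1) by rewrite FP // f'E // f1.
have lE N : E N -> loop_generated (surface_proj G z)
    (fun i : 'I_(size s) => deck_loop z (nth 1%:M s i)) (deck_loop z N).
  rewrite Es /= => Ns; have iN : (index N s < size s)%N by rewrite index_mem.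
  have := loop_generated_gen (surface_proj G z)
    (fun i : 'I_(size s) => deck_loop z (nth 1%:M s i)) (Ordinal iN).
  by rewrite /= nth_index.
have [_ lM] := deck_loop_generated EG lE (gen _ hM).
apply: (loop_generated_homotopic lM).
have [|||||||_ h] := @lifts_homotopic (surface_proj G z) f F
  (fun t => segment t z (mob M z)) => //.
- exact: deck_segment_continuous.
- by move=> t t0 t1; rewrite FP // f'E.
- by rewrite F0 segment0.
- by rewrite segment1.
- by rewrite F0.
- by rewrite FP // f'E // f1.
Qed.

End FundamentalGroup.

(** * Weakly tame groups are recurrent *)

Section Tameness.
Context {R : realType} (G : fuchsian R).
Implicit Types (M N P g h k : 'M[R]_2).

(** The hyperbolic cosine of the distance, minus 1. *)
Definition sdist (z w : R[i]) : R :=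
  normc (z - w) ^+ 2 / (2 * complex.Im z * complex.Im w).

Lemma sdist_ge0 (z w : R[i]) :
  in_half_plane z -> in_half_plane w -> 0 <= sdist z w.
Proof.
rewrite /in_half_plane => z0 w0; rewrite /sdist divr_ge0 ?sqr_ge0 //.
by rewrite !mulr_ge0 // ltW.
Qed.

Lemma sdist_mobius M (z w : R[i]) : \det M = 1 ->
  in_half_plane z -> in_half_plane w ->
  sdist (mobius M z) (mobius M w) = sdist z w.
Proof.
move=> dM z0 w0; rewrite /sdist !mobius_ImE //.
have dz := mobius_den_neq0 dM z0; have dw := mobius_den_neq0 dM w0.
have E : mobius M z - mobius M w =
    (z - w) / (mobius_den M z * mobius_den M w).
  have dC : (M 0 0)%:C * (M 1 1)%:C - (M 0 1)%:C * (M 1 0)%:C = 1 :> R[i].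
    by rewrite -!rmorphM -rmorphB /= -det_mx22E dM.
  rewrite -[in RHS](mul1r (z - w)) -dC; move: dz dw; rewrite /mobius /mobius_den.
  by move=> dz dw; field; rewrite dz dw.
rewrite E Normc.normcM Normc.normcV Normc.normcM.
have := normc_gt0 dz; have := normc_gt0 dw.
move: z0 w0; rewrite /in_half_plane => z0 w0 nw nz.
by field; rewrite !gt_eqF.
Qed.

Lemma sdist_up P : \det P = 1 -> 1 + sdist 'i (mobius P 'i) = frob P / 2.
Proof.
move=> dP.
have E : mobius P 'i = (val (mobt P (@up R))).1 by rewrite val_mobt.
rewrite E val_mobt_up //= /sdist normc_sqr /=.
have := row_nsq_gt0 dP; rewrite det_mx22E in dP.
set n := _ + _ => n0.
set X := P 0 0 * P 1 0 + P 0 1 * P 1 1.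
have XE : X ^+ 2 = (P 0 0 ^+ 2 + P 0 1 ^+ 2) * n - 1.
  have -> : 1 = (P 0 0 * P 1 1 - P 0 1 * P 1 0) ^+ 2 by rewrite dP expr1n.
  by rewrite /X /n; ring.
rewrite /frob -/n (_ : 0 - X / n = - (X / n)) ?sub0r // sqrrN exprMn XE.
by field; rewrite gt_eqF.
Qed.

(** For [k] a frame at a point, conjugating by [k] reduces the displacement of
    that point to the displacement of ['i], which is given by the Frobenius
    norm. *)
Lemma sdist_conj k M : \det k = 1 -> \det M = 1 ->
  1 + sdist (mobius k 'i) (mobius M (mobius k 'i)) =
  frob (invmx k *m M *m k) / 2.
Proof.
move=> dk dM; have dP : \det (invmx k *m M *m k) = 1.
  by rewrite !det_mulmx det_inv dM dk invr1 !mul1r.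
have i0 : in_half_plane ('i : R[i]) by rewrite /in_half_plane /= ltr01.
rewrite -sdist_up // -[in RHS](sdist_mobius dk) //; last exact: mobius_half_plane.
have d1 : mobius_den k 'i != 0 by exact: mobius_den_neq0.
have d2 : mobius_den (invmx k *m M *m k) 'i != 0 by exact: mobius_den_neq0.
rewrite -!mobiusM //.
by rewrite !mulmxA mulmxV ?mul1mx // det1_unit.
Qed.

Lemma arcosh_lt (x C : R) : 1 <= x -> arcosh x < C -> x < expR C.
Proof.
move=> x1; rewrite /arcosh => h.
have s0 := sqrtr_ge0 (x ^+ 2 - 1).
have p : 0 < x + Num.sqrt (x ^+ 2 - 1) by lra.
rewrite -ltr_expR lnK // in h; lra.
Qed.

(** The representative of a point of the surface used by the injectivity radius
    differs from the point of the chosen geodesic by an element of the group,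
    by which the almost minimizing element is conjugated. *)
Lemma tame_displacement g : \det g = 1 -> weakly_tame G ->
  exists C, forall T, exists t M, [/\ T < t, fuchsian_set G M, ~ psl_trivial M &
    let k := g *m dilat (expR (t / 2)) in frob (invmx k *m M *m k) < C].
Proof.
move=> dg /(_ (\pi_(unit_tangent_surface G) (mobt g (@up R)))).
rewrite /liminf_inj_radius limf_einfE.
set f := (fun t : R => _); set L := ereal_sup _ => L1.
have [C LC] : exists C : R, (L < C%:E)%E.
  move: L1; case: L => [r| |] //; last by exists 0; rewrite ltNyr.
  by move=> _; exists (r + 1); rewrite lte_fin ltrDl.
exists (2 * expR C) => T.
pose V : set R := [set t | T < t].
have LV : (ereal_inf (f @` V) <= L)%E.
  apply: ereal_sup_ubound; exists V => //.
  by exists T; split=> //; exact: num_real.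
have /ereal_inf_lt[_ [t /= Tt <-]] := le_lt_trans LV LC.
rewrite /f surface_geodesic_flow_pi surface_base_point_pi geodesic_flow_frame //.
have e0 : expR (t / 2) != 0 by rewrite gt_eqF // expR_gt0.
set h := g *m _; have dh : \det h = 1 by rewrite det_mul1 // dilat_det.
set z := base_point _.
have zE : val z = mobius h 'i by rewrite /= val_mobt.
rewrite /inj_radius => /ereal_inf_lt[_ [M [hM nM] <-]].
have : \pi_(surface G) z = \pi_(surface G) (repr (\pi_(surface G) z)).
  by rewrite reprK.
move=> /(@eqmodP _ (orbit_point_equiv G)) /asboolP[N hN NE].
have [dM dN] := (fuchsian_det hM, fuchsian_det hN).
have i0 : in_half_plane ('i : R[i]) by rewrite /in_half_plane /= ltr01.
rewrite -NE zE lte_fin /hdist -mobiusM; last exact: mobius_den_neq0.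
have dNh := det_mul1 dN dh.
rewrite -/(sdist _ _) sdist_conj // => small.
exists t, (invmx N *m M *m N); split=> //.
- by apply: fuchsianM => //; apply: fuchsianM => //; exact: fuchsianV.
- move=> nt; apply: nM; apply: (psl_trivial_conj (g := invmx N)).
    exact: det_invmx1.
  by rewrite invmxK.
rewrite /=.
have E : invmx h *m (invmx N *m M *m N) *m h = invmx (N *m h) *m M *m (N *m h).
  by rewrite invmx_mul1 // -!mulmxA.
rewrite E /frob; set F := frob _ in small.
have F1 : 1 <= F / 2.
  have dP : \det (invmx (N *m h) *m M *m (N *m h)) = 1.
    by rewrite det_mul1 // det_mul1 // det_invmx1.
  rewrite /F -sdist_up //.
  by rewrite lerDl sdist_ge0 // mobius_half_plane.
have := arcosh_lt F1 small; rewrite -/(frob _) -/F; lra.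
Qed.

Lemma fuchsian_recurrent :
  (forall M, fuchsian_set G M -> ~ elliptic M) ->
  (forall M, fuchsian_set G M -> ~ parabolic M) ->
  weakly_tame G -> recurrent_group (fuchsian_set G).
Proof.
move=> noE noP tame; split.
- exact: fuchsian_det.
- exact: fuchsianN.
- exact: fuchsianM.
- exact: fuchsianV.
- exact: fuchsian_finite.
- move=> M hM nM; rewrite lt_neqAle; apply/andP; split.
    by apply/eqP => t2; apply: (noP _ hM).
  by rewrite leNgt; apply/negP; exact: noE.
move=> g dg; have [C hC] := tame_displacement dg tame.
pose K := Num.max 1 C; exists K => T.
have [t [M [Tt hM nM small]]] := hC T.
exists (expR t), M; split=> //.
  by rewrite ltW // (lt_le_trans Tt) // (le_trans _ (expR_ge1Dx t)) // lerDr.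
have K1 : 1 <= K by rewrite le_max lexx.
have CK : C <= K by rewrite le_max lexx orbT.
have et : expR t = expR (t / 2) ^+ 2 by rewrite expr2 -expRD; congr expR; field.
have e0 := expR_gt0 (t / 2).
move: small; rewrite et; move: (expR (t / 2)) e0 => e e0 small.
have ne : e != 0 by rewrite gt_eqF.
have dd := dilat_det ne.
have PE : invmx (g *m dilat e) *m M *m (g *m dilat e) =
    invmx (dilat e) *m (invmx g *m M *m g) *m dilat e.
  by rewrite invmx_mul1 // -!mulmxA.
rewrite /= PE in small; rewrite /=.
have := frob_bounded K1 (ltW (lt_le_trans small CK)).
move: (invmx g *m M *m g) => N bN {small PE}.
have := (bN 0 0, bN 0 1, bN 1 0, bN 1 1).
rewrite !mulmx2E (invmx_det1 dd) !mx2E.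
move=> [[[h1 h2] h3] h4]; split.
- apply: le_trans h1; rewrite (_ : _ + _ = N 0 0) //; by field.
- apply: le_trans h4; rewrite (_ : _ + _ = N 1 1) //; by field.
- rewrite -ler_pdivrMr ?exprn_gt0 //.
  have -> : `|N 0 1| / e ^+ 2 = `|N 0 1 / e ^+ 2|.
    by rewrite normrM normfV normrX (gtr0_norm e0).
  apply: le_trans h2; rewrite (_ : _ + _ = N 0 1 / e ^+ 2) //; by field.
- rewrite ler_pdivlMr ?exprn_gt0 //.
  have -> : `|N 1 0| * e ^+ 2 = `|N 1 0 * e ^+ 2|.
    by rewrite normrM normrX (gtr0_norm e0).
  apply: le_trans h3; rewrite (_ : _ + _ = N 1 0 * e ^+ 2) //; by field.
Qed.

End Tameness.

(** * Minimal sets and their vectors *)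

Section MinimalSets.
Context {R : realType} (G : fuchsian R)
  (A : set (unit_tangent_surface G)).
Hypothesis minA : minimal_horocycle_set A.
Implicit Types (M g h : 'M[R]_2) (v w : R * R) (u : unit_tangent R).

Definition tangent_proj u : unit_tangent_surface G :=
  \pi_(unit_tangent_surface G) u.

Lemma tangent_proj_eq u (w : unit_tangent R) :
  tangent_proj u = tangent_proj w <->
  exists2 M, fuchsian_set G M & mobt M u = w.
Proof.
split.
  move/(@eqmodP _ (orbit_tangent_equiv G)) => /asboolP[M hM E]; exists M => //.
  by apply: val_inj; rewrite val_mobt // (fuchsian_det hM).
move=> [M hM E]; apply/(@eqmodP _ (orbit_tangent_equiv G)); apply/asboolP.
by exists M => //; rewrite -E val_mobt // (fuchsian_det hM).
Qed.

Lemma exists_tangent_frame (x : unit_tangent_surface G) :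
  exists2 g, \det g = 1 & x = tangent_proj (mobt g (@up R)).
Proof.
have [g dg E] := exists_frame (repr x); exists g => //.
by rewrite -E /tangent_proj reprK.
Qed.

(** The horocycle orbits of the unit tangent bundle are the vectors of the
    plane up to sign: the orbit of a frame is its first column. *)
Definition vectors : set (R * R) :=
  [set v | v != 0 /\ A (tangent_proj (frame_up v))].

Lemma column_neq0 g : \det g = 1 -> (g 0 0, g 1 0) != 0.
Proof.
rewrite det_mx22E => dg; apply/eqP => -[a0 c0].
by move: dg; rewrite a0 c0 mul0r mulr0 subr0 => /eqP; rewrite eq_sym oner_eq0.
Qed.

Lemma same_column g h : \det g = 1 -> \det h = 1 ->
  g 0 0 = h 0 0 -> g 1 0 = h 1 0 -> exists s, h = g *m unip s.
Proof.
move=> dg dh a c; exists (g 1 1 * h 0 1 - g 0 1 * h 1 1).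
rewrite det_mx22E in dg; rewrite det_mx22E -a -c in dh.
apply: mx2P; rewrite mulmx2E !mx2E.
- by rewrite -a; ring.
- rewrite (_ : _ + _ = h 0 1 * (g 0 0 * g 1 1 - g 0 1 * g 1 0) + g 0 1 *
    (1 - (g 0 0 * h 1 1 - h 0 1 * g 1 0))); last by ring.
  by rewrite dg dh; ring.
- by rewrite -c; ring.
rewrite (_ : _ + _ = h 1 1 * (g 0 0 * g 1 1 - g 0 1 * g 1 0) + g 1 1 *
  (1 - (g 0 0 * h 1 1 - h 0 1 * g 1 0))); last by ring.
by rewrite dg dh; ring.
Qed.

Lemma frame_vectors g : \det g = 1 ->
  A (tangent_proj (mobt g (@up R))) <-> vectors (g 0 0, g 1 0).
Proof.
move=> dg; have v0 := column_neq0 dg; have df := frame_det v0.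
have [[_ _ inv] _] := minA.
have flow h k s : \det h = 1 -> k = h *m unip s ->
    A (tangent_proj (mobt h (@up R))) -> A (tangent_proj (mobt k (@up R))).
  move=> dh -> /(inv s); rewrite surface_horocycle_flow_pi.
  by rewrite horocycle_flow_frame.
split.
  move=> Ag; split=> //.
  have [s sE] := same_column dg df (esym (mx2E _ _ _ _).1.1)
    (esym (mx2E _ _ _ _).2.1).
  exact: flow sE Ag.
move=> [_ Av].
have [s sE] := same_column df dg (mx2E _ _ _ _).1.1 (mx2E _ _ _ _).2.1.
exact: flow sE Av.
Qed.

Lemma preimage_closed : closed (tangent_proj @^-1` A).
Proof.
have [[_ cA _] _] := minA.
by apply: closed_comp => // u _; exact: pi_continuous.
Qed.

Lemma vectors_invariant_closed : invariant_closed (fuchsian_set G) vectors.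
Proof.
split; first by move=> v [].
- move=> M v hM [v0 Av]; have dM := fuchsian_det hM; have df := frame_det v0.
  have : A (tangent_proj (mobt (M *m frame v) (@up R))).
    rewrite mobtM // (_ : tangent_proj _ = tangent_proj (frame_up v)) //.
    by apply/esym/tangent_proj_eq; exists M.
  move=> /(frame_vectors (det_mul1 dM df)).
  by rewrite !mulmx2E !mx2E.
move=> p p0 hp; split=> //; apply: contrapT => nA.
have nW : nbhs (frame_up p) (~` (tangent_proj @^-1` A)).
  by apply: open_nbhs_nbhs; split=> //; exact: closed_openC preimage_closed.
have : nbhs p [set v | ~ A (tangent_proj (frame_up v))].
  exact: (frame_up_continuous p0 nW).
move=> /nbhs_ballP[e /= e0 eA]; have [v [[v0 Av] h1 h2]] := hp e e0.
by apply: (eA v) => //; split; rewrite /ball /= distrC.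
Qed.

Lemma vectors_nonempty : vectors !=set0.
Proof.
have [[[x Ax] _ _] _] := minA; have [g dg xE] := exists_tangent_frame x.
by exists (g 0 0, g 1 0); apply/frame_vectors; rewrite -?xE.
Qed.

Lemma minimal_subset (B : set (unit_tangent_surface G)) :
  nonempty_closed_invariant B -> B `<=` A -> A `<=` B.
Proof.
move=> hB BA; apply: contrapT => nAB; have [_ /(_ B)] := minA; apply.
by split=> //; split.
Qed.

(** The points of the minimal set that the geodesic flow keeps in it at a given
    time form a closed invariant subset; it is everything as soon as it
    contains one point. *)
Lemma vectors_scaling r v : 0 < r -> vectors v -> vectors (r *: v) ->
  forall w, vectors w -> vectors (r *: w).
Proof.
move=> r0 vv rv w vw.
pose t := 2 * ln r.
have rE : expR (t / 2) = r by rewrite /t mulrC mulKf ?pnatr_eq0 // lnK.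
have rn : r != 0 by rewrite gt_eqF.
have flowE g : \det g = 1 ->
    A (surface_geodesic_flow t (tangent_proj (mobt g (@up R)))) <->
    vectors (r *: (g 0 0, g 1 0)).
  move=> dg; rewrite surface_geodesic_flow_pi geodesic_flow_frame // rE.
  have dd := dilat_det rn.
  rewrite (_ : r *: (g 0 0, g 1 0) =
    ((g *m dilat r) 0 0, (g *m dilat r) 1 0)); last first.
    by rewrite !mulmx2E !mx2E !mulr0 !addr0 ![_ * r]mulrC.
  by apply: frame_vectors; rewrite det_mul1.
have [[_ cA inv] _] := minA.
pose B := A `&` surface_geodesic_flow t @^-1` A.
have BE g : \det g = 1 -> B (tangent_proj (mobt g (@up R))) <->
    vectors (g 0 0, g 1 0) /\ vectors (r *: (g 0 0, g 1 0)).
  move=> dg; split.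
    by move=> [/(frame_vectors dg) h1 /(flowE _ dg) h2].
  by move=> [/(frame_vectors dg) h1 /(flowE _ dg) h2].
have hB : nonempty_closed_invariant B.
  split.
  - have v0 : v != 0 by case: vv.
    exists (tangent_proj (frame_up v)); apply/(BE _ (frame_det v0)).
    by rewrite !mx2E -surjective_pairing.
  - apply: closedI => //; apply: closed_comp => // x _.
    suff : continuous (@surface_geodesic_flow R G t) by exact.
    apply/quotient_continuous => u.
    rewrite (_ : _ \o _ = tangent_proj \o geodesic_flow t); last first.
      by apply/funext => w0; rewrite /= surface_geodesic_flow_pi.
    apply: continuous_comp; first exact: geodesic_flow_continuous.
    exact: pi_continuous.
  - move=> s x; have [g dg ->] := exists_tangent_frame x.
    rewrite surface_horocycle_flow_pi horocycle_flow_frame //.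
    move=> /(BE _ dg) Bg; apply/BE; first by rewrite det_mul1 // unip_det.
    by rewrite !mulmx2E !mx2E !mulr1 !mulr0 !addr0.
have w0 : w != 0 by case: vw.
have : B (tangent_proj (frame_up w)).
  by apply: (minimal_subset hB) => [x []//|]; case: vw.
by move=> /(BE _ (frame_det w0)); rewrite !mx2E -surjective_pairing => -[].
Qed.

(** The points of the minimal set with no lift of small height form a closed
    invariant subset, which is proper, hence empty. *)
Lemma vectors_shrink (e : R) v : vectors v -> nsq v < e ->
  forall w, vectors w -> exists M, fuchsian_set G M /\ nsq (act M w) < e.
Proof.
move=> vv ve w vw; apply: contrapT => /forallNP hw.
have [[_ cA inv] _] := minA.
pose B := A `&` [set x | forall u, tangent_proj u = x -> e <= height (val u)].
have BE g : \det g = 1 -> B (tangent_proj (mobt g (@up R))) <->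
    vectors (g 0 0, g 1 0) /\
    forall M, fuchsian_set G M -> e <= nsq (act M (g 0 0, g 1 0)).
  move=> dg.
  have colE M : fuchsian_set G M ->
      height (val (mobt M (mobt g (@up R)))) = nsq (act M (g 0 0, g 1 0)).
    move=> hM; have dM := fuchsian_det hM.
    by rewrite -mobtM // height_frame ?det_mul1 // !mulmx2E.
  split.
    move=> [/(frame_vectors dg) h1 h2]; split=> // M hM.
    rewrite -colE //; apply: h2; apply/esym/tangent_proj_eq.
    by exists M.
  move=> [/(frame_vectors dg) h1 h2]; split=> // u /esym/tangent_proj_eq[M hM <-].
  by rewrite colE //; exact: h2.
have hB : nonempty_closed_invariant B.
  split.
  - have w0 : w != 0 by case: vw.
    exists (tangent_proj (frame_up w)); apply/(BE _ (frame_det w0)).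
    rewrite !mx2E -surjective_pairing; split=> // M hM.
    by rewrite leNgt; apply/negP => h; apply: (hw M).
  - have -> : closed B = closed (~` (~` B)) by rewrite setCK.
    apply: open_closedC.
    suff : open (tangent_proj @^-1` (~` B)) by [].
    have -> : tangent_proj @^-1` (~` B) = tangent_proj @^-1` (~` A) `|`
        \bigcup_(M in fuchsian_set G)
          (mobt M @^-1` [set u | height (val u) < e]).
      apply/seteqP; split=> u /=.
        move=> nB; case: (pselect (A (tangent_proj u))) => Au; last by left.
        right; apply: contrapT => nU; apply: nB; split=> // u'.
        move=> /esym/tangent_proj_eq[M hM <-]; rewrite leNgt; apply/negP => h.
        by apply: nU; exists M.
      move=> [nA [] //|[M hM hu] [_ /(_ (mobt M u))]].
      rewrite /= in hu; rewrite leNgt hu => hB; suff : false by [].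
      by apply: hB; apply/esym/tangent_proj_eq; exists M.
    apply: openU.
      exact: closed_openC preimage_closed.
    apply: bigcup_open => M hM; apply: open_comp.
      by move=> u _; apply: mobt_continuous; exact: fuchsian_det hM.
    rewrite openE => u hu.
    exact: (nbhs_sublevel (@height_continuous R u) hu).
  - move=> s x; have [g dg ->] := exists_tangent_frame x.
    rewrite surface_horocycle_flow_pi horocycle_flow_frame //.
    move=> /(BE _ dg) Bg; apply/BE; first by rewrite det_mul1 // unip_det.
    by rewrite !mulmx2E !mx2E !mulr1 !mulr0 !addr0.
have v0 : v != 0 by case: vv.
have : B (tangent_proj (frame_up v)).
  by apply: (minimal_subset hB) => [x []//|]; case: vv.
move=> /(BE _ (frame_det v0)); rewrite !mx2E -surjective_pairing => -[_].
by move=> /(_ _ (fuchsian1 G)); rewrite act1 leNgt ve.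
Qed.

Lemma minimal_contraction : recurrent_group (fuchsian_set G) ->
  forall v, v != 0 ->
    exists M, fuchsian_set G M /\ nsq (act M v) < 4^-1 * nsq v.
Proof.
move=> rG; have HS := vectors_invariant_closed.
have [v0 vv0] := vectors_nonempty.
have [r0 [r00 r01 rv0]] := recurrent_scaling rG HS vv0.
have scale r : 0 < r -> r != 1 -> vectors (r *: v0) -> 1 < r ->
    scale_invariant r vectors.
  move=> rp r1 rv _ w vw; split; first exact: (vectors_scaling rp vv0 rv).
  apply: (vectors_scaling _ rv _ vw); first by rewrite invr_gt0.
  by rewrite scalerA mulVf ?gt_eqF // scale1r.
have [r r1 hr] : exists2 r, 1 < r & scale_invariant r vectors.
  case: (ltrP 1 r0) => r1; first by exists r0 => //; exact: scale.
  exists r0^-1; first by rewrite invf_gt1 // lt_neqAle r01.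
  have h w : vectors w -> vectors (r0 *: w) /\ vectors (r0^-1 *: w).
    move=> vw; split; first exact: (vectors_scaling r00 vv0 rv0).
    apply: (vectors_scaling _ rv0 _ vw); first by rewrite invr_gt0.
    by rewrite scalerA mulVf ?gt_eqF // scale1r.
  by move=> w /h []; rewrite invrK.
have rp : 0 < r by lra.
have small e : 0 < e -> exists2 v, vectors v & nsq v < e.
  move=> e0; have dn n : vectors (r ^- n *: v0).
    elim: n => [|n ih]; first by rewrite expr0 invr1 scale1r.
    by rewrite exprS invfM -scalerA; have [] := hr _ ih.
  have bern n : 1 + n%:R * (r - 1) <= r ^+ n.
    elim: n => [|n ih]; first by rewrite mul0r addr0 expr0.
    have sq : 0 <= n%:R * (r - 1) ^+ 2 by rewrite mulr_ge0 // sqr_ge0.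
    rewrite exprS -natr1; have := ler_wpM2l (ltW rp) ih.
    by apply: le_trans; rewrite expr2 in sq; lra.
  have [n hn] : exists n : nat, nsq v0 / e / (r - 1) < n%:R.
    by exists (Num.truncn (nsq v0 / e / (r - 1))).+1; rewrite truncnS_gt.
  exists (r ^- n *: v0); first exact: dn.
  rewrite ltr_pdivrMr ?subr_gt0 // in hn.
  have rn : nsq v0 / e < r ^+ n by have := bern n; lra.
  rewrite ltr_pdivrMr // in rn.
  have X0 : 0 < r ^+ n by rewrite exprn_gt0.
  have X1 : 1 <= r ^+ n by rewrite exprn_ege1 // ltW.
  rewrite nsqZ; move: (r ^+ n) X0 X1 rn => X X0 X1 rn.
  rewrite exprVn mulrC ltr_pdivrMr ?exprn_gt0 // expr2.
  by apply: (lt_le_trans rn); rewrite mulrC ler_pM2l // ler_peMl // ltW.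
move=> v vn0; have [q vq] := all_directions rG HS r1 hr vectors_nonempty vn0.
have qv0 := ic_neq0 HS vq.
have e0 : 0 < 4^-1 * nsq (q *: v) by rewrite mulr_gt0 // nsq_gt0.
have [v1 vv1 v1s] := small _ e0.
have [M [hM Mv]] := vectors_shrink vv1 v1s vq.
exists M; split=> //.
have q0 : 0 < q ^+ 2.
  rewrite lt0r sqr_ge0 andbT sqrf_eq0; apply: contraNneq qv0 => ->.
  by rewrite scale0r.
by rewrite actZ !nsqZ mulrCA ltr_pM2l // in Mv.
Qed.

End MinimalSets.

Theorem corollary1p2 (R : realType) (G : fuchsian R)
  (no_elliptic : forall M, fuchsian_set G M -> ~ elliptic M)
  (no_parabolic : forall M, fuchsian_set G M -> ~ parabolic M)
  (geometrically_infinite : ~ geometrically_finite G)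
  (tame : weakly_tame G) :
  ~ exists A : set (unit_tangent_surface G), minimal_horocycle_set A.
Proof.
move=> [A minA]; apply: geometrically_infinite.
have rG := fuchsian_recurrent no_elliptic no_parabolic tame.
have [C gen] := contraction_generated (@fuchsian_det R G) (@fuchsianM R G)
  (minimal_contraction minA rG).
apply: (finitely_generated_geometrically_finite _ (fuchsian_finite G C) _ gen).
  exact: properly_discontinuous.
by move=> M [].
Qed.
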